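(* Let $n\ge 1$, let $\Sigma\subset\mathbb{S}^{2n}_+$ be a spherical cap, and let $\rho_\Sigma=\phi^{-1}(\alpha_\Sigma)\in[0,2\pi]$, where $\phi:[0,2\pi]\to[0,+\infty]$ is the order-reversing diffeomorphism defined by $$\phi(r)=\frac{4(1-\cos r)}{r-\sin r}\qquad(\phi(0)=+\infty).$$ Then $$\frac{n^2\rho_\Sigma^2}{4}\ \le\ c_n^\perp(\Sigma)\ \le\ \pi^2n^2 .$$
   Context: The Heisenberg group $\mathbb{H}^n$ is $\mathbb{R}^{2n+1}$ with points $(x,y,z)\in\mathbb{R}^n\times\mathbb{R}^n\times\mathbb{R}$, endowed with the sub-Riemannian structure whose (horizontal) distribution $\mathcal{D}$ has orthonormal frame $$X_i=\partial_{x_i}-\frac{y_i}{2}\partial_z,\qquad Y_i=\partial_{y_i}+\frac{x_i}{2}\partial_z,\qquad i=1,\dots,n,$$ with associated metric $\langle\cdot,\cdot\rangle$ and norm $|\cdot|$ on $\mathcal{D}$. The Carnot-Carathéodory distance from the origin is $\delta(p)=\inf\int_0^1|\dot\gamma(t)|\,dt$, over absolutely continuous curves $\gamma:[0,1]\to\mathbb{H}^n$ with $\dot\gamma(t)\in\mathcal{D}_{\gamma(t)}$ for a.e. $t$, $\gamma(0)=0$, $\gamma(1)=p$. It is smooth outside the center $\mathcal{Z}=\{x=y=0\}$. The horizontal gradient is $\nabla_{\mathbb{H}}u=\sum_{i=1}^n\big((X_iu)X_i+(Y_iu)Y_i\big)$, and $\nabla_{\mathbb{H}}^\perp u$ denotes,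 on $\mathbb{H}^n\setminus\mathcal{Z}$, the component of $\nabla_{\mathbb{H}}u$ orthogonal to the (unit) field $\nabla_{\mathbb{H}}\delta$, i.e. $\nabla_{\mathbb{H}}^\perp u=\nabla_{\mathbb{H}}u-\langle\nabla_{\mathbb{H}}u,\nabla_{\mathbb{H}}\delta\rangle\nabla_{\mathbb{H}}\delta$. Integration $dp$ is with respect to Lebesgue measure. Let $\varrho_\lambda(x,y,z)=(\lambda x,\lambda y,\lambda^2z)$ for $\lambda>0$, and $\mathbb{S}^{2n}_+=\{|x|^2+|y|^2+z^2=1,\ z>0\}$. Spherical caps $\Sigma\subset\mathbb{S}^{2n}_+$ are (open, nonempty) caps centered at the north pole $(0,0,1)$, possibly all of $\mathbb{S}^{2n}_+$. The associated homogeneous cone is $C_\Sigma=\{\varrho_\lambda(p):\lambda>0,\ p\in\Sigma\}$, and $\alpha_\Sigma\in(0,+\infty]$ is the unique parameter such that $C_\Sigma=\{(x,y,z)\in\mathbb{R}^{2n+1}: |x|^2+|y|^2<\alpha_\Sigma z\}$ (with $\alpha_\Sigma=+\infty$ meaning $C_\Sigma=\{z>0\}$). Finally, $$c_n^\perp(\Sigma)=\inf_{0\ne u\in C_c^\infty(C_\Sigma)}\frac{\int_{C_\Sigma}|\nabla_{\mathbb{H}}^\perp u|^2\,dp}{\int_{C_\Sigma}|u|^2\delta^{-2}\,dp}.$$ *)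

(* Defs.v *)
From HB Require Import structures.
From mathcomp Require Import all_boot all_order all_algebra.
From mathcomp Require Import all_classical all_reals all_analysis.

Set Implicit Arguments.
Unset Strict Implicit.
Unset Printing Implicit Defensive.
Import Order.TTheory GRing.Theory Num.Theory.
Import numFieldNormedType.Exports.

Local Open Scope classical_set_scope.
Local Open Scope ring_scope.

(* 'rV[T]_n carries the product sigma-algebra, exactly as n.-tuple T does. *)
Section measurable_rV.
Context {d} {T : sigmaRingType d}.
Variable n : nat.

Let coords : 'I_n -> 'rV[T]_n -> T := fun i v => v ord0 i.

Let rV_set0 : g_sigma_preimage coords set0.
Proof. exact: sigma_algebra0. Qed.

Let rV_setC A : g_sigma_preimage coords A -> g_sigma_preimage coords (~` A).
Proof. exact: sigma_algebraC. Qed.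

Let rV_bigcup (F : (set 'rV[T]_n)^nat) :
  (forall i, g_sigma_preimage coords (F i)) ->
  g_sigma_preimage coords (\bigcup_i (F i)).
Proof. exact: sigma_algebra_bigcup. Qed.

HB.instance Definition _ := @isMeasurable.Build (measure_tuple_display d)
  'rV[T]_n (g_sigma_preimage coords) rV_set0 rV_setC rV_bigcup.

End measurable_rV.

Lemma measurable_coord d (T : sigmaRingType d) n (i : 'I_n) :
  measurable_fun [set: 'rV[T]_n] (fun v => v ord0 i).
Proof.
move=> _ Y mY; rewrite setTI; apply: sub_sigma_algebra => /=.
rewrite -bigcup_seq/=; exists i => /=; first by rewrite mem_index_enum.
by exists Y => //; rewrite setTI.
Qed.

Lemma measurable_fun_rVP d1 d2 (T1 : measurableType d1)
    (T2 : measurableType d2) n (f : T1 -> 'rV[T2]_n) :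
  (forall i, measurable_fun [set: T1] (fun t => f t ord0 i)) ->
  measurable_fun [set: T1] f.
Proof.
move=> mf _ A mA; rewrite setTI.
have : (fun B => measurable (f @^-1` B)) A; last by [].
move: A mA; apply: smallest_sub.
  split => /=.
  - by rewrite preimage_set0.
  - by move=> A mA; rewrite setTD preimage_setC; exact: measurableC.
  - by move=> F mF; rewrite preimage_bigcup; exact: bigcup_measurable.
move=> A; rewrite -bigcup_seq/= => -[i _ [B mB <-]].
by rewrite setTI; have := mf i measurableT B mB; rewrite setTI.
Qed.

Section lebesgue_rV.
Local Open Scope ereal_scope.
Context {R : realType}.

Definition cons_rV n (p : measurableTypeR R * 'rV[R]_n) : 'rV[R]_n.+1 :=
  \row_i oapp (p.2 ord0) p.1 (unlift ord0 i).

Lemma measurable_cons_rV n : measurable_fun setT (@cons_rV n).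
Proof.
apply: measurable_fun_rVP => i; rewrite /cons_rV.
under eq_fun do rewrite mxE.
case: unliftP => [j|] _ /=; last exact: measurable_fst.
exact: (measurableT_comp (measurable_coord j) measurable_snd).
Qed.

Section step.
Variables (n : nat) (mu : {sigma_finite_measure set 'rV[R]_n -> \bar R}).

Definition lebesgue_rV_step : set 'rV[R]_n.+1 -> \bar R :=
  pushforward (@lebesgue_measure R \x mu) (@cons_rV n).

Let measurable_preimage A : measurable A -> measurable (@cons_rV n @^-1` A).
Proof.
by move=> mA; have := @measurable_cons_rV n measurableT _ mA; rewrite setTI.
Qed.

Let step0 : lebesgue_rV_step set0 = 0.
Proof. by rewrite /lebesgue_rV_step /pushforward preimage_set0 measure0. Qed.

Let step_ge0 A : 0 <= lebesgue_rV_step A.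
Proof. exact: (measure_ge0 (@lebesgue_measure R \x mu)). Qed.

Let step_sigma_additive : semi_sigma_additive lebesgue_rV_step.
Proof.
move=> F mF tF mUF; rewrite /lebesgue_rV_step /pushforward preimage_bigcup.
apply: measure_semi_sigma_additive.
- by move=> k; exact: measurable_preimage.
- apply/trivIsetP => /= i j _ _ ij; rewrite -preimage_setI.
  by move/trivIsetP : tF => /(_ _ _ _ _ ij) ->//; rewrite preimage_set0.
- by rewrite -preimage_bigcup; exact: measurable_preimage.
Qed.

HB.instance Definition _ := isMeasure.Build _ _ _ lebesgue_rV_step
  step0 step_ge0 step_sigma_additive.

Let sigma_finite_step : sigma_finite setT lebesgue_rV_step.
Proof.
pose g (v : 'rV[R]_n.+1) : measurableTypeR R * 'rV[R]_n :=
  (v ord0 ord0, \row_j v ord0 (lift ord0 j)).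
have gK : cancel (@cons_rV n) g.
  move=> [t w]; congr pair; first by rewrite mxE unlift_none.
  by apply/rowP => j; rewrite !mxE liftK.
have mg : measurable_fun setT g.
  apply: measurable_fun_pair; first exact: measurable_coord.
  apply: measurable_fun_rVP => j; under eq_fun do rewrite mxE.
  exact: measurable_coord.
have /sigma_finiteP[F [FT ndF Foo]] := sigma_finiteT (@lebesgue_measure R).
have /sigma_finiteP[G [GT ndG Goo]] := sigma_finiteT mu.
exists (fun k => g @^-1` (F k `*` G k)).
  apply/seteqP; split => // v _.
  have [i _ Fi] : (\bigcup_i F i) (g v).1 by rewrite -FT.
  have [j _ Gj] : (\bigcup_i G i) (g v).2 by rewrite -GT.
  exists (maxn i j) => //; split.
  - by move: Fi; exact/subsetPset/ndF/leq_maxl.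
  - by move: Gj; exact/subsetPset/ndG/leq_maxr.
move=> k; have [mF Fk] := Foo k; have [mG Gk] := Goo k; split.
  have := mg measurableT _ (measurableX mF mG).
  by rewrite setTI.
rewrite /lebesgue_rV_step /pushforward -comp_preimage.
rewrite (_ : g \o _ = id); last by apply/funext => p /=; rewrite gK.
by rewrite preimage_id product_measure1E// lte_mul_pinfty// ge0_fin_numE.
Qed.

HB.instance Definition _ :=
  Measure_isSigmaFinite.Build _ _ _ lebesgue_rV_step sigma_finite_step.

End step.

(* Lebesgue measure on R^n: under R^(n+1) = R x R^n it is the product of the
   Lebesgue measures; R^0 is a point of mass 1. *)
Fixpoint lebesgue_rV n : {sigma_finite_measure set 'rV[R]_n -> \bar R} :=
  match n with
  | 0 => [the {sigma_finite_measure set _ -> \bar R} of \d_(0%R : 'rV[R]_0)]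
  | m.+1 => [the {sigma_finite_measure set _ -> \bar R} of
             lebesgue_rV_step (lebesgue_rV m)]
  end.

Lemma lebesgue_rV_box n (A : 'I_n -> set R) :
  (forall i, measurable (A i)) ->
  lebesgue_rV n [set v | forall i, A i (v ord0 i)] =
  \prod_(i < n) lebesgue_measure (A i).
Proof.
elim: n A => [|n IH] A mA.
  by rewrite big_ord0 /= diracE mem_set// => -[].
rewrite big_ord_recl -IH //= /lebesgue_rV_step /pushforward.
rewrite (_ : _ @^-1` _ = A ord0 `*`
  [set v : 'rV[R]_n | forall i, A (lift ord0 i) (v ord0 i)]).
  rewrite product_measure1E //; first exact: mA.
  rewrite (_ : [set _ | _] = \bigcap_i
    ((fun v : 'rV[R]_n => v ord0 i) @^-1` A (lift ord0 i))).
    apply: fin_bigcap_measurable => // i _.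
    by have := measurable_coord i measurableT (mA (lift ord0 i)); rewrite setTI.
  by apply/seteqP; split => v /= Av i; [move=> _|]; exact: Av.
apply/seteqP; split => -[t w] /= Av; last first.
  by move=> i; rewrite mxE; case: unliftP => [j|] -> //=; case: Av.
split=> [|i]; first by have := Av ord0; rewrite mxE unlift_none.
by have := Av (lift ord0 i); rewrite mxE liftK.
Qed.

End lebesgue_rV.
Arguments lebesgue_rV R n : clear implicits.

(* The point (x, y, z) of H^n is the pair ((x, y), z); H^n is thus the normed
   module R^n x R^n x R. *)
Notation heis R n := ('rV[R]_n * 'rV[R]_n * R)%type.

Section heisenberg.
Context {R : realType} {n : nat}.
Implicit Types (p v w : heis R n) (u : heis R n -> R) (S : set (heis R n)).

Definition Xfield (i : 'I_n) p : heis R n :=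
  (delta_mx 0 i, 0, - (p.1.2 0 i / 2)).
Definition Yfield (i : 'I_n) p : heis R n :=
  (0, delta_mx 0 i, p.1.1 0 i / 2).

Definition hdistribution p : set (heis R n) :=
  [set v | exists a b : 'rV[R]_n,
     v = \sum_i (a 0 i *: Xfield i p + b 0 i *: Yfield i p)].

(* A horizontal vector at p is (a, b, _), where a and b are its coordinates in
   the frame X_i(p), Y_i(p).  The metric making this frame orthonormal is
   therefore given by a formula that does not involve p. *)
Definition hdot v w : R :=
  \sum_i (v.1.1 0 i * w.1.1 0 i + v.1.2 0 i * w.1.2 0 i).
Definition hnorm v : R := Num.sqrt (hdot v v).

Lemma hdotXX p i j : hdot (Xfield i p) (Xfield j p) = (i == j)%:R.
Proof.
rewrite /hdot (bigD1 i)//= big1 => [|k /negPf ki]; rewrite !mxE !eqxx/=.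
  by rewrite eq_sym mul1r mulr0 !addr0 eq_sym.
by rewrite ki mul0r mulr0 addr0.
Qed.

Lemma hdotYY p i j : hdot (Yfield i p) (Yfield j p) = (i == j)%:R.
Proof.
rewrite /hdot (bigD1 i)//= big1 => [|k /negPf ki]; rewrite !mxE !eqxx/=.
  by rewrite mul1r mul0r add0r addr0.
by rewrite ki !mul0r addr0.
Qed.

Lemma hdotXY p i j : hdot (Xfield i p) (Yfield j p) = 0.
Proof. by rewrite /hdot big1 // => k _; rewrite !mxE mulr0 mul0r addr0. Qed.

Definition abs_continuous (V : normedModType R) (a b : R) (f : R -> V) : Prop :=
  forall e : R, 0 < e -> exists2 d : R, 0 < d &
    forall (m : nat) (l r : 'I_m -> R),
      (forall k, a <= l k <= r k /\ r k <= b) ->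
      trivIset setT (fun k => `]l k, r k[%classic) ->
      \sum_k (r k - l k) < d -> \sum_k `|f (r k) - f (l k)| < e.

(* Curves are functions on R of which only the restriction to [0, 1] matters. *)
Definition horizontal_curve (g : R -> heis R n) : Prop :=
  abs_continuous 0 1 g /\
  {ae (@lebesgue_measure R), forall t, t \in `[0, 1] ->
     derivable g t 1 /\ hdistribution (g t) (derive1 g t)}.

Definition curve_length (g : R -> heis R n) : \bar R :=
  (\int[lebesgue_measure]_(t in `[0%R, 1%R]) (hnorm (derive1 g t))%:E)%E.

Definition ccdist p : R :=
  fine (ereal_inf [set curve_length g |
    g in [set g | [/\ horizontal_curve g, g 0 = 0 & g 1 = p]]]).

Definition hgrad u p : heis R n :=
  \sum_i ('D_(Xfield i p) u p *: Xfield i p + 'D_(Yfield i p) u p *: Yfield i p).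

(* meaningful off the centre x = y = 0, where ccdist is smooth *)
Definition hgrad_perp u p : heis R n :=
  hgrad u p - hdot (hgrad u p) (hgrad ccdist p) *: hgrad ccdist p.

Definition heis_measure :=
  ((lebesgue_rV R n \x lebesgue_rV R n) \x @lebesgue_measure R)%E.
HB.instance Definition _ := Measure.on heis_measure.

Fixpoint Cn (k : nat) u : Prop :=
  continuous u /\
  if k is m.+1 then
    forall v, (forall p, derivable u p v) /\ Cn m ('D_v u)
  else True.

Definition smooth u : Prop := forall k, Cn k u.

(* Elements of C_c^oo(O) are identified with their extension by 0. *)
Definition test_functions (O : set (heis R n)) : set (heis R n -> R) :=
  [set u | [/\ smooth u, compact (closure [set p | u p != 0]) &
               closure [set p | u p != 0] `<=` O]].

Definition sqnorm (x : 'rV[R]_n) : R := \sum_i x 0 i ^+ 2.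

Definition upper_hemisphere : set (heis R n) :=
  [set p | sqnorm p.1.1 + sqnorm p.1.2 + p.2 ^+ 2 = 1 /\ 0 < p.2].

(* h is the cosine of the angular radius of the cap *)
Definition spherical_cap S : Prop :=
  exists2 h : R, 0 <= h < 1 & S = upper_hemisphere `&` [set p | h < p.2].

Definition dilation (l : R) p : heis R n :=
  (l *: p.1.1, l *: p.1.2, l ^+ 2 * p.2).

Definition cone S : set (heis R n) :=
  [set dilation l p | l in [set l | 0 < l] & p in S].

Definition paraboloid (a : \bar R) : set (heis R n) :=
  match a with
  | r%:E => [set p | sqnorm p.1.1 + sqnorm p.1.2 < r * p.2]
  | +oo%E => [set p | 0 < p.2]
  | -oo%E => set0
  end.

Definition cap_alpha S : \bar R :=
  get [set a | (0 < a)%E /\ cone S = paraboloid a].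

Definition phi (r : R) : \bar R :=
  if r == 0 then +oo%E else (4 * (1 - cos r) / (r - sin r))%:E.

Definition cap_rho S : R :=
  get [set r | 0 <= r <= 2 * pi /\ phi r = cap_alpha S].

(* The denominator is positive and finite for every admissible u. *)
Definition c_perp S : \bar R :=
  ereal_inf [set
    ((\int[heis_measure]_(p in cone S) (hnorm (hgrad_perp u p) ^+ 2)%:E) /
     (\int[heis_measure]_(p in cone S) (`|u p| ^+ 2 / ccdist p ^+ 2)%:E))%E
    | u in test_functions (cone S) `&` [set u | u <> cst 0]].

End heisenberg.

(* Main.v *)
(* For 0 < t < 2 pi, the quantity 2 t z + (t / 2) cot (t / 2) (|x|^2 + |y|^2) is a
   calibration: it is at most the squared length of any horizontal curve from 0
   to (x, y, z).  The lifted circular arc of angle theta through (x, y) attains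
   it, so delta^2 is its maximum over t, reached at t = theta(x, y, z), and the
   envelope theorem gives grad delta, with d(ln delta)/dz = theta / delta^2.

   Lower bound: let J be the horizontal rotation, W the unit horizontal field
   J grad delta, which is orthogonal to grad delta, and f = u^2.  Then
   W f / delta - n f d(ln delta)/dz is a sum of terms df /\ d(ln delta), each a
   null Lagrangian, so it integrates to 0; since theta >= rho on the cone, the
   pointwise inequality (W u)^2 >= a (2 u W u / delta) - (a u / delta)^2 with
   a = n rho / 2 gives the bound.

   Upper bound: for u = g(s) chi(z), s = |x|^2 + |y|^2, the orthogonal gradient
   has norm (theta s / delta) |g' chi - g chi' cot (theta / 2) / 4|, and
   theta <= 2 pi.  With g close to (s + sigma)^(-n/2) near s = 0 the main term is
   at most pi n |u| / delta, while the integral of u^2 / delta^2 diverges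
   logarithmically as sigma tends to 0 and the cut-off errors do not. *)
Require Import Defs.
From mathcomp Require Import all_boot all_order all_algebra.
From mathcomp Require Import all_classical all_reals all_analysis.
From mathcomp Require Import measurable_realfun ring lra.
Set Implicit Arguments.
Unset Strict Implicit.
Unset Printing Implicit Defensive.
Import Order.TTheory GRing.Theory Num.Theory.
Import numFieldNormedType.Exports.
Local Open Scope classical_set_scope.
Local Open Scope ring_scope.

(** * Circular arcs *)

(** The distance is known here only for z > 0 off the centre, with first derivatives given by the
    envelope theorem, while the support of u may cross the centre. This dictates the form of the
    integration by parts. A coefficient of df /\ d(ln delta) is written as the difference of D_w (ln
    delta D_v f) and D_v (ln delta D_w f), so that second derivatives fall on f alone. Each of the
    two terms is then cut off by a coordinate that is constant along its direction of
    differentiation: a line in that direction either carries the zero function or avoids the centre,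
    hence differentiability along lines holds everywhere, and translation invariance of the measure
    with dominated convergence gives a zero integral. The two constants have one origin. With y = u
    / delta, the null Lagrangian produces a (n theta) y^2 - a^2 y^2 after completing the square, and
    the best choice at a given angle is a = n theta / 2. On the cone theta ranges between rho and 2
    pi. The value 2 pi is approached only at the centre, which is why the test functions of the
    upper bound concentrate there. *)

Section trigonometry.
Context {R : realType}.
Implicit Types t x : R.

(** This is x < tan x cleared of its denominator, so that it survives beyond pi / 2. *)
Let sin_subMcos_gt0 x : 0 < x < pi -> x * cos x < sin x.
Proof.
move=> /andP[x0 xpi]; rewrite -subr_gt0.
pose f (y : R) := sin y - y * cos y.
have df (y : R) : is_derive y 1 f (y * sin y).
  by apply: is_derive_eq; rewrite /GRing.scale /=; lra.
have f0 : f 0 = 0 by rewrite /f sin0 mul0r subr0.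
rewrite -/(f x) -f0.
have cf (y : R) : {for y, continuous f}.
  by apply/differentiable_continuous/derivable1_diffP; have [] := df y.
apply: (@gtr0_derive1_lt_cc R f 0 x) => //.
- move=> y; rewrite in_itv /= => /andP[y0 yx].
  rewrite derive1E (@derive_val _ _ _ _ _ _ _ (df y)) mulr_gt0//.
  by apply: sin_gt0_pi; rewrite y0 (lt_trans yx).
- by apply: continuous_subspaceT => y; exact: cf.
- by rewrite in_itv /= lexx ltW.
- by rewrite in_itv /= lexx ltW.
Qed.

Lemma cos_lt1 t : 0 < t < 2 * pi -> cos t < 1.
Proof.
move=> /andP[t0 tpi].
have -> : t = (t / 2) *+ 2 by rewrite -mulr_natr; field.
have s0 : 0 < sin (t / 2).
  by apply: sin_gt0_pi; rewrite divr_gt0 //= ltr_pdivrMr // mulrC.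
have := cos2Dsin2 (t / 2); rewrite cos_mulr2n => h.
have : 0 < sin (t / 2) ^+ 2 by rewrite exprn_gt0.
lra.
Qed.

(* cot (t / 2) / 2 *)
Definition halfcot t := sin t / (2 * (1 - cos t)).

(** Both sides are 1 / (4 sin^2 (t / 2)). Multiplied by the squared chord |x|^2 + |y|^2, this is the
    squared radius of the circle that carries the arc of angle t. *)
Lemma halfcotE t : cos t < 1 -> 1 / 4 + halfcot t ^+ 2 = 1 / (2 * (1 - cos t)).
Proof.
move=> c1; rewrite /halfcot.
have h : 1 - cos t != 0 by rewrite gt_eqF// subr_gt0.
have -> : (sin t / (2 * (1 - cos t))) ^+ 2 = sin t ^+ 2 / (2 * (1 - cos t)) ^+ 2.
  by rewrite expr_div_n.
have -> : sin t ^+ 2 = 1 - cos t ^+ 2 by rewrite -(cos2Dsin2 t) addrAC subrr add0r.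
by field.
Qed.

Lemma is_derive_halfcot t : cos t < 1 ->
  is_derive t 1 halfcot (- (1 / 4 + halfcot t ^+ 2)).
Proof.
move=> c1; have h : 1 - cos t != 0 by rewrite gt_eqF// subr_gt0.
have h2 : 2 * (1 - cos t) != 0 by rewrite mulf_neq0.
rewrite halfcotE //.
have -> : halfcot = sin * (fun x : R => (2 * (1 - cos x))^-1) by [].
have d2 : is_derive t 1 (fun x : R => 2 * (1 - cos x)) (2 * sin t).
  by apply: is_derive_eq; rewrite /GRing.scale /=; ring.
have d3 := @is_deriveV R (fun x : R => 2 * (1 - cos x)) t _ 1 h2 d2.
apply: is_derive_eq; rewrite /GRing.scale /=.
have -> : sin t * (- (2 * (1 - cos t)) ^- 2 * (2 * sin t)) + (2 * (1 - cos t))^-1 * cos t =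
   - (2 * (sin t ^+ 2) / (2 * (1 - cos t)) ^+ 2) + cos t / (2 * (1 - cos t)) by field.
have -> : sin t ^+ 2 = 1 - cos t ^+ 2 by rewrite -(cos2Dsin2 t) addrAC subrr add0r.
by field.
Qed.

(* The value of z / (|x|^2 + |y|^2) at the end of an arc of angle t. *)
Definition arc_ratio t := (t - sin t) / (4 * (1 - cos t)).

(** At the half angle the expression factors through sin x - x cos x. It is the numerator of the
    derivative of [arc_ratio], and its sign also says that [t * halfcot t] is below 1. *)
Lemma arc_ratio_num_gt0 t : 0 < t < 2 * pi -> 0 < 2 * (1 - cos t) - t * sin t.
Proof.
move=> /andP[t0 tpi].
have x0 : 0 < t / 2 < pi by rewrite divr_gt0 //= ltr_pdivrMr // mulrC.
have -> : 2 * (1 - cos t) - t * sin t =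
  4 * sin (t / 2) * (sin (t / 2) - (t / 2) * cos (t / 2)).
  have {1 3}-> : t = (t / 2) *+ 2 by rewrite -mulr_natr; field.
  rewrite cos_mulr2n sin_mulr2n.
  have -> : 1 - (cos (t / 2) ^+ 2 *+ 2 - 1) = 2 * sin (t / 2) ^+ 2.
    by have := cos2Dsin2 (t / 2); rewrite -mulr_natr; lra.
  by rewrite -[_ *+ 2]mulr_natr; field.
by rewrite mulr_gt0// ?subr_gt0 ?sin_subMcos_gt0// mulr_gt0// sin_gt0_pi.
Qed.

Lemma is_derive_arc_ratio t : cos t < 1 -> is_derive t 1 arc_ratio
  ((2 * (1 - cos t) - t * sin t) / (4 * (1 - cos t) ^+ 2)).
Proof.
move=> c1; have h : 1 - cos t != 0 by rewrite gt_eqF// subr_gt0.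
have h2 : 4 * (1 - cos t) != 0 by rewrite mulf_neq0.
have -> : arc_ratio = (id - sin) * (fun x : R => (4 * (1 - cos x))^-1) by [].
have d2 : is_derive t 1 (fun x : R => 4 * (1 - cos x)) (4 * sin t).
  by apply: is_derive_eq; rewrite /GRing.scale /=; ring.
have d3 := @is_deriveV R (fun x : R => 4 * (1 - cos x)) t _ 1 h2 d2.
apply: is_derive_eq; rewrite /GRing.scale /=.
have -> : (t - sin t) * (- (4 * (1 - cos t)) ^- 2 * (4 * sin t)) +
  (4 * (1 - cos t))^-1 * (1 - cos t) =
  (4 * (sin t ^+ 2 - t * sin t)) / (4 * (1 - cos t)) ^+ 2
  + (1 - cos t) / (4 * (1 - cos t)) by field.
have -> : sin t ^+ 2 = 1 - cos t ^+ 2 by rewrite -(cos2Dsin2 t) addrAC subrr add0r.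
by field.
Qed.

Lemma arc_ratio_incr t t' : 0 < t -> t < t' -> t' < 2 * pi ->
  arc_ratio t < arc_ratio t'.
Proof.
move=> t0 tt' t'pi.
have d x : x \in `[t, t'] -> 0 < x < 2 * pi.
  by rewrite in_itv /= => /andP[tx xt']; rewrite (lt_le_trans t0)//= (le_lt_trans xt').
apply: (@gtr0_derive1_lt_cc R arc_ratio t t') => //.
- move=> x /subset_itv_oo_cc /d /cos_lt1 /is_derive_arc_ratio h.
  exact: ex_derive.
- move=> x /subset_itv_oo_cc /d xd.
  rewrite derive1E (@derive_val _ _ _ _ _ _ _ (is_derive_arc_ratio (cos_lt1 xd))).
  by rewrite divr_gt0 ?arc_ratio_num_gt0// mulr_gt0// exprn_gt0// subr_gt0 cos_lt1.
- apply: derivable_within_continuous => x /d /cos_lt1 /is_derive_arc_ratio h.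
  exact: ex_derive.
- by rewrite in_itv /= lexx ltW.
- by rewrite in_itv /= lexx ltW.
Qed.

Lemma arc_ratio_surj r : 0 < r -> exists2 t : R, 0 < t < 2 * pi & arc_ratio t = r.
Proof.
move=> r0.
(* Clearing the denominator gives a function continuous up to 2 pi, where [arc_ratio] itself blows
   up. *)
pose f (t : R) := r * (4 * (1 - cos t)) - (t - sin t).
(* Since e cos e < sin e, one has e - sin e < e (1 - cos e), so that e <= r makes [f e] positive. *)
pose e := Num.min (pi / 2) r.
have pi0 := @pi_gt0 R.
have e0 : 0 < e by rewrite lt_min r0 andbT divr_gt0.
have epi : e < pi by rewrite gt_min; apply/orP; left; lra.
have er : e <= r by rewrite ge_min lexx orbT.
have fe : 0 < f e.
  have ce : cos e < 1 by rewrite cos_lt1// e0 (lt_trans epi)//; lra.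
  have := @sin_subMcos_gt0 e; rewrite e0 epi => /(_ isT) h.
  have : e - sin e < r * (1 - cos e).
    apply: (@lt_le_trans _ _ (e * (1 - cos e))); first by lra.
    by rewrite ler_wpM2r// subr_ge0 ltW.
  have : 0 < r * (1 - cos e) by rewrite mulr_gt0// subr_gt0.
  by rewrite /f; lra.
have f2pi : f (2 * pi) < 0.
  by rewrite /f (mulr_natl pi 2) cos2pi sin2pi -mulr_natl; lra.
have df (y : R) : is_derive y 1 f (r * (4 * sin y) - (1 - cos y)).
  by apply: is_derive_eq; rewrite /GRing.scale /=; ring.
have cf : continuous f.
  by move=> y; apply/differentiable_continuous/derivable1_diffP; have [] := df y.
have [|||c] := @IVT R f e (2 * pi) 0.
- by apply/ltW/(lt_trans epi); lra.
- exact: continuous_subspaceT.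
- by rewrite ge_min le_max (ltW fe) (ltW f2pi) orbT.
rewrite in_itv /= => /andP[ec c2pi] fc.
have c0 : 0 < c by exact: lt_le_trans ec.
have cd : 0 < c < 2 * pi.
  rewrite c0 lt_neqAle c2pi andbT; apply/eqP => ce.
  by move: f2pi; rewrite -ce fc ltxx.
exists c => //; rewrite /arc_ratio.
have h : 4 * (1 - cos c) != 0 by rewrite mulf_neq0// gt_eqF// subr_gt0 cos_lt1.
apply: (mulIf h); rewrite mulfVK//; apply/eqP.
by rewrite eq_sym -subr_eq0 -/(f c) fc.
Qed.

End trigonometry.

(** * Absolute continuity and the calibration *)

Section ae_derivative.
Context {R : realType}.
Notation mu := (@lebesgue_measure R).

(** A chord that straddles s splits at s into two chords ending there, so differentiability at the
    single point s is enough. *)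
Let slope_le0 (f : R -> R) (s e : R) : 0 < e -> derivable f s 1 ->
  derive1 f s <= 0 -> exists2 eta : R, 0 < eta & forall l r : R,
    s - eta < l <= s -> s <= r < s + eta -> f r - f l <= e * (r - l).
Proof.
move=> e0 df f0; have /cvg_ex[a fa] := df.
have fsa : derive1 f s = a by rewrite derive1E; exact: cvg_lim fa.
have /fa : nbhs a (ball a e) by exact: nbhsx_ballx.
rewrite /= !near_simpl /= => -[eta /= eta0 feta].
have near_s h : h != 0 -> `|h| < eta -> `|a - h^-1 * (f (h + s) - f s)| < e.
  move=> h0 heta; have /= := feta h; rewrite /ball /= sub0r normrN => /(_ heta h0).
  by rewrite /GRing.scale /= mulr1.
exists eta => // l r /andP[sl ls] /andP[sr rs].
have a0 : a <= 0 by rewrite -fsa.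
have fr : f r - f s <= e * (r - s).
  have [->|rs0] := eqVneq r s; first by rewrite !subrr mulr0.
  have p : 0 < r - s by rewrite subr_gt0 lt_neqAle eq_sym rs0.
  have /= := near_s (r - s); rewrite subrK gt_eqF// gtr0_norm//.
  move=> /(_ isT); rewrite ltrBlDl => /(_ rs).
  rewrite ltr_distlC => /andP[_].
  by rewrite mulrC ltr_pdivrMr// => /ltW/le_trans; apply; rewrite ler_pM2r//; lra.
have fl : f s - f l <= e * (s - l).
  have [->|rs0] := eqVneq l s; first by rewrite !subrr mulr0.
  have p : 0 < s - l by rewrite subr_gt0 lt_neqAle rs0.
  have ls0 : l - s < 0 by rewrite subr_lt0 lt_neqAle rs0.
  have := near_s (l - s); rewrite subrK lt_eqF// ltr0_norm// opprB.
  move=> /(_ isT); rewrite ltrBlDl -ltrBlDr => /(_ sl).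
  rewrite ltr_distlC => /andP[_].
  have -> : (l - s)^-1 * (f l - f s) = (f s - f l) / (s - l).
    by rewrite -(opprB s l) invrN mulNr -mulrN opprB mulrC.
  by rewrite ltr_pdivrMr// => /ltW/le_trans; apply; rewrite ler_pM2r//; lra.
lra.
Qed.

(* Continuous induction on [0, t]: outside the exceptional null set, the slope
   of f is almost nonpositive; the intervals meeting it lie in an open set of
   small measure, over which absolute continuity controls the variation. *)
Lemma abs_continuous_nonincreasing (f : R -> R) : abs_continuous 0 1 f ->
  {ae mu, forall t, t \in `[0, 1] -> derivable f t 1 /\ derive1 f t <= 0} ->
  f 1 <= f 0.
Proof.
move=> acf [N [mN N0 fN]].
apply/ler_addgt0Pr => e' e'0; pose e := e' / 2.
have e0 : 0 < e by rewrite divr_gt0.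
have [d d0 acfd] := acf _ e0.
have [|U [oU NU Ud]] := @lebesgue_regularity_outer R N d mN _ d0.
  by rewrite [ltLHS](_ : _ = 0%E)//; exact: N0.
have mU : measurable U by exact: measurable_realfun.open_measurable.
have muU : (mu U < d%:E)%E.
  have UN : (mu (U `&` N) <= mu N)%E.
    by apply: le_measure; rewrite ?inE//; exact: measurableI.
  rewrite (@measureDI _ _ _ mu _ _ mU mN); apply: le_lt_trans Ud.
  rewrite -[leRHS]adde0; apply: leeD => //; apply: (le_trans UN).
  by rewrite le_eqVlt; apply/orP; left; apply/eqP; exact: N0.
(* Up to time t, f has grown by at most e t, apart from its variation over finitely many ordered
   intervals whose total length is charged to U. Only the indices below m count. *)
pose P (t : R) := exists m (l r : nat -> R),
  [/\ forall k, (k < m)%N -> 0 <= l k <= r k /\ r k <= t,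
      forall j k, (j < k < m)%N -> r j <= l k,
      ((\sum_(k < m) (r k - l k))%:E <= mu (U `&` `]0%R, t]))%E &
      f t - f 0 <= e * t + \sum_(k < m) `|f (r k) - f (l k)|].
have stepN t t' : t <= t' -> P t -> f t' - f t <= e * (t' - t) -> P t'.
  move=> tt' [m [l [r [lr mon le fle]]]] ftt'; exists m, l, r; split => //.
  - by move=> k /lr[? h]; split => //; exact: le_trans tt'.
  - apply: (le_trans le); apply: le_measure; rewrite ?inE; [exact: measurableI..|].
    by apply: setIS; apply: subset_itvl; rewrite bnd_simp.
  - by rewrite -(subrKA (f t)); move: fle ftt'; lra.
have stepU t t' : 0 <= t -> t <= t' -> P t -> `]t, t'] `<=` U -> P t'.
  move=> t0 tt' [m [l [r [lr mon le fle]]]] sU.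
  exists m.+1, (fun k => if (k < m)%N then l k else t),
    (fun k => if (k < m)%N then r k else t'); split => //.
  - move=> k _; case: ifPn => [/lr[? h]|_]; first by split=> //; exact: le_trans tt'.
    by rewrite t0 tt'.
  - move=> j k /andP[jk]; rewrite ltnS leq_eqVlt => /predU1P[km|km].
      rewrite km in jk *.
      by rewrite jk ltnn; have [] := lr j jk.
    by rewrite (ltn_trans jk km) km mon// jk.
  - have -> : U `&` `]0, t'] = (U `&` `]0, t]) `|` `]t, t'].
      apply/seteqP; split => x /=; rewrite !in_itv/=.
        move=> [Ux /andP[x0 xt']]; have [xt|tx] := leP x t; [left|right] => //.
          by split => //; rewrite x0.
      move=> [[Ux /andP[x0 xt]]|/andP[tx xt']].
        by split => //; rewrite x0 (le_trans xt).
      by split; [apply: sU; rewrite /= in_itv/= tx xt'|rewrite (le_lt_trans t0 tx)].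
    rewrite measureU//=; last 2 first.
    + exact: measurableI.
    + apply/seteqP; split => // x /=; rewrite !in_itv/=.
      by move=> [[_ /andP[_ xt]] /andP[]]; rewrite ltNge xt.
    rewrite big_ord_recr/= ltnn EFinD; apply: leeD.
      rewrite (eq_bigr (fun k : 'I_m => r k - l k))// => k _.
      by rewrite ltn_ord.
    rewrite lebesgue_measure_itv/= lte_fin; case: ifPn => [_ //|].
    by rewrite -leNgt lee_fin subr_le0.
  - rewrite big_ord_recr/= ltnn (eq_bigr (fun k : 'I_m => `|f (r k) - f (l k)|)); last first.
      by move=> k _; rewrite ltn_ord.
    rewrite addrA; have := ler_norm (f t' - f t).
    have : e * t <= e * t' by rewrite ler_pM2l.
    by move: fle; lra.
have P0 : P 0.
  exists 0%N, (fun=> 0), (fun=> 0); rewrite !big_ord0; split => //.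
  by rewrite subrr mulr0 addr0.
pose S := [set t | 0 <= t <= 1 /\ P t].
have S0 : S 0 by split => //; rewrite lexx ler01.
have hS : has_sup S by split; [exists 0|exists 1 => t [/andP[]]].
pose s := sup S.
have s0 : 0 <= s by apply: (ub_le_sup hS.2).
have s1 : s <= 1 by apply: ge_sup => [|t [/andP[]//]]; exists 0.
(* from some t <= s in S one reaches every r slightly beyond s *)
have [eta eta0 reach] : exists2 eta : R, 0 < eta &
    forall r, s <= r < s + eta -> r <= 1 -> P r.
  have [Ns|Ns] := pselect (N s).
  - have /nbhs_ballP[eta /= eta0 sU] : nbhs s U by exact: open_nbhs_nbhs (conj oU (NU _ Ns)).
    exists eta => // r /andP[sr reta] r1.
    have [t [/andP[t0 t1] Pt] ts] := sup_adherent eta0 hS.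
    have ts' : t <= s by apply: (ub_le_sup hS.2); split => //; rewrite t0.
    apply: (stepU t r) => //; first exact: le_trans sr.
    move=> x /=; rewrite in_itv/= => /andP[tx xr]; apply: sU.
    rewrite /ball/= ltr_distlC; apply/andP; split; first exact: lt_trans tx.
    exact: le_lt_trans reta.
  - have [dfs fs] : derivable f s 1 /\ derive1 f s <= 0.
      apply: contrapT => h; apply: Ns; apply: fN => /= hs; apply: h; apply: hs.
      by rewrite in_itv/= s0.
    have [eta eta0 sl] := slope_le0 e0 dfs fs.
    exists eta => // r /andP[sr reta] r1.
    have [t [/andP[t0 t1] Pt] ts] := sup_adherent eta0 hS.
    have ts' : t <= s by apply: (ub_le_sup hS.2); split => //; rewrite t0.
    apply: (stepN t r) => //; first exact: le_trans sr.
    by apply: sl; rewrite ?ts ?ts' ?sr.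
have P1 : P 1.
  have [s1'|] := ltP 1 (s + eta); first by apply: reach; rewrite ?s1.
  move=> seta1; pose r := s + eta / 2.
  have rs : s < r by rewrite ltrDl divr_gt0.
  have reta : r < s + eta by rewrite ltrD2l; lra.
  have Sr : S r.
    split; first by rewrite (le_trans s0 (ltW rs))/= (le_trans (ltW reta)).
    by apply: reach; rewrite ?(ltW rs) ?reta// (le_trans (ltW reta)).
  by have := ub_le_sup hS.2 Sr; rewrite leNgt rs.
have [m [l [r [lr mon le]]]] := P1.
suff : \sum_(k < m) `|f (r k) - f (l k)| < e by rewrite /e; lra.
apply: acfd.
- by move=> k; have [] := lr k (ltn_ord k).
- apply/trivIsetP => /= i j _ _ ij.
  wlog ltij : i j ij / (i < j)%N.
    move=> h; have [||/val_inj] := ltngtP i j; first exact: h.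
      by move=> ji; rewrite setIC; apply: h => //; rewrite eq_sym.
    by move=> ije; rewrite ije eqxx in ij.
  apply/seteqP; split => // x /=; rewrite !in_itv/= => -[/andP[_ xi] /andP[jx _]].
  have := mon i j; rewrite ltij ltn_ord => /(_ isT).
  by rewrite leNgt (lt_trans jx xi).
- rewrite -lte_fin; apply: le_lt_trans muU; apply: (le_trans le).
  by apply: le_measure; rewrite ?inE//; exact: measurableI.
Qed.

End ae_derivative.

(** * Integrals of nonnegative functions that may fail to be measurable *)

Section nonmeasurable_integrands.
Local Open Scope ereal_scope.
Context d (T : measurableType d) (R : realType).
Variable mu : {measure set T -> \bar R}.
Implicit Types (D N : set T) (f g : T -> \bar R).
Import HBNNSimple.

(* The integrands of curve_length and of the energy of u come without
   measurability, which ge0_le_integral requires. *)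
Lemma ge0_le_integral_nonmeasurable D f g :
  (forall x, D x -> 0 <= f x) -> (forall x, D x -> f x <= g x) ->
  \int[mu]_(x in D) f x <= \int[mu]_(x in D) g x.
Proof.
move=> f0 fg; rewrite !ge0_integralE//; last first.
  by move=> x Dx; exact: le_trans (f0 _ Dx) (fg _ Dx).
apply: ereal_sup_le => _ [h /= hf <-].
exists h => //= x; apply: (le_trans (hf x)).
by rewrite /patch; case: ifPn => // /set_mem; exact: fg.
Qed.

Lemma ge0_subset_integral_nonmeasurable D E f : D `<=` E ->
  (forall x, E x -> 0 <= f x) ->
  \int[mu]_(x in D) f x <= \int[mu]_(x in E) f x.
Proof.
move=> DE f0; rewrite integral_mkcond [leRHS]integral_mkcond.
apply: ge0_le_integral_nonmeasurable => x _; rewrite /patch.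
  by case: ifPn => // /set_mem /DE; exact: f0.
case: ifPn => [/set_mem /DE Ex|_]; first by rewrite mem_set.
by case: ifPn => // /set_mem; exact: f0.
Qed.

(** The integral is a supremum over simple functions below f. These are measurable, so each keeps
    its integral when N is removed. *)
Lemma ge0_null_integral_nonmeasurable D N f : measurable N -> mu N = 0 ->
  (forall x, D x -> 0 <= f x) ->
  \int[mu]_(x in D) f x = \int[mu]_(x in D `\` N) f x.
Proof.
move=> mN N0 f0; apply/eqP; rewrite eq_le; apply/andP; split; last first.
  exact: ge0_subset_integral_nonmeasurable.
rewrite ge0_integralE//; apply: ge_ereal_sup => _ [h /= hf <-].
rewrite -integralT_nnsfun (ge0_negligible_integral mN)//; last 2 first.
- exact/measurable_EFinP.
- by move=> x _; rewrite lee_fin.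
rewrite integral_mkcond [leRHS]integral_mkcond.
apply: ge0_le_integral_nonmeasurable => x _; rewrite /patch.
  by case: ifPn => // _; rewrite lee_fin.
case: ifPn => [/set_mem[_ Nx]|_]; last by case: ifPn => // /set_mem[/f0].
have := hf x; rewrite /patch; case: ifPn => [/set_mem Dx|/negP nD].
  by rewrite mem_set.
by move=> h0; rewrite memNset// => -[Dx _]; apply: nD; rewrite mem_set.
Qed.

End nonmeasurable_integrands.

Section indefinite_integral.
Context {R : realType}.
Notation mu := (@lebesgue_measure R).

(** On D the derivative is the pointwise limit of the difference quotients of steps 1 / (k + 1),
    which are measurable because c is continuous. *)
Lemma measurable_derive1 (c : R -> R) (D : set R) : measurable D ->
  continuous c -> (forall t, D t -> derivable c t 1) ->
  measurable_fun D (derive1 c).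
Proof.
move=> mD cc dc.
pose h (k : nat) (t : R) := k.+1%:R * (c (k.+1%:R^-1 + t) - c t).
apply: (@measurable_fun_cvg _ _ _ _ h).
  move=> k; apply: measurable_funTS; apply: measurable_funM => //.
  have mc := continuous_measurable_fun cc.
  apply: measurable_funB => //.
  have ms : measurable_fun [set: R] (fun t : R => k.+1%:R^-1 + t).
    exact: measurable_funD.
  exact: (measurableT_comp mc ms).
move=> t /dc /cvg_ex[a ca].
have -> : derive1 c t = a by rewrite derive1E; exact: cvg_lim ca.
move/cvgr_dnbhsP : ca => /(_ harmonic)/=.
rewrite (_ : (fun n => _ *: _) = h ^~ t); last first.
  by apply/funext => k; rewrite invrK /GRing.scale/= mulr1.
by apply; split; [move=> k; rewrite gt_eqF|exact: cvg_harmonic].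
Qed.

Variable h : R -> R.
Hypothesis h0 : forall t, 0 <= h t.
Hypothesis inth : mu.-integrable setT (EFin \o h).

Definition primitive (x : R) := (\int[mu]_(t in `[0%R, x]) h t)%R.

Let inth_itv (i : interval R) : mu.-integrable [set` i] (EFin \o h).
Proof. exact: integrableS inth. Qed.

Lemma primitive0 : primitive 0 = 0.
Proof. by rewrite /primitive set_itv1 Rintegral_set1. Qed.

Lemma primitiveB (l r : R) : 0 <= l -> l <= r ->
  primitive r - primitive l = (\int[mu]_(t in `]l, r[) h t)%R.
Proof.
move=> l0 lr; rewrite /primitive Rintegral_itvB ?bnd_simp//.
by rewrite -Rintegral_itv_bndo_bndc.
Qed.

Lemma primitive_le (l r : R) : 0 <= l -> l <= r -> primitive l <= primitive r.
Proof.
by move=> l0 lr; rewrite -subr_ge0 primitiveB// Rintegral_ge0.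
Qed.

Lemma primitive_abs_continuous : abs_continuous 0 1 primitive.
Proof.
move=> e e0; have [d [d0 hd]] := integral_normr_continuous inth e0.
exists d => // m l r lr tI ltd.
pose F k := `]l k, r k[%classic : set R.
pose A := \big[setU/set0]_(k < m) F k.
have mF k : measurable (F k) by exact: measurable_itv.
have mA : measurable A by apply: bigsetU_measurable => k _; exact: mF.
have muA : (mu A < d%:E)%E.
  have -> : mu A = (\sum_(k < m) mu (F k))%E by exact: measure_semi_additive_ord.
  rewrite (eq_bigr (fun k => (r k - l k)%:E)) ?sumEFin ?lte_fin// => k _.
  rewrite lebesgue_measure_itv/= lte_fin.
  have [/andP[_ lk] _] := lr k; case: ltP => // rl.
  by rewrite (@le_anti _ _ (l k) (r k)) ?subrr// lk rl.
apply: le_lt_trans (hd A mA muA).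
have -> : (\int[mu]_(x in A) `|h x|)%R = \sum_k (\int[mu]_(x in F k) h x)%R.
  rewrite /Rintegral (@ge0_integral_bigsetU _ _ _ mu _ F)//.
  - rewrite -sum_fine//.
      apply: eq_bigr => k _; congr fine; apply: eq_integral => x _.
      by rewrite ger0_norm.
    move=> k _; apply: integrable_fin_num; first exact: mF.
    exact: (integrable_abse (inth_itv `]l k, r k[)).
  - exact: index_enum_uniq.
  - by apply: sub_trivIset tI => ? ?.
  - apply/measurable_EFinP; apply: measurableT_comp => //.
    by apply: measurable_funTS; apply/measurable_EFinP; exact: measurable_int inth.
apply: ler_sum => k _; have [/andP[l0 lk] rk] := lr k.
by rewrite ger0_norm ?subr_ge0 ?primitive_le// primitiveB.
Qed.

Lemma derive_primitive :
  {ae mu, forall t, 0 < t -> derivable primitive t 1 /\ derive1 primitive t = h t}.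
Proof.
have loc : locally_integrable setT h.
  by apply: open_integrable_locally => //; exact: openT.
have := @FTC1 R h (BLeft 0) (fun y => inth_itv _) loc.
apply: filterS; first exact: (ae_filter_ringOfSetsType mu).
by move=> x /= hx x0; apply: hx; rewrite lte_fin.
Qed.

End indefinite_integral.

Section linear_derivative.
Context {R : realType} {V W Z : normedModType R}.

(** Linearity of c is assumed in the very shape in which it meets a difference quotient. *)
Lemma is_derive_linear_comp (c : W -> Z) (f : V -> W) (p v : V) (df : W) :
  (forall k u w, c (k *: (u - w)) = k *: (c u - c w)) -> continuous c ->
  is_derive p v f df -> is_derive p v (c \o f) (c df).
Proof.
move=> clin cc [fpv fd].
have cf : (fun h : R => h^-1 *: ((c \o f) (h *: v + p) - (c \o f) p)) @ 0^' --> c df.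
  rewrite (_ : (fun h => _) = c \o (fun h : R => h^-1 *: (f (h *: v + p) - f p))).
    apply: continuous_cvg; first exact: cc.
    have /cvg_ex[a fa] := fpv.
    by have -> : df = a by rewrite -fd; exact: cvg_lim fa.
  by apply/funext => h /=; rewrite clin.
by apply: DeriveDef; [apply/cvg_ex; exists (c df)|exact: cvg_lim cf].
Qed.

(** This gives access to the one-variable rules, the chain rule above all, for directional
    derivatives. *)
Lemma is_derive_lineP (f : V -> W) (p v : V) (df : W) :
  is_derive (0 : R) 1 (fun t : R => f (t *: v + p)) df <-> is_derive p v f df.
Proof.
have E : (fun h : R => h^-1 *: (((fun t : R => f (t *: v + p)) \o shift (0 : R)) (h *: 1) -
    f (0 *: v + p))) = (fun h : R => h^-1 *: ((f \o shift p) (h *: v) - f p)).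
  by apply/funext => h /=; rewrite addr0 scale0r add0r /GRing.scale/= mulr1.
split => -[d1 d2].
- by apply: DeriveDef; [move: d1|move: d2]; rewrite /derivable /derive E.
- by apply: DeriveDef; [move: d1|move: d2]; rewrite /derivable /derive E.
Qed.

End linear_derivative.

(** * Linear algebra of the horizontal frame *)

Section heisenberg_algebra.
Context {R : realType} {n : nat}.
Implicit Types (p q u v w : heis R n) (i : 'I_n).

(** Multiplication by i on C^n, where x + i y is the horizontal part. The third entry is set to 0,
    [hdot] being blind to it. *)
Definition hrot p : heis R n := (- p.1.2, p.1.1, 0).

Lemma hdotC v w : hdot v w = hdot w v.
Proof. by apply: eq_bigr => i _; rewrite mulrC [X in _ + X]mulrC. Qed.

Lemma hdotDl u v w : hdot (u + v) w = hdot u w + hdot v w.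
Proof. by rewrite -big_split; apply: eq_bigr => i _ /=; rewrite !mxE; ring. Qed.

Lemma hdotZl (k : R) v w : hdot (k *: v) w = k * hdot v w.
Proof. by rewrite mulr_sumr; apply: eq_bigr => i _ /=; rewrite !mxE; ring. Qed.

Lemma hdotDr u v w : hdot w (u + v) = hdot w u + hdot w v.
Proof. by rewrite hdotC hdotDl !(hdotC w). Qed.

Lemma hdotZr (k : R) v w : hdot w (k *: v) = k * hdot w v.
Proof. by rewrite hdotC hdotZl hdotC. Qed.

Lemma hdotNl v w : hdot (- v) w = - hdot v w.
Proof. by rewrite -scaleN1r hdotZl mulN1r. Qed.

Lemma hdotNr v w : hdot w (- v) = - hdot w v.
Proof. by rewrite hdotC hdotNl hdotC. Qed.

Lemma hdotBl u v w : hdot (u - v) w = hdot u w - hdot v w.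
Proof. by rewrite hdotDl hdotNl. Qed.

Lemma hdotBr u v w : hdot w (u - v) = hdot w u - hdot w v.
Proof. by rewrite hdotDr hdotNr. Qed.

Lemma hdot0l v : hdot 0 v = 0.
Proof. by rewrite -(scale0r (0 : heis R n)) hdotZl mul0r. Qed.

Lemma hdot_ge0 v : 0 <= hdot v v.
Proof. by apply: sumr_ge0 => i _; rewrite addr_ge0// -expr2 sqr_ge0. Qed.

Lemma hdot_gt0 v i : (v.1.1 0 i != 0) || (v.1.2 0 i != 0) -> 0 < hdot v v.
Proof.
move=> vi; rewrite /hdot (bigD1 i)//= -!expr2 ltr_pwDl//.
  by case/orP: vi => vi; [rewrite ltr_pwDl|rewrite ltr_wpDl]; rewrite ?sqr_ge0// exprn_even_gt0.
by apply: sumr_ge0 => j _; rewrite addr_ge0// -expr2 sqr_ge0.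
Qed.

Lemma hdot_hrot v w : hdot (hrot v) (hrot w) = hdot v w.
Proof. by apply: eq_bigr => i _ /=; rewrite !mxE; ring. Qed.

Lemma hdot_hrot_id v : hdot v (hrot v) = 0.
Proof. by rewrite /hdot big1 => // i _ /=; rewrite !mxE; ring. Qed.

Lemma sqnormE p : sqnorm p.1.1 + sqnorm p.1.2 = hdot p p.
Proof. by rewrite -big_split; apply: eq_bigr => i _ /=; rewrite !expr2. Qed.

(** On triples [hdot] is only semidefinite, so the case [hdot v v = 0] is settled apart: both
    horizontal parts of v vanish. *)
Lemma hdot_CS v w : hdot v w ^+ 2 <= hdot v v * hdot w w.
Proof.
have := hdot_ge0 v; rewrite le_eqVlt => /predU1P[v0|v0].
  have v0' i : v.1.1 0 i = 0 /\ v.1.2 0 i = 0.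
    have /psumr_eq0P : \sum_i (v.1.1 0 i * v.1.1 0 i + v.1.2 0 i * v.1.2 0 i) = 0 by [].
    move=> /(_ _ i isT) h; have {}h : v.1.1 0 i ^+ 2 + v.1.2 0 i ^+ 2 = 0.
      by rewrite !expr2; apply: h => j _; rewrite addr_ge0// -expr2 sqr_ge0.
    by move/eqP : h; rewrite paddr_eq0 ?sqr_ge0// !sqrf_eq0 => /andP[/eqP ? /eqP].
  rewrite -v0 mul0r /hdot big1 ?expr0n//= => i _.
  by have [-> ->] := v0' i; rewrite !mul0r addr0.
rewrite -subr_ge0 -(pmulr_rge0 _ v0).
have := hdot_ge0 (hdot v v *: w - hdot v w *: v).
rewrite !(hdotBl, hdotBr, hdotZl, hdotZr) (hdotC w v); congr (_ <= _); ring.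
Qed.

Lemma hnorm_sq v : hnorm v ^+ 2 = hdot v v.
Proof. by rewrite sqr_sqrtr// hdot_ge0. Qed.

Lemma hnorm_ge0 v : 0 <= hnorm v.
Proof. exact: sqrtr_ge0. Qed.

Lemma hframe_sum p (a b : 'rV[R]_n) :
  \sum_i (a 0 i *: Xfield i p + b 0 i *: Yfield i p) =
  (a, b, hdot (hrot p) (a, b, 0) / 2).
Proof.
rewrite [LHS]surjective_pairing [X in (X, _)]surjective_pairing.
have E1 (v : 'I_n -> heis R n) : (\sum_i v i).1.1 = \sum_i (v i).1.1.
  by elim/big_ind2 : _ => // x1 x2 y1 y2 <- <-.
have E2 (v : 'I_n -> heis R n) : (\sum_i v i).1.2 = \sum_i (v i).1.2.
  by elim/big_ind2 : _ => // x1 x2 y1 y2 <- <-.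
have E3 (v : 'I_n -> heis R n) : (\sum_i v i).2 = \sum_i (v i).2.
  by elim/big_ind2 : _ => // x1 x2 y1 y2 <- <-.
rewrite E1 E2 E3; congr (_, _, _).
- rewrite [RHS]row_sum_delta; apply: eq_bigr => i _ /=.
  by rewrite scaler0 addr0.
- rewrite [RHS]row_sum_delta; apply: eq_bigr => i _ /=.
  by rewrite scaler0 add0r.
- rewrite /hdot mulr_suml; apply: eq_bigr => i _ /=.
  by rewrite !mxE /GRing.scale /=; field.
Qed.

(** The distribution is the kernel of the contact form dz - (x dy - y dx) / 2, and pairing with
    [hrot p] evaluates x dy - y dx. *)
Lemma hdistributionP p v : hdistribution p v <-> v.2 = hdot (hrot p) v / 2.
Proof.
split=> [[a [b ->]]|v2]; first by rewrite hframe_sum.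
exists v.1.1, v.1.2; rewrite hframe_sum [LHS]surjective_pairing.
by rewrite [X in (X, _)]surjective_pairing v2.
Qed.

Lemma hgrad_coord (f : heis R n -> R) p :
  hgrad f p = (\row_i 'D_(Xfield i p) f p, \row_i 'D_(Yfield i p) f p,
    hdot (hrot p) (\row_i 'D_(Xfield i p) f p, \row_i 'D_(Yfield i p) f p, 0) / 2).
Proof.
by rewrite -hframe_sum; apply: eq_bigr => i _; rewrite !mxE.
Qed.

Lemma continuous_xcoord i : continuous (fun p => p.1.1 0 i).
Proof.
move=> p; apply: (@continuous_comp _ _ _ (fun p => p.1.1) (fun M : 'rV[R]_n => M 0 i)).
  by apply: continuous_comp; [exact: cvg_fst|exact: cvg_fst].
exact: coord_continuous.
Qed.

Lemma continuous_ycoord i : continuous (fun p => p.1.2 0 i).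
Proof.
move=> p; apply: (@continuous_comp _ _ _ (fun p => p.1.2) (fun M : 'rV[R]_n => M 0 i)).
  by apply: continuous_comp; [exact: cvg_fst|exact: cvg_snd].
exact: coord_continuous.
Qed.

Lemma continuous_zcoord : continuous (fun p => p.2).
Proof. by move=> p; exact: cvg_snd. Qed.

Lemma ler_norm_coord p i :
  [/\ `|p.1.1 0 i| <= `|p|, `|p.1.2 0 i| <= `|p| & `|p.2| <= `|p| ].
Proof.
have h (M : 'rV[R]_n) : `|M 0 i| <= `|M|.
  have -> : `|M| = mx_norm M by [].
  rewrite mx_normrE; exact: (@le_bigmax _ _ _ 0 (fun ij => `|M ij.1 ij.2|) (0, i)).
split; rewrite prod_normE/= le_max.
- by apply/orP; left; rewrite prod_normE/= le_max h.
- by apply/orP; left; rewrite prod_normE/= le_max h orbT.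
- by rewrite lexx orbT.
Qed.

End heisenberg_algebra.

Section abs_continuous_algebra.
Context {R : realType}.
Implicit Types f g : R -> R.

(** Common source of the closure properties: sums, products, coordinates and Lipschitz images all
    have increments dominated in this way. *)
Lemma abs_continuous_le2 (V1 V2 W : normedModType R) (f1 : R -> V1)
    (f2 : R -> V2) (f : R -> W) (M : R) :
  abs_continuous 0 1 f1 -> abs_continuous 0 1 f2 ->
  (forall l r, 0 <= l -> l <= r -> r <= 1 ->
    `|f r - f l| <= M * (`|f1 r - f1 l| + `|f2 r - f2 l|)) ->
  abs_continuous 0 1 f.
Proof.
(* M may be nonpositive, while the tolerances below are divided by the constant. *)
move=> ac1 ac2 fM e e0; pose M' := Num.max M 1.
have M0 : 0 < M' by rewrite lt_max ltr01 orbT.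
have e20 : 0 < e / (2 * M') by rewrite divr_gt0// mulr_gt0.
have [d1 d10 h1] := ac1 _ e20; have [d2 d20 h2] := ac2 _ e20.
exists (Num.min d1 d2); first by rewrite lt_min d10.
move=> m l r lr tI; rewrite lt_min => /andP[/(h1 _ _ _ lr tI) h1' /(h2 _ _ _ lr tI) h2'].
apply: (@le_lt_trans _ _ (\sum_k M' * (`|f1 (r k) - f1 (l k)| + `|f2 (r k) - f2 (l k)|))).
  apply: ler_sum => k _; have [/andP[l0 lk] r1] := lr k.
  apply: (le_trans (fM _ _ l0 lk r1)); apply: ler_wpM2r; first by rewrite addr_ge0.
  by rewrite le_max lexx.
rewrite -mulr_sumr big_split/= mulrC -ltr_pdivlMr//.
have -> : e / M' = e / (2 * M') + e / (2 * M') by field; rewrite gt_eqF.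
exact: ltrD.
Qed.

(** Finitely many steps of length d / 2 cross [0, 1], and each changes f by less than 1. *)
Lemma abs_continuous_bounded f : abs_continuous 0 1 f ->
  exists2 M : R, 0 < M & forall t, 0 <= t <= 1 -> `|f t| <= M.
Proof.
move=> acf; have [d d0 hd] := acf 1 ltr01.
have step (l r : R) : 0 <= l -> l <= r -> r <= 1 -> r - l < d -> `|f r - f l| < 1.
  move=> l0 lr r1 rld; have := hd 1%N (fun=> l) (fun=> r).
  rewrite !big_ord1; apply => //; first by move=> k; rewrite l0 lr.
  by apply/trivIsetP => i j _ _; rewrite (ord1 i) (ord1 j) eqxx.
pose s := d / 2; have s0 : 0 < s by rewrite divr_gt0.
have sd : s < d by rewrite ltr_pdivrMr//; lra.
have ind (k : nat) t : 0 <= t <= 1 -> t <= k%:R * s -> `|f t| <= `|f 0| + k%:R.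
  elim: k t => [|k ih] t /andP[t0 t1] tk.
    by rewrite mul0r in tk; rewrite (@le_anti _ _ t 0) ?addr0// tk.
  have [ts|ts] := leP t s.
    have := step 0 t; rewrite lexx subr0 (le_lt_trans ts sd) => /(_ isT t0 t1 isT).
    have := ler_normD (f t - f 0) (f 0); rewrite subrK => h1 h2.
    by rewrite -natr1; have := ler0n R k; lra.
  have := ih (t - s); rewrite subr_ge0 (ltW ts)/= lerBlDr.
  have -> : t <= 1 + s by lra.
  have -> : t - s <= k%:R * s by rewrite lerBlDr; move: tk; rewrite -natr1 mulrDl mul1r.
  move=> /(_ isT isT) h.
  have h' : `|f t - f (t - s)| < 1 by apply: step => //; lra.
  have := ler_normD (f t - f (t - s)) (f (t - s)); rewrite subrK -natr1; lra.
have [k sk] : exists k : nat, 1 / s < k%:R by exists (Num.bound (1 / s)); rewrite archi_boundP// divr_ge0 ?ltW.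
exists (`|f 0| + k%:R + 1); first by rewrite ltr_wpDl// addr_ge0.
move=> t /andP[t0 t1]; apply: (le_trans (ind k t _ _)); rewrite ?t0 ?t1//.
- by apply: (le_trans t1); move: sk; rewrite ltr_pdivrMr// => /ltW.
- by rewrite lerDl.
Qed.

Lemma abs_continuousD f g : abs_continuous 0 1 f -> abs_continuous 0 1 g ->
  abs_continuous 0 1 (fun t => f t + g t).
Proof.
move=> acf acg; apply: (abs_continuous_le2 (M := 1) acf acg) => l r _ _ _.
by rewrite mul1r opprD addrACA ler_normD.
Qed.

Lemma abs_continuousM f g : abs_continuous 0 1 f -> abs_continuous 0 1 g ->
  abs_continuous 0 1 (fun t => f t * g t).
Proof.
move=> acf acg; have [M M0 fM] := abs_continuous_bounded acf.
have [N N0 gN] := abs_continuous_bounded acg.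
apply: (abs_continuous_le2 (M := Num.max M N) acf acg) => l r l0 lr r1.
have -> : f r * g r - f l * g l = (f r - f l) * g r + f l * (g r - g l) by ring.
apply: (le_trans (ler_normD _ _)); rewrite !normrM mulrDr; apply: lerD.
  rewrite mulrC ler_wpM2r// (le_trans (gN r _)) ?le_max ?lexx ?orbT//.
  by rewrite (le_trans l0 lr).
by rewrite ler_wpM2r// (le_trans (fM l _)) ?le_max ?lexx ?orbT// l0 (le_trans lr).
Qed.

Lemma abs_continuous_cst (V : normedModType R) (c : V) : abs_continuous 0 1 (fun=> c).
Proof.
move=> e e0; exists 1 => // m l r _ _ _; rewrite big1// => k _.
by rewrite subrr normr0.
Qed.

Lemma abs_continuous_sum (k : nat) (f : 'I_k -> R -> R) :
  (forall i, abs_continuous 0 1 (f i)) -> abs_continuous 0 1 (fun t => \sum_i f i t).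
Proof.
elim: k f => [|k ih] f acf.
  rewrite (_ : (fun t => _) = fun=> 0); first exact: abs_continuous_cst.
  by apply/funext => t; rewrite big_ord0.
rewrite (_ : (fun t => _) = fun t => f ord0 t + \sum_i f (lift ord0 i) t).
  by apply: abs_continuousD => //; exact: (ih (fun i => f (lift ord0 i))).
by apply/funext => t; rewrite big_ord_recl.
Qed.

End abs_continuous_algebra.

Section calibration.
Context {R : realType} {n : nat}.
Notation mu := (@lebesgue_measure R).
Implicit Types (p : heis R n) (g : R -> heis R n).

Definition arc_energy (th : R) p : R :=
  2 * th * p.2 + th * halfcot th * hdot p p.

Let abs_continuous_coord (c : heis R n -> R) g :
  (forall u v, `|c u - c v| <= `|u - v|) -> abs_continuous 0 1 g ->
  abs_continuous 0 1 (c \o g).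
Proof.
move=> cN acg; apply: (abs_continuous_le2 (M := 1) acg (abs_continuous_cst (0 : R))).
by move=> l r _ _ _; rewrite mul1r subrr normr0 addr0; exact: cN.
Qed.

(** Curves are arbitrary outside [0, 1]. Composed with this retraction, their coordinates become
    continuous on the whole line, as [measurable_derive1] requires. *)
Let clamp (t : R) : R := Num.max 0 (Num.min 1 t).

Let clampE t : 0 <= t <= 1 -> clamp t = t.
Proof. by move=> /andP[t0 t1]; rewrite /clamp (min_idPr t1) (max_idPr t0). Qed.

Let clamp_itv t : 0 <= clamp t <= 1.
Proof. by rewrite /clamp le_max lexx/= ge_max ler01 ge_min lexx. Qed.

Let clamp_lip s t : s <= t -> clamp s <= clamp t /\ clamp t - clamp s <= t - s.
Proof.
move=> st.
have c0 x : x <= 0 -> clamp x = 0.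
  by move=> x0; apply/max_idPl; rewrite ge_min x0 orbT.
have c1 x : 1 <= x -> clamp x = 1.
  by move=> x1; rewrite /clamp (min_idPl x1); apply/max_idPr.
have cE x : [\/ x <= 0 /\ clamp x = 0, 0 <= x <= 1 /\ clamp x = x |
    1 <= x /\ clamp x = 1].
  have [x0|x0] := leP x 0; first by apply: Or31; rewrite c0.
  have [x1|x1] := leP x 1; last by apply: Or33; rewrite c1 ?ltW.
  have x01 : 0 <= x <= 1 by rewrite (ltW x0) x1.
  by apply: Or32; split; [rewrite (ltW x0)|exact: clampE].
case: (cE s) => [[s0 ->]|[/andP[s0 s1] ->]|[s1 ->]];
  case: (cE t) => [[t0 ->]|[/andP[t0 t1] ->]|[t1 ->]]; split; lra.
Qed.

Let clamp_continuous (f : R -> R) : abs_continuous 0 1 f ->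
  continuous (f \o clamp).
Proof.
move=> acf x; apply/cvgrPdist_lt => e e0.
have [d d0 hd] := acf _ e0.
have key y t : y <= t -> t - y < d -> `|f (clamp t) - f (clamp y)| < e.
  move=> yt ytd; have [c1 c2] := clamp_lip yt.
  have := hd 1%N (fun=> clamp y) (fun=> clamp t); rewrite !big_ord1/=; apply.
  - move=> _; have /andP[y0 _] := clamp_itv y; have /andP[_ t1] := clamp_itv t.
    by rewrite y0 c1 t1.
  - by apply/trivIsetP => i j _ _; rewrite (ord1 i) (ord1 j) eqxx.
  - exact: le_lt_trans ytd.
near=> t.
have tx : `|x - t| < d by near: t; exact: cvgr_dist_lt.
have [xt|tx'] := leP x t.
  by rewrite distrC; apply: key => //; rewrite ler0_norm ?subr_le0// opprB in tx.
by apply: key (ltW tx') _; rewrite gtr0_norm ?subr_gt0 in tx.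
Unshelve. all: by end_near. Qed.

Let coordN (u v : heis R n) : (forall i, `|u.1.1 0 i - v.1.1 0 i| <= `|u - v| /\
  `|u.1.2 0 i - v.1.2 0 i| <= `|u - v|) /\ `|u.2 - v.2| <= `|u - v|.
Proof.
split; last by rewrite prod_normE/= le_max lexx orbT.
by move=> i; have [h1 h2 _] := ler_norm_coord (u - v) i; move: h1 h2; rewrite !mxE.
Qed.

(** Away from its poles 0 and 2 pi, [halfcot] has a continuous and hence bounded derivative on a
    segment. This is what makes its composition with the phase of the calibration absolutely
    continuous. *)
Let halfcot_lipschitz (a b : R) : 0 < a -> b < 2 * pi ->
  exists2 M : R, 0 <= M & forall x y, a <= x -> x <= y -> y <= b ->
    `|halfcot y - halfcot x| <= M * (y - x).
Proof.
move=> a0 bpi.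
have [ab|ba] := ltP b a.
  by exists 0 => // x y ax xy yb; move: ab; rewrite ltNge (le_trans ax)// (le_trans xy).
have dk x : x \in `[a, b] -> is_derive x 1 halfcot (- (1 / 4 + halfcot x ^+ 2)).
  rewrite in_itv/= => /andP[ax xb]; apply: is_derive_halfcot; apply: cos_lt1.
  by rewrite (lt_le_trans a0)// (le_lt_trans xb).
have ck : {within `[a, b], continuous halfcot}.
  by apply: derivable_within_continuous => x /dk h; exact: ex_derive.
have ck2 : {within `[a, b], continuous (fun x => 1 / 4 + halfcot x ^+ 2)}.
  move=> x; apply: cvgD; first exact: cvg_cst.
  rewrite (_ : (fun x => _) = (fun y => halfcot y * halfcot y)).
    by apply: cvgM; exact: ck.
  by apply/funext => y; rewrite expr2.
have [c cab hc] := EVT_max ba ck2.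
exists (1 / 4 + halfcot c ^+ 2); first by rewrite addr_ge0 ?sqr_ge0.
move=> x y ax xy yb.
have sub : {subset `[x, y] <= `[a, b]}.
  by move=> t; rewrite !in_itv/= => /andP[xt ty]; rewrite (le_trans ax)// (le_trans ty).
have dk' t : t \in `]x, y[ -> is_derive t 1 halfcot (- (1 / 4 + halfcot t ^+ 2)).
  by move=> txy; apply: dk; apply: sub; exact: subset_itv_oo_cc.
have ck' : {within `[x, y], continuous halfcot}.
  by apply: derivable_within_continuous => t /sub /dk h; exact: ex_derive.
have [t txy E] := MVT_segment xy dk' ck'.
rewrite E.
rewrite normrM (ger0_norm (_ : 0 <= y - x)) ?subr_ge0//; apply: ler_wpM2r.
  by rewrite subr_ge0.
by rewrite normrN ger0_norm ?addr_ge0 ?sqr_ge0//; apply: hc; exact: sub.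
Qed.

(** The left side pairs w with J v / 2 + ka v, whose squared length is Q = (1/4 + ka^2) |v|^2
    because J is an isometry with J v orthogonal to v. Cauchy-Schwarz bounds it by |w| sqrt Q, and
    the arithmetic-geometric mean inequality with weight k removes the root. *)
Let calibration_slope (k : R) (ka : R) (v w : heis R n) : 0 < k ->
  hdot (hrot v) w / 2 + ka * hdot v w <=
  k * hnorm w * ((1 / 4 + ka ^+ 2) * hdot v v) / 2 + hnorm w / (2 * k).
Proof.
move=> k0; set Q := (_ + _) * hdot v v; set s := hnorm w.
have Q0 : 0 <= Q by rewrite mulr_ge0 ?hdot_ge0// addr_ge0 ?sqr_ge0.
have s0 : 0 <= s := hnorm_ge0 w.
have -> : hdot (hrot v) w / 2 + ka * hdot v w = hdot (2^-1 *: hrot v + ka *: v) w.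
  by rewrite hdotDl !hdotZl mulrC.
have CS := hdot_CS (2^-1 *: hrot v + ka *: v) w.
have E : hdot (2^-1 *: hrot v + ka *: v) (2^-1 *: hrot v + ka *: v) = Q.
  rewrite !(hdotDl, hdotDr, hdotZl, hdotZr) hdot_hrot (hdotC (hrot v)) hdot_hrot_id.
  by rewrite /Q; field.
rewrite E -hnorm_sq -/s in CS.
set X := hdot _ w in CS *; set Y := _ + _.
have Y0 : 0 <= Y.
  have k0' := ltW k0.
  by apply: addr_ge0; apply: divr_ge0 => //; do ?apply: mulr_ge0 => //.
have XY : X ^+ 2 <= Y ^+ 2.
  apply: (le_trans CS); rewrite -subr_ge0.
  have -> : Y ^+ 2 - Q * s ^+ 2 = (k * s * Q / 2 - s / (2 * k)) ^+ 2.
    by rewrite /Y; field; rewrite gt_eqF.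
  exact: sqr_ge0.
have := ler_norm X; move/le_trans; apply.
by rewrite -(ger0_norm Y0) -ler_sqr ?nnegrE// !real_normK ?num_real.
Qed.

(* V t = z + |w|^2 cot (k (S + e) / 2) / 4 - S / (2 k), where S is the length
   of the curve up to time t, is nonincreasing: its derivative is minus a
   square, because b = cot (k s / 2) / 2 solves b' = - k (1/4 + b^2). *)
Lemma calibration g p th L : horizontal_curve g -> g 0 = 0 -> g 1 = p ->
  0 < th < 2 * pi -> (curve_length g <= L%:E)%E -> arc_energy th p <= L ^+ 2.
Proof.
move=> [acg [N [mN N0 gN]]] g0 g1 /andP[th0 thpi] len.
have acx i : abs_continuous 0 1 (fun t => (g t).1.1 0 i).
  by apply: (abs_continuous_coord (c := fun p => p.1.1 0 i)) => // u v; have [/(_ i)[]] := coordN u v.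
have acy i : abs_continuous 0 1 (fun t => (g t).1.2 0 i).
  by apply: (abs_continuous_coord (c := fun p => p.1.2 0 i)) => // u v; have [/(_ i)[]] := coordN u v.
have acz : abs_continuous 0 1 (fun t => (g t).2).
  by apply: (abs_continuous_coord (c := fun p => p.2)) => // u v; have [] := coordN u v.
pose q t := hdot (g t) (g t).
have acq : abs_continuous 0 1 q.
  by apply: abs_continuous_sum => i; apply: abs_continuousD; exact: abs_continuousM.
(* Interior times at which the curve is differentiable and horizontal. Setting the speed to 0
   elsewhere makes it measurable and changes it on [0, 1] only over a null set. *)
pose D : set R := `]0, 1[%classic `\` N.
have mD : measurable D by apply: measurableD => //; exact: measurable_itv.
have gD t : D t -> derivable g t 1 /\ hdistribution (g t) (derive1 g t).
  move=> [t01 Nt]; apply: contrapT => hh; apply: Nt; apply: gN => /= h; apply: hh.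
  by apply: h; exact: subset_itv_oo_cc.
have dco (c : heis R n -> R) : (forall k u w, c (k *: (u - w)) = k *: (c u - c w)) ->
    continuous c -> forall t, D t -> is_derive t 1 (c \o g) (c (derive1 g t)).
  move=> cl cc t /gD[dg _]; apply: (@is_derive_linear_comp R R (heis R n) R c g t 1) cl cc _.
  by rewrite derive1E; exact: derivableP.
have dx i t : D t -> is_derive t 1 (fun s => (g s).1.1 0 i) ((derive1 g t).1.1 0 i).
  by apply: (dco (fun p => p.1.1 0 i)) => [k u w|]; [rewrite !mxE|exact: continuous_xcoord].
have dy i t : D t -> is_derive t 1 (fun s => (g s).1.2 0 i) ((derive1 g t).1.2 0 i).
  by apply: (dco (fun p => p.1.2 0 i)) => [k u w|]; [rewrite !mxE|exact: continuous_ycoord].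
have dz t : D t -> is_derive t 1 (fun s => (g s).2) (derive1 g t).2.
  by apply: (dco (fun p => p.2)) => [k u w|] //; exact: continuous_zcoord.
pose h := (hnorm \o derive1 g) \_ D.
have h0 t : 0 <= h t by rewrite /h /patch; case: ifPn => // _; exact: hnorm_ge0.
have mh : measurable_fun setT h.
  apply/(measurable_restrictT _ mD).
  have mc (f : R -> R) (df : R -> R) : abs_continuous 0 1 f ->
      (forall t, D t -> is_derive t 1 f (df t)) -> measurable_fun D df.
    move=> acf fdf.
    have E t : D t -> is_derive t 1 (f \o clamp) (df t).
      move=> Dt; have := fdf _ Dt; apply: near_eq_is_derive.
      have [/= t01 _] := Dt; near=> s; rewrite /= clampE//.
      have : s \in `]0, 1[ by near: s; exact: near_in_itvoo.
      by rewrite in_itv/= => /andP[/ltW -> /ltW].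
    apply: (eq_measurable_fun (derive1 (f \o clamp))).
      move=> t; rewrite inE => /E Et; rewrite derive1E.
      by rewrite (@derive_val _ _ _ _ _ _ _ Et).
    apply: measurable_derive1 => //; first exact: clamp_continuous.
    by move=> t /E Et; exact: ex_derive.
  have msq : measurable_fun [set: R] (@Num.sqrt R).
    exact: (continuous_measurable_fun (@sqrt_continuous R)).
  apply: (measurableT_comp msq).
  rewrite /hdot; apply: measurable_sum => i; apply: measurable_funD.
    by apply: measurable_funM; exact: (mc _ _ (acx i) (dx i)).
  by apply: measurable_funM; exact: (mc _ _ (acy i) (dy i)).
have hle : (\int[mu]_(t in `[0%R, 1%R]) (h t)%:E <= L%:E)%E.
  apply: le_trans len; apply: ge0_le_integral_nonmeasurable => t _.
    by rewrite lee_fin.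
  rewrite lee_fin /h /patch; case: ifPn => // _; exact: hnorm_ge0.
have hE : (\int[mu]_t (h t)%:E = \int[mu]_(t in `[0%R, 1%R]) (h t)%:E)%E.
  rewrite [RHS]integral_mkcond; apply: eq_integral => t _.
  rewrite [RHS]/patch; case: ifPn => // /negP t01.
  rewrite /h patchE memNset// => -[/= t01' _]; apply: t01; rewrite inE /=.
  exact: subset_itv_oo_cc.
have inth : mu.-integrable setT (EFin \o h).
  apply/integrableP; split; first exact/measurable_EFinP.
  apply: le_lt_trans (ltry L); apply: le_trans hle; rewrite -hE.
  apply: ge0_le_integral_nonmeasurable => t _; first exact: abse_ge0.
  by rewrite gee0_abs// lee_fin.
pose S := primitive h.
have S0 : S 0 = 0 := primitive0 h.
have SL : S 1 <= L.
  rewrite -lee_fin /S /primitive /Rintegral fineK//.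
  rewrite ge0_fin_numE ?(le_lt_trans hle) ?ltry//.
  by apply: integral_ge0 => t _; rewrite lee_fin.
have Sle l r : 0 <= l -> l <= r -> S l <= S r by exact: primitive_le.
have S1 : 0 <= S 1 by rewrite -S0 Sle.
(* The shift by e keeps the phase above [k * e], away from the pole of [halfcot] at 0, where the
   curve starts. Letting e tend to 0 restores the squared length. *)
suff main e : 0 < e -> arc_energy th p <= S 1 * (S 1 + e).
  apply/ler_addgt0Pr => e e0.
  have e1 : 0 < e / (S 1 + 1) by rewrite divr_gt0// ltr_wpDl.
  apply: (le_trans (main _ e1)); rewrite mulrDr; apply: lerD.
    by rewrite -expr2 ler_sqr ?nnegrE// (le_trans S1).
  by rewrite mulrA ler_pdivrMr ?ltr_wpDl// mulrC ler_pM2l// lerDl.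
(* k is the curvature for which the phase k (S + e) equals th exactly at time 1. *)
move=> e0; pose k := th / (S 1 + e).
have Se : 0 < S 1 + e by rewrite ltr_wpDl.
have k0 : 0 < k by rewrite divr_gt0.
have kS : k * (S 1 + e) = th by rewrite /k divfK// gt_eqF.
pose ph t := k * (S t + e).
have phd t : 0 <= t <= 1 -> k * e <= ph t <= th.
  move=> /andP[t0 t1]; rewrite -kS !ler_pM2l// lerDr lerD2r Sle// andbT.
  by rewrite -S0 Sle.
have ke : 0 < k * e by rewrite mulr_gt0.
have [M M0 hM] := halfcot_lipschitz ke thpi.
have ack : abs_continuous 0 1 (halfcot \o ph).
  apply: (abs_continuous_le2 (M := M * k) (primitive_abs_continuous h0 inth)
    (abs_continuous_cst (0 : R))) => l r l0 lr r1.
  rewrite subrr normr0 addr0 (ger0_norm (_ : 0 <= primitive h r - primitive h l)); last by rewrite subr_ge0 Sle.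
  have /andP[kl _] : k * e <= ph l <= th by rewrite phd// l0 (le_trans lr).
  have /andP[_ rk] : k * e <= ph r <= th by rewrite phd// r1 (le_trans l0).
  have lrS : ph l <= ph r by rewrite /ph ler_pM2l// lerD2r Sle.
  apply: (le_trans (hM _ _ kl lrS rk)); rewrite -mulrA ler_wpM2l//.
  by rewrite /ph -mulrBr ler_pM2l// opprD addrACA subrr addr0.
pose V t := (g t).2 + (2^-1 * (halfcot (ph t) * q t) + (- (2 * k)^-1) * S t).
have acV : abs_continuous 0 1 V.
  apply: abs_continuousD => //; apply: abs_continuousD.
    apply: abs_continuousM; first exact: abs_continuous_cst.
    exact: abs_continuousM.
  apply: abs_continuousM; first exact: abs_continuous_cst.
  exact: primitive_abs_continuous.
have aeD : {ae mu, forall t, t \in `[0%R, 1%R] -> D t}.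
  exists (N `|` [set 0; 1]); split.
  - by apply: measurableU => //; apply: measurableU; exact: measurable_set1.
  - apply/eqP; rewrite -measure_le0.
    apply: (@le_trans _ _ (mu N + (mu [set 0%R] + mu [set 1%R]))%E).
      apply: (le_trans (measureU2 _ _ _)) => //.
        by apply: measurableU; exact: measurable_set1.
      by apply: leeD => //; apply: measureU2; exact: measurable_set1.
    by rewrite N0 !lebesgue_measure_set1 !adde0.
  - move=> t /= /not_implyP[]; rewrite in_itv/= => /andP[t0 t1] nD.
    have [->|t0'] := eqVneq t 0; first by right; left.
    have [->|t1'] := eqVneq t 1; first by right; right.
    left; apply: contrapT => Nt; apply: nD; split => //=.
    by rewrite in_itv/= lt_neqAle eq_sym t0' t0 lt_neqAle t1' t1.
have aeV : {ae mu, forall t, t \in `[0%R, 1%R] -> derivable V t 1 /\ derive1 V t <= 0}.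
  have aeS := derive_primitive inth.
  apply: (@filterS2 _ _ (ae_filter_ringOfSetsType mu) _ _ _ _ aeS aeD).
  move=> t St Dt t01; have {}Dt := Dt t01.
  have t0 : 0 < t by case: Dt => /= + _; rewrite in_itv/= => /andP[].
  have [dS dSE] := St t0; have {}dS : is_derive t 1 S (h t).
    by rewrite -dSE derive1E; exact: derivableP.
  have [_ /hdistributionP hz] := gD _ Dt.
  have dq : is_derive t 1 q (2 * hdot (g t) (derive1 g t)).
    rewrite (_ : q = \sum_i (fun t => (g t).1.1 0 i * (g t).1.1 0 i + (g t).1.2 0 i * (g t).1.2 0 i)); last first.
      by apply/funext => s; rewrite fct_sumE.
    rewrite /hdot mulr_sumr; apply: is_derive_sum => i.
    have dxi := dx i _ Dt; have dyi := dy i _ Dt.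
    by apply: is_derive_eq; rewrite /GRing.scale /=; ring.
  have dph : is_derive t 1 ph (k * h t).
    rewrite (_ : ph = k *: (S + cst e)) //.
    by apply: is_derive_eq; rewrite addr0.
  have pht : 0 < ph t < 2 * pi.
    have /andP[a b] := phd _ t01; apply/andP; split; last exact: le_lt_trans thpi.
    exact: lt_le_trans a.
  have dka : is_derive t 1 (halfcot \o ph) (- (1 / 4 + halfcot (ph t) ^+ 2) * (k * h t)).
    exact: (is_derive1_comp (is_derive_halfcot (cos_lt1 pht)) dph).
  have dzt := dz _ Dt.
  pose V' := (derive1 g t).2 + (2^-1 * (halfcot (ph t) * (2 * hdot (g t) (derive1 g t)) +
    q t * (- (1 / 4 + halfcot (ph t) ^+ 2) * (k * h t))) + (- (2 * k)^-1) * h t).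
  have dV : is_derive t 1 V V'.
    have dM := is_deriveM dka dq.
    exact: (is_deriveD dzt (is_deriveD (is_deriveZ (2^-1) dM) (is_deriveZ (- (2 * k)^-1) dS))).
  split; first exact: ex_derive.
  rewrite derive1E (@derive_val _ _ _ _ _ _ _ dV) /V' hz.
  have -> : h t = hnorm (derive1 g t) by rewrite /h patchE mem_set.
  have := calibration_slope (halfcot (ph t)) (g t) (derive1 g t) k0.
  by rewrite -/(q t) invfM; lra.
have := abs_continuous_nonincreasing acV aeV.
rewrite /V /q g0 g1 S0 hdot0l /ph kS !mulr0 !addr0 => hV.
rewrite /arc_energy -subr_ge0.
have -> : S 1 * (S 1 + e) - (2 * th * p.2 + th * halfcot th * hdot p p) =
  (2 * th) * - (p.2 + (2^-1 * (halfcot th * hdot p p) - (2 * k)^-1 * S 1)).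
  by rewrite /k; field; rewrite !gt_eqF.
by rewrite mulr_ge0 ?mulr_ge0 ?oppr_ge0 ?(ltW th0)// -mulNr.
Unshelve. all: by end_near. Qed.

End calibration.

(** * Geodesics, the distance and its gradient *)

Section geodesics.
Context {R : realType} {n : nat}.
Notation mu := (@lebesgue_measure R).
Implicit Types (p v w : heis R n) (th : R).

Lemma hrotD v w : hrot (v + w) = hrot v + hrot w.
Proof. by rewrite /hrot /= opprD -[0 in LHS]addr0. Qed.

Lemma hrotZ (k : R) v : hrot (k *: v) = k *: hrot v.
Proof. by rewrite /hrot /= -scalerN -[0 in LHS](scaler0 _ k). Qed.

(** If p is the end of a lifted arc of angle th, the calibration takes the value th^2 r^2, the
    squared length of that arc, where r^2 = |w|^2 / (2 (1 - cos th)) for the chord w. *)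
Lemma arc_energyE th p : 0 < th < 2 * pi ->
  p.2 * (4 * (1 - cos th)) = hdot p p * (th - sin th) ->
  arc_energy th p = th ^+ 2 * (hdot p p / (2 * (1 - cos th))).
Proof.
move=> thd pE; have c1 : 1 - cos th != 0 by rewrite gt_eqF// subr_gt0 cos_lt1.
have -> : arc_energy th p = (2 * th * (p.2 * (4 * (1 - cos th))) +
    2 * th * sin th * hdot p p) / (4 * (1 - cos th)).
  by rewrite /arc_energy /halfcot; field.
by rewrite pE; field.
Qed.

Let abs_continuous_id : abs_continuous 0 1 (fun t : R => t).
Proof.
move=> e e0; exists e => // m l r lr _; apply: le_lt_trans; apply: ler_sum => k _.
by have [/andP[_ h] _] := lr k; rewrite ger0_norm ?subr_ge0.
Qed.

Let abs_continuous_C1 (f df : R -> R) (M : R) :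
  (forall t : R, is_derive t 1 f (df t)) -> (forall t, `|df t| <= M) ->
  abs_continuous 0 1 f.
Proof.
move=> fdf dfM.
apply: (abs_continuous_le2 (M := M) abs_continuous_id (abs_continuous_cst (0 : R))).
move=> l r _ lr _; rewrite subrr normr0 addr0.
have df' t : t \in `]l, r[ -> is_derive t 1 f (df t) by [].
have cf : {within `[l, r], continuous f}.
  by apply: derivable_within_continuous => t _; have [] := fdf t.
have [c _ ->] := MVT_segment lr df' cf.
by rewrite normrM ler_wpM2r.
Qed.

Let abs_continuousZ (f : R -> R) v : abs_continuous 0 1 f ->
  abs_continuous 0 1 (fun t => f t *: v).
Proof.
move=> acf.
apply: (abs_continuous_le2 (M := `|v|) acf (abs_continuous_cst (0 : R))) => l r _ _ _.
by rewrite subrr normr0 addr0 -scalerBl normrZ mulrC.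
Qed.

Let abs_continuousDv (f g : R -> heis R n) : abs_continuous 0 1 f ->
  abs_continuous 0 1 g -> abs_continuous 0 1 (fun t => f t + g t).
Proof.
move=> acf acg; apply: (abs_continuous_le2 (M := 1) acf acg) => l r _ _ _.
by rewrite mul1r opprD addrACA ler_normD.
Qed.

Let is_derive_scale (f : R -> R) v (t df : R) : is_derive t 1 f df ->
  is_derive t 1 (fun t => f t *: v) (df *: v).
Proof.
move=> fdf; apply: (@is_derive_linear_comp R R R (heis R n) (fun k => k *: v) f t 1) => //.
  by move=> k u w; rewrite -scalerBl scalerA.
exact: scalel_continuous.
Qed.

(** Only the Gram table of the frame matters for the speed of the arc; abstracting the vectors
    leaves a polynomial identity. *)
Let hdot_frame (v1 v2 v3 : heis R n) (m a b : R) :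
  hdot v1 v1 = m -> hdot v1 v2 = 0 -> hdot v2 v2 = m ->
  (forall w, hdot w v3 = 0) ->
  let v := a *: v1 + b *: v2 + (1 : R) *: v3 in
  hdot v v = (a ^+ 2 + b ^+ 2) * m.
Proof.
move=> v11 v12 v22 v3w /=.
rewrite !(hdotDl, hdotDr, hdotZl, hdotZr) (hdotC v3 v1) (hdotC v3 v2) !v3w (hdotC v2).
by rewrite v11 v12 v22; ring.
Qed.

Let hdot_rot_frame (v1 v2 v3 : heis R n) (m a b c a' b' : R) :
  hdot v1 v1 = m -> hdot v1 v2 = 0 -> hdot v2 v2 = m ->
  (forall w, hdot w v3 = 0) -> (forall w, hdot (hrot v3) w = 0) ->
  (forall w, hdot (hrot v1) w = hdot v2 w) ->
  (forall w, hdot (hrot v2) w = - hdot v1 w) ->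
  hdot (hrot (a *: v1 + b *: v2 + c *: v3)) (a' *: v1 + b' *: v2 + (1 : R) *: v3) =
  (a * b' - b * a') * m.
Proof.
move=> v11 v12 v22 v3w rv3 rv1 rv2; rewrite !hrotD !hrotZ.
rewrite !(hdotDl, hdotDr, hdotZl, hdotZr) !rv1 !rv2 !rv3 !v3w (hdotC v2 v1).
by rewrite v11 v12 v22; ring.
Qed.

(* The horizontal projection of the curve is the arc of angle th of the circle
   through 0 and the projection of p. *)
Lemma geodesic th p : 0 < th < 2 * pi ->
  p.2 * (4 * (1 - cos th)) = hdot p p * (th - sin th) ->
  exists g, [/\ horizontal_curve g, g 0 = 0, g 1 = p &
    curve_length g = (th * Num.sqrt (hdot p p / (2 * (1 - cos th))))%:E].
Proof.
move=> thd pE; have c1 := cos_lt1 thd; have /andP[th0 _] := thd.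
have c1' : 1 - cos th != 0 by rewrite gt_eqF// subr_gt0.
set ka := halfcot th; set s := hdot p p.
pose q := s / (4 * (1 - cos th)).
pose h : heis R n := (p.1.1, p.1.2, 0).
pose z (r : R) : heis R n := (0, 0, r).
(* The projected circle has centre -v1 and squared radius m, and v2 is v1 rotated by J in its
   horizontal part. The vertical entries of v2 and v3 add up to the height q (th t - sin (th t)),
   twice the swept area divided by 2. *)
pose v1 := (- 2^-1) *: h - ka *: hrot p.
pose v2 := ka *: h - 2^-1 *: hrot p + z (- q).
pose v3 := z (th * q).
pose g t := (cos (th * t) - 1) *: v1 + sin (th * t) *: v2 + t *: v3.
pose g' t := (- (th * sin (th * t))) *: v1 + (th * cos (th * t)) *: v2 + (1 : R) *: v3.
have hh : hdot h h = s by [].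
have hr : hdot h (hrot p) = 0 by rewrite -(hdot_hrot_id p).
have rr : hdot (hrot p) (hrot p) = s by rewrite hdot_hrot.
have zl r v : hdot (z r) v = 0.
  by rewrite /hdot big1// => i _; rewrite !mxE !mul0r addr0.
have zr r v : hdot v (z r) = 0 by rewrite hdotC zl.
have rzl r v : hdot (hrot (z r)) v = 0.
  by rewrite /hdot big1// => i _; rewrite !mxE oppr0 !mul0r addr0.
pose m := s / (2 * (1 - cos th)).
have mE : (1 / 4 + ka ^+ 2) * s = m by rewrite /ka halfcotE// /m; field.
have v11 : hdot v1 v1 = m.
  rewrite /v1 !(hdotBl, hdotBr, hdotZl, hdotZr) (hdotC (hrot p)) hr rr hh -mE.
  by field.
have v12 : hdot v1 v2 = 0.
  rewrite /v1 /v2 !(hdotDl, hdotDr, hdotNl, hdotNr, hdotZl, hdotZr) !zr (hdotC (hrot p)) hr rr hh.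
  by field.
have v22 : hdot v2 v2 = m.
  rewrite /v2 !(hdotDl, hdotDr, hdotNl, hdotNr, hdotZl, hdotZr) !zr !zl (hdotC (hrot p)) hr rr hh -mE.
  by field.
have hrotv1 w : hdot (hrot v1) w = hdot v2 w.
  rewrite hdotDl zl addr0; apply: eq_bigr => i _.
  by rewrite /= !mxE; field.
have hrotv2 w : hdot (hrot v2) w = - hdot v1 w.
  rewrite /v2 hrotD hdotDl rzl addr0 -hdotNl; apply: eq_bigr => i _.
  by rewrite /= !mxE; field.
have dcos (t : R) : is_derive t 1 (fun t => cos (th * t) - 1) (- (th * sin (th * t))).
  have d1 : is_derive t 1 (fun t => th * t) th.
    by apply: is_derive_eq; rewrite /GRing.scale /=; ring.
  have d2 := is_derive1_comp (is_derive_cos (th * t)) d1.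
  have -> : (fun t => cos (th * t) - 1) = (cos \o (fun t => th * t)) - cst 1 by [].
  by apply: is_derive_eq; ring.
have dsin (t : R) : is_derive t 1 (fun t => sin (th * t)) (th * cos (th * t)).
  have d1 : is_derive t 1 (fun t => th * t) th.
    by apply: is_derive_eq; rewrite /GRing.scale /=; ring.
  have d2 := is_derive1_comp (is_derive_sin (th * t)) d1.
  by rewrite mulrC.
have dg (t : R) : is_derive t 1 g (g' t).
  apply: (is_deriveD (is_deriveD (is_derive_scale v1 (dcos t)) (is_derive_scale v2 (dsin t)))).
  exact: is_derive_scale (is_derive_id _ _).
have dgE t : derive1 g t = g' t.
  by rewrite derive1E (@derive_val _ _ _ _ _ _ _ (dg t)).
have g'g' t : hdot (g' t) (g' t) = th ^+ 2 * m.
  rewrite (hdot_frame _ _ v11 v12 v22) => [|w]; last exact: zr.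
  by rewrite -[in RHS](mulr1 (th ^+ 2)) -(cos2Dsin2 (th * t)); ring.
exists g; split.
- split.
    apply: abs_continuousDv; [apply: abs_continuousDv|]; apply: abs_continuousZ => //.
      apply: (abs_continuous_C1 (M := `|th|) dcos) => t.
      by rewrite normrN normrM ler_piMr// sin_max.
    apply: (abs_continuous_C1 (M := `|th|) dsin) => t.
    by rewrite normrM ler_piMr// cos_max.
  apply: aeW => t _; split; first by have [] := dg t.
  rewrite dgE; apply/hdistributionP.
  have rv3 w : hdot (hrot v3) w = 0 by exact: rzl.
  have v3w w : hdot w v3 = 0 by exact: zr.
  rewrite (hdot_rot_frame _ _ _ _ _ v11 v12 v22 v3w rv3 hrotv1 hrotv2) /=.
  have -> : m = 2 * q by rewrite /m /q; field.
  rewrite /GRing.scale /= !(mulr0, add0r, addr0, oppr0).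
  set C := cos _; set S := sin _.
  have -> : ((C - 1) * (th * C) - S * - (th * S)) * (2 * q) / 2 =
    ((C - 1) * (th * C) + th * S ^+ 2) * q by field.
  rewrite (_ : S ^+ 2 = 1 - C ^+ 2); last first.
    by rewrite -(cos2Dsin2 (th * t)) addrAC subrr add0r.
  by ring.
- by rewrite /g mulr0 cos0 sin0 subrr !scale0r !addr0.
- have e1 : - (cos th - 1) / 2 + sin th * ka = 1.
    rewrite /ka /halfcot (_ : _ + _ = ((1 - cos th) ^+ 2 + sin th ^+ 2) / (2 * (1 - cos th))); last by field.
    by rewrite (_ : sin th ^+ 2 = 1 - cos th ^+ 2) ?sin2cos2//; field.
  have e2 : (cos th - 1) * - ka - sin th / 2 = 0 by rewrite /ka /halfcot; field.
  rewrite /g mulr1 scale1r.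
  have -> : (cos th - 1) *: v1 + sin th *: v2 + v3 =
      (- (cos th - 1) / 2 + sin th * ka) *: h + ((cos th - 1) * - ka - sin th / 2) *: hrot p
      + z (q * (th - sin th)).
    congr (_, _, _).
    + by apply/rowP => i; rewrite !mxE; field.
    + by apply/rowP => i; rewrite !mxE; field.
    + by rewrite /= /GRing.scale /=; field.
  rewrite e1 e2 scale1r scale0r addr0.
  have -> : q * (th - sin th) = p.2.
    by rewrite /q mulrAC -pE mulfK// mulf_neq0.
  rewrite (_ : h + z p.2 = (p.1.1 + 0, p.1.2 + 0, 0 + p.2))// !addr0 add0r.
  by rewrite -!surjective_pairing.
- rewrite /curve_length (eq_integral (cst (th * Num.sqrt m)%:E)); last first.
    move=> t _; rewrite dgE /hnorm g'g' sqrtrM ?sqr_ge0// sqrtr_sqr.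
    by rewrite ger0_norm// ltW.
  by rewrite integral_cst//= lebesgue_measure_itv/= lte01 oppr0 adde0 mule1.
Qed.

Definition arc_angle p : R :=
  get [set th | 0 < th < 2 * pi /\ arc_ratio th = p.2 / hdot p p].

(** Besides the centre, the lower half-space is excluded: the cones lie in z > 0, where the arc
    angle stays strictly between 0 and 2 pi. *)
Definition noncentral : set (heis R n) := [set p | 0 < hdot p p /\ 0 < p.2].

Lemma arc_angleP p : noncentral p ->
  0 < arc_angle p < 2 * pi /\ arc_ratio (arc_angle p) = p.2 / hdot p p.
Proof.
move=> [s0 z0]; rewrite /arc_angle; case: xgetP => [th _ //|noth].
have [th h1 h2] := arc_ratio_surj (divr_gt0 z0 s0).
by case: (noth th).
Qed.

Lemma arc_angle_rel p : noncentral p ->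
  p.2 * (4 * (1 - cos (arc_angle p))) =
  hdot p p * (arc_angle p - sin (arc_angle p)).
Proof.
move=> Up; have [thd] := arc_angleP Up; have [s0 _] := Up.
have c1 : 1 - cos (arc_angle p) != 0 by rewrite gt_eqF// subr_gt0 cos_lt1.
have c2 : 4 * (1 - cos (arc_angle p)) != 0 by rewrite mulf_neq0.
rewrite /arc_ratio => /eqP; rewrite eqr_div// ?(gt_eqF s0)// => /eqP <-.
by rewrite mulrC.
Qed.

Definition sqdist p : R := arc_energy (arc_angle p) p.

Lemma sqdistE p : noncentral p -> sqdist p =
  arc_angle p ^+ 2 * (hdot p p / (2 * (1 - cos (arc_angle p)))).
Proof.
move=> Up; apply: arc_energyE; last exact: arc_angle_rel.
by have [] := arc_angleP Up.
Qed.

Lemma sqdist_gt0 p : noncentral p -> 0 < sqdist p.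
Proof.
move=> Up; rewrite sqdistE//; have [thd _] := arc_angleP Up; have [s0 _] := Up.
have /andP[th0 _] := thd.
by rewrite mulr_gt0 ?exprn_gt0// divr_gt0// mulr_gt0// subr_gt0 cos_lt1.
Qed.

Let noncentral_geodesic p : noncentral p -> exists g, [/\ horizontal_curve g, g 0 = 0,
  g 1 = p & curve_length g = (Num.sqrt (sqdist p))%:E].
Proof.
move=> Up; have [thd _] := arc_angleP Up.
have [g [hg g0 g1 lg]] := geodesic thd (arc_angle_rel Up).
exists g; split => //; rewrite lg sqdistE// [in RHS]sqrtrM ?sqr_ge0// sqrtr_sqr.
by rewrite ger0_norm//; case/andP: thd => /ltW.
Qed.

(** The geodesic to p has squared length [sqdist p], and a calibration of any angle stays below the
    squared length of any curve. So [sqdist] is a maximum over the angles, with no study of critical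
    points. *)
Lemma arc_energy_le_sqdist p th : noncentral p -> 0 < th < 2 * pi ->
  arc_energy th p <= sqdist p.
Proof.
move=> Up thd; have [g [hg g0 g1 lg]] := noncentral_geodesic Up.
rewrite -(sqr_sqrtr (ltW (sqdist_gt0 Up))).
by apply: (calibration hg g0 g1 thd); rewrite lg.
Qed.

Lemma ccdistE p : noncentral p -> ccdist p = Num.sqrt (sqdist p).
Proof.
move=> Up; have [g [hg g0 g1 lg]] := noncentral_geodesic Up.
rewrite /ccdist; set A := [set _ | _ in _].
suff -> : ereal_inf A = (Num.sqrt (sqdist p))%:E by [].
apply/eqP; rewrite eq_le; apply/andP; split.
  by apply: ereal_inf_lbound; exists g.
apply: le_ereal_inf_tmp => _ [g' [hg' g'0 g'1] <-].
have : (0 <= curve_length g')%E.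
  by apply: integral_ge0 => t _; rewrite lee_fin hnorm_ge0.
case E : (curve_length g') => [L| |]// L0; last by rewrite leey.
have {}L0 : 0 <= L by rewrite -lee_fin.
rewrite lee_fin -[leRHS](ger0_norm L0) -[leRHS]sqrtr_sqr; apply: ler_wsqrtr.
apply: (calibration hg' g'0 g'1); last by rewrite E.
by have [] := arc_angleP Up.
Qed.

Lemma ccdist_sq p : noncentral p -> ccdist p ^+ 2 = sqdist p.
Proof. by move=> Up; rewrite ccdistE// sqr_sqrtr// ltW// sqdist_gt0. Qed.

Lemma ccdist_gt0 p : noncentral p -> 0 < ccdist p.
Proof. by move=> Up; rewrite ccdistE// sqrtr_gt0 sqdist_gt0. Qed.

(** This is the calibration of angle pi, at which the cotangent term vanishes. *)
Lemma sqdist_ge p : noncentral p -> 2 * pi * p.2 <= sqdist p.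
Proof.
move=> Up; have := @arc_energy_le_sqdist p pi Up.
rewrite /arc_energy /halfcot sinpi !(mul0r, mulr0) addr0; apply.
by rewrite pi_gt0/= mulr_natl mulr2n ltrDl pi_gt0.
Qed.

(** The angle is below 2 pi and [th * halfcot th] is below 1. Together with [sqdist_ge], this keeps
    delta between positive constants on compact parts of z > 0, uniformly up to the centre. *)
Lemma sqdist_le p : noncentral p -> sqdist p <= 4 * pi * p.2 + hdot p p.
Proof.
move=> Up; have [/andP[th0 thpi] _] := arc_angleP Up; have [s0 z0] := Up.
rewrite /sqdist /arc_energy; set th := arc_angle p in th0 thpi *.
apply: lerD.
  by rewrite ler_pM2r//; lra.
rewrite -[leRHS]mul1r ler_pM2r//.
have := @arc_ratio_num_gt0 R th; rewrite th0 thpi => /(_ isT) h.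
have c1 : 0 < 1 - cos th by rewrite subr_gt0 cos_lt1// th0.
by rewrite /halfcot mulrA ler_pdivrMr ?mulr_gt0// mul1r ltW// -subr_gt0.
Qed.

End geodesics.

Section distance_gradient.
Context {R : realType} {n : nat}.
Implicit Types (p q u v w : heis R n).

Lemma is_derive_real_comp (V : normedModType R) (f : R -> R) (F : V -> R) (p v : V) (a b : R) :
  is_derive (F p) 1 f a -> is_derive p v F b -> is_derive p v (f \o F) (a * b).
Proof.
move=> fa /is_derive_lineP Fb; apply/is_derive_lineP.
apply: (@is_derive1_comp R f (fun t : R => F (t *: v + p)) 0) => //.
by rewrite scale0r add0r.
Qed.

Lemma continuous_hdot_id : continuous (fun p : heis R n => hdot p p).
Proof.
have h := @continuous_big R 'I_n +%R 0 xpredT (@add_continuous R) (heis R n) (index_enum _)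
  (fun i (p : heis R n) => p.1.1 0 i * p.1.1 0 i + p.1.2 0 i * p.1.2 0 i).
apply: h => i _ p.
by apply: cvgD; apply: cvgM; (exact: continuous_xcoord || exact: continuous_ycoord).
Qed.

Lemma near_noncentral p : noncentral p -> \forall q \near p, noncentral q.
Proof.
move=> [s0 z0]; near=> q; split; near: q.
  have := continuous_hdot_id (x := p); move/cvgr_gt; exact.
have := continuous_zcoord (x := p); move/cvgr_gt; exact.
Unshelve. all: by end_near. Qed.

(** As [arc_ratio] is increasing, two strict inequalities on z / (|x|^2 + |y|^2) trap the angle. The
    radius e' keeps both comparison angles inside (0, 2 pi). *)
Lemma continuous_arc_angle p : noncentral p -> {for p, continuous (@arc_angle R n)}.
Proof.
move=> Up; have [/andP[th0 thpi] rE] := arc_angleP Up; have [s0 z0] := Up.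
have cr : {for p, continuous (fun q : heis R n => q.2 / hdot q q)}.
  apply: cvgM; first exact: continuous_zcoord.
  by apply: cvgV; [rewrite gt_eqF|exact: continuous_hdot_id].
apply/cvgrPdist_lt => e e0; set th := arc_angle p in th0 thpi rE *.
pose e' := Num.min e (Num.min (th / 2) ((2 * pi - th) / 2)).
have e'0 : 0 < e' by rewrite !lt_min e0 !divr_gt0// subr_gt0.
have : e' <= e /\ e' <= th / 2 /\ e' <= (2 * pi - th) / 2 by rewrite !ge_min !lexx !orbT.
move=> [e'e [e'1 e'2]].
have r1 : arc_ratio (th - e') < p.2 / hdot p p by rewrite -rE; apply: arc_ratio_incr; lra.
have r2 : p.2 / hdot p p < arc_ratio (th + e') by rewrite -rE; apply: arc_ratio_incr; lra.
near=> q.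
have Uq : noncentral q by near: q; exact: near_noncentral.
have [/andP[q0 qpi] qE] := arc_angleP Uq.
have q1 : arc_ratio (th - e') < q.2 / hdot q q by near: q; exact: cvgr_gt cr _ r1.
have q2 : q.2 / hdot q q < arc_ratio (th + e') by near: q; exact: cvgr_lt cr _ r2.
rewrite ltr_distlC; apply/andP; split.
  apply: (@le_lt_trans _ _ (th - e')); first by lra.
  rewrite ltNge le_eqVlt; apply/negP => /predU1P[h|h].
    by move: q1; rewrite -qE h ltxx.
  have : arc_ratio (arc_angle q) < arc_ratio (th - e') by apply: arc_ratio_incr => //; lra.
  by rewrite qE => /(lt_trans q1); rewrite ltxx.
apply: (@lt_le_trans _ _ (th + e')); last by lra.
rewrite ltNge le_eqVlt; apply/negP => /predU1P[h|h].
  by move: q2; rewrite -qE h ltxx.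
have : arc_ratio (th + e') < arc_ratio (arc_angle q) by apply: arc_ratio_incr => //; lra.
by rewrite qE => /lt_trans /(_ q2); rewrite ltxx.
Unshelve. all: by end_near. Qed.

Lemma hdot_line v p (t : R) : hdot (t *: v + p) (t *: v + p) =
  hdot p p + t * (2 * hdot p v + t * hdot v v).
Proof. by rewrite !(hdotDl, hdotDr, hdotZl, hdotZr) (hdotC v p); ring. Qed.

(* Envelope theorem: sqdist is the maximum of the functions arc_energy th,
   attained at th = arc_angle p, which depends continuously on p. *)
Lemma is_derive_sqdist p v : noncentral p -> is_derive p v (@sqdist R n)
  (2 * arc_angle p * v.2 + 2 * arc_angle p * halfcot (arc_angle p) * hdot p v).
Proof.
move=> Up; set D := (X in is_derive _ _ _ X).
(* For a fixed angle [arc_energy] is quadratic along the line, so A is its exact difference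
   quotient, and it remains convergent when the angle varies continuously with h. *)
pose A (th h : R) := 2 * th * v.2 + th * halfcot th * (2 * hdot p v + h * hdot v v).
have AE th h : arc_energy th (h *: v + p) - arc_energy th p = h * A th h.
  by rewrite /arc_energy hdot_line /A /= /GRing.scale /=; ring.
have cl : {for (0 : R), continuous (fun h : R => h *: v + p)}.
  apply: cvgD; last exact: cvg_cst.
  exact: scalel_continuous.
have nU : \forall h \near (0 : R), noncentral (h *: v + p).
  by apply: cl; rewrite scale0r add0r; exact: near_noncentral.
have [thd _] := arc_angleP Up.
have cth : {for (0 : R), continuous (fun h : R => arc_angle (h *: v + p))}.
  apply: continuous_comp => //; rewrite scale0r add0r; exact: continuous_arc_angle.
have ck : {for arc_angle p, continuous halfcot}.
  apply/differentiable_continuous/derivable1_diffP.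
  by have [] := is_derive_halfcot (cos_lt1 thd).
have cA (f : R -> R) : f 0 = arc_angle p -> {for (0 : R), continuous f} ->
    A (f h) h @[h --> (0 : R)] --> D.
  move=> f0 cf; have -> : D = A (f 0) 0 by rewrite /D /A f0 mul0r; ring.
  apply: cvgD.
    by apply: cvgM; [apply: cvgM; [exact: cvg_cst|exact: cf]|exact: cvg_cst].
  apply: cvgM; first apply: cvgM; first exact: cf.
    by apply: continuous_comp; rewrite ?f0.
  by apply: cvgD; [exact: cvg_cst|apply: cvgM; [exact: cvg_id|exact: cvg_cst]].
have lim : h^-1 * (sqdist (h *: v + p) - sqdist p) @[h --> (0 : R)^'] --> D.
  apply/cvgrPdist_lt => e e0.
  have c1 := cA (fun=> arc_angle p) erefl (@cst_continuous _ _ _ _).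
  have th0 : arc_angle (0 *: v + p) = arc_angle p by rewrite scale0r add0r.
  have c2 := cA (fun h => arc_angle (h *: v + p)) th0 cth.
  move/cvgrPdist_lt : c1 => /(_ e e0) n1; move/cvgrPdist_lt : c2 => /(_ e e0) n2.
  near=> h.
  have Uh : noncentral (h *: v + p) by near: h; exact: (@nbhs_dnbhs _ _ _ nU).
  have h1 : `|D - A (arc_angle p) h| < e.
    by near: h; exact: (@nbhs_dnbhs _ _ _ n1).
  have h2 : `|D - A (arc_angle (h *: v + p)) h| < e.
    by near: h; exact: (@nbhs_dnbhs _ _ _ n2).
  have hn0 : h != 0 by near: h; exact: nbhs_dnbhs_neq.
  (* Maximality at the moved point and maximality at p enclose the increment between the quotients
     for the old and the new angle. A negative h exchanges the two. *)
  have l1 : h * A (arc_angle p) h <= sqdist (h *: v + p) - sqdist p.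
    by rewrite -AE lerD2r; exact: arc_energy_le_sqdist.
  have l2 : sqdist (h *: v + p) - sqdist p <= h * A (arc_angle (h *: v + p)) h.
    rewrite -AE lerB//; apply: arc_energy_le_sqdist => //.
    by have [] := arc_angleP Uh.
  move: h1 h2 l1 l2; set q := _ - sqdist p; set a := A _ _; set b := A _ _.
  rewrite !ltr_distlC => /andP[a1 a2] /andP[b1 b2] l1 l2.
  have [hp|hn|h0] := ltrgtP 0 h; last by rewrite -h0 eqxx in hn0.
    have : a <= h^-1 * q <= b by rewrite ler_pdivlMl// ler_pdivrMl// l1 l2.
    by move=> /andP[x y]; apply/andP; split; lra.
  have : b <= h^-1 * q <= a by rewrite ler_ndivlMl// ler_ndivrMl// l1 l2.
  by move=> /andP[x y]; apply/andP; split; lra.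
by apply: DeriveDef; [apply/cvg_ex; exists D|exact: cvg_lim lim].
Unshelve. all: by end_near. Qed.

Definition dist_slope p v : R := arc_angle p * (v.2 + halfcot (arc_angle p) * hdot p v).

Lemma is_derive_ccdist p v : noncentral p ->
  is_derive p v (@ccdist R n) (dist_slope p v / ccdist p).
Proof.
move=> Up.
apply: (@near_eq_is_derive _ _ _ (@Num.sqrt R \o @sqdist R n)).
  by near=> q; rewrite /= ccdistE//; near: q; exact: near_noncentral.
have h := is_derive_real_comp (is_derive1_sqrt (sqdist_gt0 Up)) (is_derive_sqdist v Up).
apply: (is_derive_eq h); rewrite -ccdistE// /dist_slope.
by field; rewrite gt_eqF ?ccdist_gt0.
Unshelve. all: by end_near. Qed.

Lemma is_derive_ln_ccdist p v : noncentral p ->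
  is_derive p v (@ln R \o @ccdist R n) (dist_slope p v / ccdist p ^+ 2).
Proof.
move=> Up; have h := is_derive_real_comp (is_derive1_ln (ccdist_gt0 Up)) (is_derive_ccdist v Up).
by apply: (is_derive_eq h); field; rewrite gt_eqF ?ccdist_gt0.
Qed.

Lemma hdot_Xfield p v i : hdot v (Xfield i p) = v.1.1 0 i.
Proof.
rewrite /hdot (bigD1 i)//= big1 => [|k /negPf ki]; rewrite !mxE !eqxx/=.
  by rewrite mulr0 mulr1 !addr0.
by rewrite ki !mulr0 addr0.
Qed.

Lemma hdot_Yfield p v i : hdot v (Yfield i p) = v.1.2 0 i.
Proof.
rewrite /hdot (bigD1 i)//= big1 => [|k /negPf ki]; rewrite !mxE !eqxx/=.
  by rewrite mulr0 mulr1 add0r addr0.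
by rewrite ki !mulr0 addr0.
Qed.

Lemma hdot_hgrad (f : heis R n -> R) p v w :
  (forall i, 'D_(Xfield i p) f p = v.1.1 0 i /\ 'D_(Yfield i p) f p = v.1.2 0 i) ->
  hdot (hgrad f p) w = hdot v w.
Proof.
move=> fv; rewrite hgrad_coord; apply: eq_bigr => i _; rewrite !mxE.
by have [-> ->] := fv i.
Qed.

(** This stands for grad delta under [hdot]: its first two entries are the frame coordinates of the
    gradient, while its third is not made horizontal. *)
Definition radial_dir p : heis R n :=
  (arc_angle p / ccdist p) *: (halfcot (arc_angle p) *: p + 2^-1 *: hrot p).

Lemma hdot_hgrad_ccdist p w : noncentral p ->
  hdot (hgrad ccdist p) w = hdot (radial_dir p) w.
Proof.
move=> Up; apply: hdot_hgrad => i.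
have hX := is_derive_ccdist (Xfield i p) Up; have hY := is_derive_ccdist (Yfield i p) Up.
rewrite !derive_val /dist_slope hdot_Xfield hdot_Yfield /radial_dir /= !mxE.
by split; field; rewrite gt_eqF ?ccdist_gt0.
Qed.

(** The eikonal equation; it amounts to delta^2 = theta^2 (1/4 + halfcot^2) |w|^2, the squared
    length of the arc. *)
Lemma radial_dir_unit p : noncentral p -> hdot (radial_dir p) (radial_dir p) = 1.
Proof.
move=> Up; rewrite /radial_dir !(hdotDl, hdotDr, hdotZl, hdotZr) hdot_hrot.
rewrite (hdotC (hrot p)) hdot_hrot_id.
have [thd _] := arc_angleP Up; have [s0 _] := Up.
have c1 : 1 - cos (arc_angle p) != 0 by rewrite gt_eqF// subr_gt0 cos_lt1.
have := ccdist_sq Up; rewrite sqdistE// => E.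
have d0 : ccdist p != 0 by rewrite gt_eqF// ccdist_gt0.
transitivity (arc_angle p ^+ 2 * ((1 / 4 + halfcot (arc_angle p) ^+ 2) * hdot p p)
   / ccdist p ^+ 2); first by field.
rewrite halfcotE ?cos_lt1// E; field.
by rewrite c1 !gt_eqF//; case/andP: thd.
Qed.

Lemma hgrad_perp_sq (f : heis R n -> R) p : noncentral p ->
  hnorm (hgrad_perp f p) ^+ 2 =
  hdot (hgrad f p) (hgrad f p) - hdot (hgrad f p) (radial_dir p) ^+ 2.
Proof.
move=> Up; rewrite hnorm_sq /hgrad_perp.
have := radial_dir_unit Up.
have : forall w, hdot (hgrad ccdist p) w = hdot (radial_dir p) w.
  by move=> w; exact: hdot_hgrad_ccdist.
move: (hgrad f p) (hgrad ccdist p) (radial_dir p) => u g e ge e1.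
rewrite !(hdotBl, hdotBr, hdotZl, hdotZr) !(hdotC u g) !ge (hdotC e g) ge e1.
by rewrite (hdotC e u); ring.
Qed.

(** Bessel's inequality for the orthonormal pair formed by grad delta and its rotation. *)
Lemma hgrad_perp_ge (f : heis R n -> R) p : noncentral p ->
  hdot (hgrad f p) (hrot (radial_dir p)) ^+ 2 <= hnorm (hgrad_perp f p) ^+ 2.
Proof.
move=> Up; rewrite hgrad_perp_sq//.
move: (hgrad f p) (radial_dir p) (radial_dir_unit Up) => u e e1.
have := hdot_ge0 (u - hdot u e *: e - hdot u (hrot e) *: hrot e).
rewrite !(hdotBl, hdotBr, hdotZl, hdotZr) hdot_hrot (hdotC (hrot e) u).
rewrite (hdotC (hrot e) e) (hdotC e u) hdot_hrot_id e1.
move=> h; rewrite -subr_ge0; apply: (le_trans h).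
by rewrite le_eqVlt; apply/orP; left; apply/eqP; ring.
Qed.

(** The plane of p and J p contains grad delta. A gradient lying in this plane therefore has its
    orthogonal part along J grad delta alone, and the bound of [hgrad_perp_ge] becomes an
    equality. *)
Lemma hgrad_perp_radial (f : heis R n -> R) p (a b : R) : noncentral p ->
  (forall w, hdot (hgrad f p) w = hdot (a *: p + b *: hrot p) w) ->
  hnorm (hgrad_perp f p) ^+ 2 = (arc_angle p / ccdist p * hdot p p *
    (a / 2 - b * halfcot (arc_angle p))) ^+ 2.
Proof.
move=> Up fE; rewrite hgrad_perp_sq// !fE (hdotC _ (hgrad f p)) fE.
have u1 := radial_dir_unit Up.
set k := arc_angle p / ccdist p.
have k1 : k ^+ 2 * ((1 / 4 + halfcot (arc_angle p) ^+ 2) * hdot p p) = 1.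
  rewrite -[RHS]u1 /radial_dir -/k !(hdotDl, hdotDr, hdotZl, hdotZr) hdot_hrot.
  by rewrite (hdotC (hrot p)) hdot_hrot_id; field.
rewrite /radial_dir -/k !(hdotDl, hdotDr, hdotZl, hdotZr) hdot_hrot.
rewrite (hdotC (hrot p)) hdot_hrot_id.
set s := hdot p p in k1 *; set ka := halfcot _ in k1 *.
transitivity ((a ^+ 2 + b ^+ 2) * s * (k ^+ 2 * ((1 / 4 + ka ^+ 2) * s)) -
  (k * s * (a * ka + b / 2)) ^+ 2); last by field.
by rewrite k1; field.
Qed.

End distance_gradient.

(** * Measure and integration by parts on the Heisenberg group *)

Section measure_preserving.
Local Open Scope ereal_scope.
Context {R : realType}.

Definition measure_preserving d (T : measurableType d) (mu : set T -> \bar R)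
    (f : T -> T) :=
  measurable_fun setT f /\ forall A, measurable A -> mu (f @^-1` A) = mu A.

Section integral.
Context d (T : measurableType d) (mu : {measure set T -> \bar R}) (tau : T -> T).
Hypothesis pt : measure_preserving mu tau.

Lemma ge0_integral_measure_preserving (f : T -> \bar R) :
  measurable_fun setT f -> (forall x, 0 <= f x) ->
  \int[mu]_x f (tau x) = \int[mu]_x f x.
Proof.
move=> mf f0; have [mt tE] := pt.
rewrite -[LHS](@ge0_integral_pushforward _ _ _ _ R tau mt mu setT f)//.
apply: eq_measure_integral => A mA _; exact: tE.
Qed.

Lemma integrable_measure_preserving (f : T -> \bar R) :
  mu.-integrable setT f -> mu.-integrable setT (f \o tau).
Proof.
move=> /integrableP[mf intf]; have [mt _] := pt.
apply/integrableP; split; first exact: measurableT_comp.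
have E := @ge0_integral_measure_preserving (fun x => `|f x|).
rewrite [ltLHS]E//; exact: measurableT_comp.
Qed.

Lemma integral_measure_preserving (f : T -> \bar R) :
  mu.-integrable setT f -> \int[mu]_x f (tau x) = \int[mu]_x f x.
Proof.
move=> intf; have [mt tE] := pt.
rewrite -[LHS](@integral_pushforward _ _ _ _ R tau mt mu setT f) //.
- by apply: eq_measure_integral => A mA _; exact: tE.
- exact: measurable_int intf.
- exact: integrable_measure_preserving.
Qed.

End integral.

(** Sections of the preimage are preimages of sections, so integrating their measures reduces the
    claim to the two factors. *)
Lemma measure_preserving_prod d1 d2 (T1 : measurableType d1)
    (T2 : measurableType d2) (m1 : {measure set T1 -> \bar R})
    (m2 : {sigma_finite_measure set T2 -> \bar R}) (t1 : T1 -> T1) (t2 : T2 -> T2) :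
  measure_preserving m1 t1 -> measure_preserving m2 t2 ->
  measure_preserving (m1 \x m2) (fun p : T1 * T2 => (t1 p.1, t2 p.2)).
Proof.
move=> pt1 [mt2 t2E]; have [mt1 _] := pt1; set t := fun p => _.
have mt : measurable_fun setT t.
  apply: measurable_fun_pair.
    exact: (measurableT_comp mt1 measurable_fst).
  exact: (measurableT_comp mt2 measurable_snd).
split => // A mA.
have mx := measurable_fun_xsection m2 mA.
transitivity (\int[m1]_x (m2 \o xsection A) (t1 x)).
  apply: eq_integral => x _ /=.
  have -> : xsection (t @^-1` A) x = t2 @^-1` (xsection A (t1 x)).
    by apply/seteqP; split => y; rewrite /xsection /= !inE.
  by apply: t2E; exact: measurable_xsection.
exact: ge0_integral_measure_preserving.
Qed.

(** The pushforward agrees with Lebesgue measure on half-open intervals, which determine it. *)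
Lemma lebesgue_measure_shift (a : R) :
  measure_preserving (@lebesgue_measure R) (fun x : R => (x + a)%R).
Proof.
have mt : measurable_fun [set: measurableTypeR R] (fun x : measurableTypeR R => (x + a)%R : measurableTypeR R).
  exact: measurable_funD.
split=> // A mA.
pose m' :
  {measure set (measurableTypeR R) -> \bar R} :=
  pushforward lebesgue_measure (fun x : measurableTypeR R => (x + a)%R : measurableTypeR R).
rewrite [RHS](@lebesgue_measure_unique _ (m' mt))// => _ [[u v]] _ <-.
have -> : m' mt (`]u, v]%classic : set R) = lebesgue_measure (`](u - a)%R, (v - a)%R]%classic : set R).
  congr (lebesgue_measure _); apply/seteqP.
  by split => x /=; rewrite !in_itv/= ltrBlDr lerBrDr.
rewrite !lebesgue_measure_itv/= !lte_fin ltrD2r.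
by case: ifPn => // _; rewrite -!EFinB; congr EFin; ring.
Qed.

Lemma lebesgue_rV_shift n (a : 'rV[R]_n) :
  measure_preserving (lebesgue_rV R n) (fun x => (x + a)%R).
Proof.
have mshift m (b : 'rV[R]_m) : measurable_fun [set: 'rV[R]_m] (fun x => (x + b)%R).
  apply: measurable_fun_rVP => i; under eq_fun do rewrite mxE.
  by apply: measurable_funD => //; exact: measurable_coord.
elim: n a => [|n ih] a; (split; first exact: mshift).
  have -> : (fun x : 'rV[R]_0 => x + a)%R = id; last by [].
  by apply/funext => x; apply/rowP => -[].
move=> A mA.
pose a' : 'rV[R]_n := (\row_i a ord0 (lift ord0 i))%R.
pose t (p : measurableTypeR R * 'rV[R]_n) := ((p.1 + a ord0 ord0)%R, (p.2 + a')%R).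
have E p : (cons_rV p + a)%R = cons_rV (t p).
  by apply/rowP => i; rewrite !mxE; case: unliftP => [j ->|->] /=; rewrite ?mxE.
have [_ pE] := measure_preserving_prod (lebesgue_measure_shift (a ord0 ord0)) (ih a').
have mcA : measurable (@cons_rV R n @^-1` A).
  by rewrite -[_ @^-1` _]setTI; exact: measurable_cons_rV.
have := pE _ mcA.
have <- : @cons_rV R n @^-1` ((fun x => x + a)%R @^-1` A) = t @^-1` (@cons_rV R n @^-1` A).
  by apply/seteqP; split => p /=; rewrite E.
by [].
Qed.

Lemma heis_measure_shift n (v : heis R n) :
  measure_preserving (@heis_measure R n) (fun p => (p + v)%R).
Proof.
have h := measure_preserving_prod (lebesgue_rV_shift v.1.1) (lebesgue_rV_shift v.1.2).
exact: (measure_preserving_prod h (lebesgue_measure_shift v.2)).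
Qed.

End measure_preserving.

(** * Measurability of open sets and of continuous functions *)

Section heisenberg_measurability.
Context {R : realType} {n : nat}.
Implicit Types p : heis R n.

Lemma measurable_xcoord (i : 'I_n) : measurable_fun setT (fun p => p.1.1 0 i).
Proof.
have h := measurableT_comp (@measurable_fst _ _ 'rV[R]_n 'rV[R]_n) (@measurable_fst _ _ ('rV[R]_n * 'rV[R]_n)%type R).
exact: (measurableT_comp (measurable_coord i) h).
Qed.

Lemma measurable_ycoord (i : 'I_n) : measurable_fun setT (fun p => p.1.2 0 i).
Proof.
have h := measurableT_comp (@measurable_snd _ _ 'rV[R]_n 'rV[R]_n) (@measurable_fst _ _ ('rV[R]_n * 'rV[R]_n)%type R).
exact: (measurableT_comp (measurable_coord i) h).
Qed.

Lemma measurable_zcoord : measurable_fun setT (fun p => p.2 : R).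
Proof. exact: measurable_snd. Qed.

Lemma heis_norm_lt p (e : R) : 0 < e ->
  (forall i, `|p.1.1 0 i| < e /\ `|p.1.2 0 i| < e) -> `|p.2| < e -> `|p| < e.
Proof.
move=> e0 pi pz.
have h (M : 'rV[R]_n) : (forall i, `|M 0 i| < e) -> `|M| < e.
  move=> Me; have -> : `|M| = mx_norm M by [].
  rewrite mx_normrE; apply: bigmax_lt => // -[i j] _ /=.
  by rewrite ord1.
rewrite !prod_normE/= !gt_max pz andbT; apply/andP; split.
  by apply: h => i; have [] := pi i.
by apply: h => i; have [] := pi i.
Qed.

(** The sigma-algebra is a product one, whereas open sets come from the norm. An open set is the
    union of the rational boxes that it contains, a countable family enumerated by [pickle]. *)
Lemma open_measurable_heis (A : set (heis R n)) : open A -> measurable A.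
Proof.
move=> oA.
pose Q := ('rV[rat]_n * 'rV[rat]_n * rat * nat)%type.
pose box (q : Q) : set (heis R n) := [set p : heis R n |
  (forall i, `|ratr (q.1.1.1 0 i) - p.1.1 0 i| < q.2.+1%:R^-1 /\
             `|ratr (q.1.1.2 0 i) - p.1.2 0 i| < q.2.+1%:R^-1) /\
  `|ratr q.1.2 - p.2| < q.2.+1%:R^-1].
have mabs (f : heis R n -> R) (a b : R) : measurable_fun setT f ->
    measurable [set p : heis R n | `|a - f p| < b].
  move=> mf; have mg : measurable_fun setT (fun p => `|a - f p|).
    by apply: measurableT_comp => //; exact: measurable_funB.
  have := mg measurableT _ (measurable_itv `]-oo, b[).
  by rewrite setTI (_ : _ @^-1` _ = [set p : heis R n | `|a - f p| < b])//; apply/seteqP; split => p /=; rewrite in_itv.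
have mbox q : measurable (box q).
  rewrite (_ : box q = (\bigcap_(i in [set: 'I_n])
      ([set p : heis R n | `|ratr (q.1.1.1 0 i) - p.1.1 0 i| < q.2.+1%:R^-1] `&`
       [set p : heis R n | `|ratr (q.1.1.2 0 i) - p.1.2 0 i| < q.2.+1%:R^-1])) `&`
      [set p : heis R n | `|ratr q.1.2 - p.2| < q.2.+1%:R^-1]).
    apply: measurableI; last by apply: mabs; exact: measurable_zcoord.
    apply: fin_bigcap_measurable => // i _; apply: measurableI; apply: mabs.
      exact: measurable_xcoord.
    exact: measurable_ycoord.
  apply/seteqP; split => p [h1 h2]; split => //.
    by move=> i _; have [] := h1 i.
  by move=> i; have [] := h1 i I.
have -> : A = \bigcup_(k in [set: nat]) (if unpickle k is Some q then
    (if asbool (box q `<=` A) then box q else set0) else set0).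
  apply/seteqP; split => [p Ap|p [k _]]; last first.
    by case: unpickle => // q; case: ifPn => // /asboolP; apply.
  have /nbhs_ballP[e /= e0 eA] : nbhs p A by exact: open_nbhs_nbhs.
  have [k ke] : exists k : nat, 2 * k.+1%:R^-1 < e.
    exists (Num.bound (2 / e)).
    have b : 2 / e < (Num.bound (2 / e)).+1%:R.
      have := @archi_boundP R (2 / e); rewrite divr_ge0 ?ltW// => /(_ isT) h.
      by rewrite (lt_trans h)// ltr_nat.
    by rewrite ltr_pdivrMr// mulrC -ltr_pdivrMr// in b *; rewrite ltr_pdivrMl ?ltr0n// mulrC -ltr_pdivrMr.
  have k0 : 0 < k.+1%:R^-1 :> R by rewrite invr_gt0.
  have rq (x : R) : exists q : rat, `|ratr q - x| < k.+1%:R^-1.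
    have [q] : exists q : rat, ratr q \in `]x - k.+1%:R^-1, x + k.+1%:R^-1[.
      by apply: rat_in_itvoo; rewrite ltrBlDr -addrA ltrDl addr_gt0.
    by rewrite in_itv/= -ltr_distlC distrC => ?; exists q.
  pose r (x : R) := projT1 (cid (rq x)).
  have rP x : `|ratr (r x) - x| < k.+1%:R^-1 by rewrite /r; case: cid.
  pose q : Q := (\row_i r (p.1.1 0 i), \row_i r (p.1.2 0 i), r p.2, k).
  exists (pickle q); first exact: I.
  rewrite pickleK.
  have -> : asbool (box q `<=` A) = true.
    apply/asboolP => p' [h1 h2]; apply: eA; rewrite -ball_normE /ball_/=.
    have d (a b c : R) : `|a - b| < k.+1%:R^-1 -> `|a - c| < k.+1%:R^-1 -> `|b - c| < e.
      move=> ab ac; apply: lt_trans ke; rewrite mulr_natl mulr2n.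
      rewrite -(subrKA a); apply: le_lt_trans (ler_normD _ _) _.
      by rewrite distrC; exact: ltrD.
    apply: heis_norm_lt => // [i|].
      have [x1 y1] := h1 i; rewrite !mxE in x1 y1 *.
      by split; [exact: d (rP _) x1|exact: d (rP _) y1].
    by exact: d (rP _) h2.
  by split=> [i|] /=; rewrite ?mxE.
apply: bigcup_measurable => k _; case: unpickle => // q; case: ifPn => // _.
Qed.

Lemma continuous_measurable_fun_heis (f : heis R n -> R) :
  continuous f -> measurable_fun setT f.
Proof.
move=> /continuousP cf; apply: (measurability _ (RGenOpens.measurableE R)).
move=> _ [_ [a [b ->] <-]]; rewrite setTI; apply: open_measurable_heis.
exact/cf/interval_open.
Qed.

End heisenberg_measurability.

(** * Calculus in the classes [Cn] *)

Section smooth_functions.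
Context {R : realType} {n : nat}.
Implicit Types (p q v w : heis R n) (u f g : heis R n -> R).

Lemma is_derive_line (V W : normedModType R) (f : V -> W) (p v : V) (t : R) (df : W) :
  is_derive (t *: v + p) v f df -> is_derive t 1 (fun s : R => f (s *: v + p)) df.
Proof.
have E : (fun h : R => h^-1 *: (((fun s : R => f (s *: v + p)) \o shift t) (h *: 1) -
    f (t *: v + p))) = (fun h : R => h^-1 *: ((f \o shift (t *: v + p)) (h *: v) - f (t *: v + p))).
  apply/funext => h /=; have -> : h *: (1 : R) = h by rewrite /GRing.scale/= mulr1.
  by rewrite scalerDl addrA.
by move=> [d1 d2]; apply: DeriveDef; [move: d1|move: d2]; rewrite /derivable /derive E.
Qed.

Lemma line_MVT (V : normedModType R) (f df : V -> R) (p v : V) (h : R) :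
  (forall t : R, is_derive (t *: v + p) v f (df (t *: v + p))) ->
  exists2 c : R, `|c| <= `|h| & f (h *: v + p) - f p = h * df (c *: v + p).
Proof.
move=> fdf; pose g (s : R) := f (s *: v + p).
have dg (t : R) : is_derive t 1 g (df (t *: v + p)) by exact: is_derive_line.
have cg (a b : R) : {within `[a, b], continuous g}.
  by apply: derivable_within_continuous => t _; have [] := dg t.
have g0 : f p = g 0 by rewrite /g scale0r add0r.
have [h0|h0] := leP 0 h.
- have [c] := MVT_segment h0 (fun t _ => dg t) (cg _ _).
  rewrite in_itv/= => /andP[c0 ch] E; exists c; first by rewrite !ger0_norm.
  by rewrite g0 -/(g h) E subr0 mulrC.
- have [c] := MVT_segment (ltW h0) (fun t _ => dg t) (cg _ _).
  rewrite in_itv/= => /andP[ch c0] E; exists c.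
    by rewrite !ler0_norm ?lerN2// ltW.
  by rewrite g0 -/(g h) -[LHS]opprB E sub0r mulrN opprK mulrC.
Qed.

Lemma CnS k u : Cn k.+1 u -> forall p v, is_derive p v u ('D_v u p).
Proof. by move=> [_ h] p v; have [/(_ p) /derivableP] := h v. Qed.

Lemma Cn_derive k u v : Cn k.+1 u -> Cn k ('D_v u).
Proof. by move=> [_ h]; have [] := h v. Qed.

Lemma Cn_continuous k u : Cn k u -> continuous u.
Proof. by case: k => [|k] []. Qed.

Lemma CnW k u : Cn k.+1 u -> Cn k u.
Proof.
elim: k u => [|k ih] u [cu hu]; first by split.
by split => // v; have [h1 h2] := hu v; split => //; exact: ih.
Qed.

Lemma Cn_cst k (c : R) : Cn k (cst c : heis R n -> R).
Proof.
elim: k c => [|k ih] c; first by split => // p; exact: cvg_cst.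
split; first by move=> p; exact: cvg_cst.
move=> v; split; first by move=> p; exact: derivable_cst.
have -> : 'D_v (cst c : heis R n -> R) = cst 0; last exact: ih.
by apply/funext => p; rewrite derive_cst.
Qed.

Lemma CnD k f g : Cn k f -> Cn k g -> Cn k (fun p => f p + g p).
Proof.
elim: k f g => [|k ih] f g Cf Cg; split => //;
  try by move=> p; apply: cvgD; [exact: (Cn_continuous Cf)|exact: (Cn_continuous Cg)].
move=> v; have E p : is_derive p v (fun p => f p + g p) ('D_v f p + 'D_v g p).
  exact: is_deriveD (CnS Cf p v) (CnS Cg p v).
split; first by move=> p; have [] := E p.
have -> : 'D_v (fun p => f p + g p) = (fun p => 'D_v f p + 'D_v g p).
  by apply/funext => p; have [] := E p.
by apply: ih; exact: Cn_derive.
Qed.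

Lemma CnM k f g : Cn k f -> Cn k g -> Cn k (fun p => f p * g p).
Proof.
elim: k f g => [|k ih] f g Cf Cg; split => //;
  try by move=> p; apply: cvgM; [exact: (Cn_continuous Cf)|exact: (Cn_continuous Cg)].
move=> v; have E p : is_derive p v (fun p => f p * g p) (f p * 'D_v g p + g p * 'D_v f p).
  exact: is_deriveM (CnS Cf p v) (CnS Cg p v).
split; first by move=> p; have [] := E p.
have -> : 'D_v (fun p => f p * g p) = (fun p => f p * 'D_v g p + g p * 'D_v f p).
  by apply/funext => p; have [] := E p.
by apply: CnD; apply: ih; (exact: CnW || exact: Cn_derive).
Qed.

Lemma Cn_sum k m (f : 'I_m -> heis R n -> R) :
  (forall i, Cn k (f i)) -> Cn k (fun p => \sum_i f i p).
Proof.
elim: m f => [|m ih] f Cf.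
  have -> : (fun p => \sum_(i < 0) f i p) = cst 0 by apply/funext => p; rewrite big_ord0.
  exact: Cn_cst.
have -> : (fun p => \sum_i f i p) = (fun p => f ord0 p + \sum_i f (lift ord0 i) p).
  by apply/funext => p; rewrite big_ord_recl.
by apply: CnD => //; exact: (ih (fun i => f (lift ord0 i))).
Qed.

Lemma is_derive_coord (c : heis R n -> R) p v :
  (forall k p q, c (k *: (p - q)) = k * (c p - c q)) -> (forall p q, c (p - q) = c p - c q) ->
  is_derive p v c (c v).
Proof.
move=> cl cB.
have E (h : R) : h != 0 -> h^-1 *: ((c \o shift p) (h *: v) - c p) = c v.
  move=> h0 /=; rewrite -cB addrK; have := cl h v 0; rewrite subr0 => ->.
  have -> : c 0 = 0 by rewrite -[0](subrr p) cB subrr.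
  by rewrite subr0 /GRing.scale/= mulrA mulVf// mul1r.
have lim : (fun h : R => h^-1 *: ((c \o shift p) (h *: v) - c p)) @ 0^' --> c v.
  (apply: cvg_near_cst; near=> h; apply: E; near: h; exact: nbhs_dnbhs_neq).
by apply: DeriveDef; [apply/cvg_ex; exists (c v)|exact: cvg_lim lim].
Unshelve. all: by end_near. Qed.

Let Cn_linear k (c : heis R n -> R) :
  (forall k p q, c (k *: (p - q)) = k * (c p - c q)) -> (forall p q, c (p - q) = c p - c q) ->
  continuous c -> Cn k c.
Proof.
move=> cl cB cc; case: k => [|k]; split => // v.
have E p := is_derive_coord p v cl cB.
split; first by move=> p; have [] := E p.
have -> : 'D_v c = cst (c v) by apply/funext => p; have [] := E p.
exact: Cn_cst.
Qed.

Lemma is_derive_xcoord i p v : is_derive p v (fun p : heis R n => p.1.1 0 i) (v.1.1 0 i).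
Proof. by apply: (is_derive_coord (c := fun p => p.1.1 0 i)) => *; rewrite !mxE. Qed.

Lemma is_derive_ycoord i p v : is_derive p v (fun p : heis R n => p.1.2 0 i) (v.1.2 0 i).
Proof. by apply: (is_derive_coord (c := fun p => p.1.2 0 i)) => *; rewrite !mxE. Qed.

Lemma is_derive_zcoord p v : is_derive p v (fun p : heis R n => p.2) v.2.
Proof. exact: (is_derive_coord (c := fun p => p.2)). Qed.

Lemma Cn_xcoord k i : Cn k (fun p : heis R n => p.1.1 0 i).
Proof.
apply: Cn_linear; last exact: continuous_xcoord; by move=> *; rewrite !mxE.
Qed.

Lemma Cn_ycoord k i : Cn k (fun p : heis R n => p.1.2 0 i).
Proof.
apply: Cn_linear; last exact: continuous_ycoord; by move=> *; rewrite !mxE.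
Qed.

Lemma Cn_zcoord k : Cn k (fun p : heis R n => p.2).
Proof. by apply: Cn_linear => //; exact: continuous_zcoord. Qed.

Lemma Cn_hdot_id k : Cn k (fun p : heis R n => hdot p p).
Proof.
apply: Cn_sum => i; apply: CnD; apply: CnM; (exact: Cn_xcoord || exact: Cn_ycoord).
Qed.

Lemma is_derive_hdot_id p v : is_derive p v (fun p : heis R n => hdot p p) (2 * hdot p v).
Proof.
have -> : (fun p : heis R n => hdot p p) =
    \sum_i (fun p : heis R n => p.1.1 0 i * p.1.1 0 i + p.1.2 0 i * p.1.2 0 i).
  by apply/funext => q; rewrite fct_sumE.
rewrite /hdot mulr_sumr; apply: is_derive_sum => i.
have dx := is_derive_xcoord i p v; have dy := is_derive_ycoord i p v.
apply: (is_derive_eq (is_deriveD (is_deriveM dx dx) (is_deriveM dy dy))).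
by rewrite /GRing.scale /=; ring.
Qed.

(** The induction on k replaces F by its derivative, so it runs over a class P closed under
    differentiation on D. The instances are the flat functions and the multiples of powers. *)
Lemma Cn_real_comp (D : set R) (P : set (R -> R)) k f (F : R -> R) :
  (forall G, P G -> exists2 G', P G' & forall x, D x -> is_derive x 1 G (G' x)) ->
  P F -> (forall p, D (f p)) -> Cn k f -> Cn k (F \o f).
Proof.
move=> PD PF Df; elim: k F PF => [|k ih] F PF Cf.
  split => // p; have [F' _ /(_ _ (Df p)) [/derivable1_diffP/differentiable_continuous cF _]] := PD _ PF.
  by apply: continuous_comp => //; exact: (Cn_continuous Cf).
have [F' PF' dF] := PD _ PF.
split.
  move=> p; have [/derivable1_diffP/differentiable_continuous cF _] := dF _ (Df p).
  by apply: continuous_comp => //; exact: (Cn_continuous Cf).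
move=> v; have E p : is_derive p v (F \o f) (F' (f p) * 'D_v f p).
  apply/is_derive_lineP.
  apply: (@is_derive1_comp R F (fun t : R => f (t *: v + p)) 0).
    by rewrite scale0r add0r; exact: dF.
  by apply/is_derive_lineP; exact: (CnS Cf).
split; first by move=> p; have [] := E p.
have -> : 'D_v (F \o f) = (fun p => (F' \o f) p * 'D_v f p).
  by apply/funext => p; have [] := E p.
by apply: CnM; [apply: ih => //; exact: CnW|exact: Cn_derive].
Qed.

Lemma derive_scale u v p (c : R) : (forall v, derivable u p v) ->
  'D_(c *: v) u p = c * 'D_v u p.
Proof.
move=> du; have /is_derive_lineP h := derivableP (du v).
suff : is_derive p (c *: v) u (c * 'D_v u p) by case.
apply/is_derive_lineP.
have -> : (fun t : R => u (t *: (c *: v) + p)) = (fun t : R => u (t *: v + p)) \o (fun t => t * c).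
  by apply/funext => t; rewrite /= scalerA.
rewrite mulrC; apply: is_derive1_comp; first by rewrite mul0r.
by apply: is_derive_eq; rewrite /GRing.scale/=; ring.
Qed.

(** [Cn] speaks of directional derivatives only. Additivity in the direction comes from the mean
    value theorem along v, started at the moved point p + h w, and from the continuity of
    ['D_v u]. *)
Lemma derive_add u v w p : Cn 1 u -> 'D_(v + w) u p = 'D_v u p + 'D_w u p.
Proof.
move=> Cu; have cv : continuous ('D_v u) := Cn_continuous (Cn_derive v Cu).
suff lim : h^-1 *: (u (h *: (v + w) + p) - u p) @[h --> (0 : R)^'] --> 'D_v u p + 'D_w u p.
  exact: cvg_lim lim.
have E (h : R) : h^-1 *: (u (h *: (v + w) + p) - u p) =
    h^-1 *: (u (h *: v + (h *: w + p)) - u (h *: w + p)) + h^-1 *: (u (h *: w + p) - u p).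
  have -> : h *: (v + w) + p = h *: v + (h *: w + p) by rewrite scalerDr addrA.
  rewrite -[RHS]scalerDr.
  by congr (_ *: _); rewrite subrKA.
under eq_cvg do rewrite E.
apply: cvgD; last first.
  have [dw _] := CnS Cu p w.
  by have /cvg_ex[a ha] := dw; have -> : 'D_w u p = a by exact: cvg_lim ha.
apply/cvgrPdist_lt => e e0.
have /cvgrPdist_lt/(_ e e0)/nbhs_ballP[d /= d0 hd] := cv p.
have nw : 0 < `|v| + `|w| + 1 by rewrite ltr_wpDl// addr_ge0.
near=> h.
have hn0 : h != 0 by near: h; exact: nbhs_dnbhs_neq.
have hsmall : `|h| < d / (`|v| + `|w| + 1).
  by near: h; apply: dnbhs0_lt; rewrite divr_gt0.
have [c ch ->] := @line_MVT _ u ('D_v u) (h *: w + p) v h (fun t => CnS Cu _ _).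
rewrite /GRing.scale/= mulrA mulVf// mul1r; apply: hd.
rewrite -ball_normE /ball_/= distrC addrA addrK.
apply: le_lt_trans (ler_normD _ _) _; rewrite !normrZ.
apply: (@le_lt_trans _ _ (`|h| * (`|v| + `|w|))).
  by rewrite mulrDr; apply: lerD => //; apply: ler_wpM2r.
move: hsmall; rewrite ltr_pdivlMr// => hs; apply: le_lt_trans hs.
by apply: ler_wpM2l; [exact: normr_ge0|rewrite lerDl ler01].
Unshelve. all: by end_near. Qed.

(** Two applications of the mean value theorem, in either order, express the same second difference
    by each mixed derivative at a nearby point; continuity carries the equality to p. *)
Lemma derive_comm u v w p : Cn 2 u -> 'D_v ('D_w u) p = 'D_w ('D_v u) p.
Proof.
move=> Cu.
have key v' w' (h : R) : exists2 ab : R * R, `|ab.1| <= `|h| /\ `|ab.2| <= `|h| &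
   u (h *: v' + (h *: w' + p)) - u (h *: v' + p) - (u (h *: w' + p) - u p) =
   h * (h * 'D_w' ('D_v' u) (ab.2 *: w' + (ab.1 *: v' + p))).
  pose g q := u (h *: w' + q) - u q.
  have dg q : is_derive q v' g ('D_v' u (h *: w' + q) - 'D_v' u q).
    apply: is_deriveB; last exact: (CnS Cu).
    apply/is_derive_lineP; have /is_derive_lineP := CnS (CnW Cu) (h *: w' + q) v'.
    by under eq_fun do rewrite addrCA.
  have [a ah ga] := @line_MVT _ g (fun q => 'D_v' u (h *: w' + q) - 'D_v' u q) p v' h (fun t => dg _).
  have [b bh gb] := @line_MVT _ ('D_v' u) ('D_w' ('D_v' u)) (a *: v' + p) w' h (fun t => CnS (Cn_derive v' Cu) _ _).
  by exists (a, b) => //=; rewrite -gb -ga /g (addrCA (h *: v') (h *: w')).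
have c1 := Cn_continuous (Cn_derive w (Cn_derive v Cu)) (x := p).
have c2 := Cn_continuous (Cn_derive v (Cn_derive w Cu)) (x := p).
apply/eqP; rewrite -subr_eq0 -normr_le0; apply/ler_addgt0Pr => e e0; rewrite add0r.
have e20 : 0 < e / 2 by rewrite divr_gt0.
move/cvgrPdist_lt : c1 => /(_ _ e20)/nbhs_ballP[d1 /= d10 h1].
move/cvgrPdist_lt : c2 => /(_ _ e20)/nbhs_ballP[d2 /= d20 h2].
have nw : 0 < `|v| + `|w| + 1 by rewrite ltr_wpDl// addr_ge0.
pose h := Num.min d1 d2 / (2 * (`|v| + `|w| + 1)).
have d0 : 0 < Num.min d1 d2 by rewrite lt_min d10.
have h0 : 0 < h by rewrite divr_gt0// mulr_gt0.
have small (a b : R) v' w' : `|v'| + `|w'| = `|v| + `|w| -> `|a| <= `|h| -> `|b| <= `|h| ->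
    `|p - (b *: w' + (a *: v' + p))| < Num.min d1 d2.
  move=> vw ah bh; rewrite distrC addrA addrK.
  apply: le_lt_trans (ler_normD _ _) _; rewrite !normrZ.
  apply: (@le_lt_trans _ _ (`|h| * (`|v| + `|w|))).
    by rewrite -vw mulrDr addrC; apply: lerD => //; apply: ler_wpM2r.
  rewrite ger0_norm ?ltW// /h mulrAC ltr_pdivrMr ?mulr_gt0// ltr_pM2l//.
  by lra.
have [[a1 b1] /= [a1h b1h] E1] := key v w h.
have [[a2 b2] /= [a2h b2h] E2] := key w v h.
have := h1 (b1 *: w + (a1 *: v + p)); rewrite -ball_normE /ball_/= => /(_ _)/=.
have := small a1 b1 v w erefl a1h b1h; rewrite lt_min => /andP[s1 _] /(_ s1) k1.
have := h2 (b2 *: v + (a2 *: w + p)); rewrite -ball_normE /ball_/= => /(_ _)/=.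
have := small a2 b2 w v (addrC _ _) a2h b2h; rewrite lt_min => /andP[_ s2] /(_ s2) k2.
have hn0 : h != 0 by rewrite gt_eqF.
move: k1 k2 E1 E2; set B := 'D_w ('D_v u) (_ + _); set A := 'D_v ('D_w u) (_ + _).
move: B A ('D_v ('D_w u) p) ('D_w ('D_v u) p) => B A X Y k1 k2 E1 E2.
have E : B = A.
  have : h * (h * B) = h * (h * A).
    rewrite -E1 -E2 (addrCA (h *: w) (h *: v)).
    by move: (u _) (u _) (u _) (u _) => a b c d; ring.
  by move/(mulfI hn0)/(mulfI hn0).
rewrite E in k1.
have := ler_distD A X Y; rewrite (distrC A Y); move: k1 k2; clear; lra.
Qed.

End smooth_functions.

Lemma integrable_bounded_support d (T : measurableType d) (R : realType)
    (mu : {measure set T -> \bar R}) (B : set T) (f : T -> R) (M : R) :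
  measurable B -> (mu B < +oo)%E -> measurable_fun setT f ->
  (forall x, B x -> `|f x| <= M) -> (forall x, ~ B x -> f x = 0) ->
  mu.-integrable setT (EFin \o f).
Proof.
move=> mB Boo mf fM f0; apply/integrableP; split; first exact/measurable_EFinP.
apply: (@le_lt_trans _ _ (\int[mu]_(x in B) (Num.max M 0)%:E)%E); last first.
  rewrite integral_cst// lte_mul_pinfty//.
  by rewrite lee_fin le_max lexx orbT.
rewrite [leRHS]integral_mkcond; apply: ge0_le_integral_nonmeasurable => x _.
  exact: abse_ge0.
rewrite patchE; case: ifPn => [/set_mem Bx|/negP nB].
  by rewrite lee_fin le_max fM.
by rewrite /= f0 ?normr0// => Bx; apply: nB; rewrite mem_set.
Qed.

Section integration_by_parts.
Context {R : realType} {n : nat}.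
Notation mu := (@heis_measure R n).
Implicit Types (p q v w : heis R n) (f h : heis R n -> R).

Lemma heis_box_measure (a b c d r s : R) : a <= b -> c <= d -> r <= s ->
  mu [set p : heis R n | (forall i, p.1.1 0 i \in `[a, b]) /\
    (forall i, p.1.2 0 i \in `[c, d]) /\ p.2 \in `[r, s]] =
  ((b - a) ^+ n * (d - c) ^+ n * (s - r))%:E.
Proof.
move=> ab cd rs.
pose X := [set x : 'rV[R]_n | forall i, x 0 i \in `[a, b]].
pose Y := [set x : 'rV[R]_n | forall i, x 0 i \in `[c, d]].
have mX (u v : R) : measurable [set x : 'rV[R]_n | forall i, x 0 i \in `[u, v]].
  rewrite (_ : [set x | _] = \bigcap_(i in [set: 'I_n]) ((fun x : 'rV[R]_n => x 0 i) @^-1` `[u, v])).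
    apply: fin_bigcap_measurable => // i _.
    by rewrite -[_ @^-1` _]setTI; apply: measurable_coord => //; exact: measurable_itv.
  by apply/seteqP; split => x /= h i; [move=> _|]; exact: h.
have lX (u v : R) : u <= v -> lebesgue_rV R n [set x : 'rV[R]_n | forall i, x 0 i \in `[u, v]] = ((v - u) ^+ n)%:E.
  move=> uv; rewrite (lebesgue_rV_box (A := fun=> `[u, v]%classic)); last first.
    by move=> i; exact: measurable_itv.
  rewrite (eq_bigr (fun=> (v - u)%:E)); last first.
    move=> i _; rewrite lebesgue_measure_itv/= lte_fin.
    by case: ltP => // vu; rewrite (@le_anti _ _ u v) ?subrr// uv vu.
  by rewrite prodEFin prodr_const card_ord.
rewrite (_ : [set p | _] = (X `*` Y) `*` `[r, s]); last first.
  by apply/seteqP; split => p /=; [move=> [? [? ?]]|move=> [[? ?] ?]].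
have mXY : measurable (X `*` Y) by apply: measurableX; exact: mX.
transitivity ((lebesgue_rV R n \x lebesgue_rV R n) (X `*` Y) * lebesgue_measure (`[r, s]%classic : set R))%E.
  by apply: product_measure1E => //; exact: measurable_itv.
have -> : lebesgue_measure (`[r, s]%classic : set R) = (s - r)%:E.
  rewrite lebesgue_measure_itv/= lte_fin.
  by case: ltP => // sr; rewrite (@le_anti _ _ r s) ?subrr// rs sr.
have -> : ((lebesgue_rV R n \x lebesgue_rV R n) (X `*` Y) = lebesgue_rV R n X * lebesgue_rV R n Y)%E.
  by apply: product_measure1E; exact: mX.
by rewrite !lX.
Qed.

Lemma measurable_norm_le (r : R) : measurable [set p : heis R n | `|p| <= r].
Proof.
rewrite -[X in measurable X]setCK; apply: measurableC; apply: open_measurable_heis.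
rewrite openC; apply: (@closed_comp _ _ (fun p : heis R n => `|p|) [set x : R | x <= r]).
  by move=> p _; exact: norm_continuous.
exact: closed_le.
Qed.

Lemma norm_le_measure (r : R) : (mu [set p : heis R n | (`|p| <= r)%R] < +oo)%E.
Proof.
have [r0|r0] := leP 0 r; last first.
  rewrite (_ : [set p | _] = set0) ?measure0//.
  by apply/seteqP; split => p //= pr; have := le_lt_trans pr r0; rewrite ltNge normr_ge0.
pose B := [set p : heis R n | (forall i, p.1.1 0 i \in `[- r, r]) /\
    (forall i, p.1.2 0 i \in `[- r, r]) /\ p.2 \in `[- r, r]].
have rr : - r <= r by rewrite (le_trans _ r0)// oppr_le0.
have mB : measurable B.
  have mi (f : heis R n -> R) : measurable_fun setT f -> measurable [set p | f p \in `[- r, r]].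
    by move=> mf; rewrite -[X in measurable X]setTI; exact: (mf measurableT _ (measurable_itv `[- r, r])).
  rewrite (_ : B = (\bigcap_(i in [set: 'I_n]) [set p : heis R n | p.1.1 0 i \in `[- r, r]]) `&`
    ((\bigcap_(i in [set: 'I_n]) [set p : heis R n | p.1.2 0 i \in `[- r, r]]) `&`
    [set p : heis R n | p.2 \in `[- r, r]])).
    apply: measurableI; last apply: measurableI.
    - by apply: fin_bigcap_measurable => // i _; apply: mi; exact: measurable_xcoord.
    - by apply: fin_bigcap_measurable => // i _; apply: mi; exact: measurable_ycoord.
    - by apply: mi; exact: measurable_zcoord.
  apply/seteqP; split => p [h1 [h2 h3]]; split => //.
  - by move=> i _; exact: h1.
  - by split => // i _; exact: h2.
  - by move=> i; exact: h1.
  - by split => // i; exact: h2.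
apply: (@le_lt_trans _ _ (mu B)); last by rewrite heis_box_measure ?ltry.
apply: le_measure; rewrite ?inE//; first exact: measurable_norm_le.
move=> p /= pr; rewrite /B /=.
have nz : `|p.2| <= r by apply: le_trans pr; rewrite prod_normE/= le_max lexx orbT.
split; last split.
- by move=> i; have [h _ _] := ler_norm_coord p i; rewrite in_itv/= -ler_norml (le_trans h).
- by move=> i; have [_ h _] := ler_norm_coord p i; rewrite in_itv/= -ler_norml (le_trans h).
- by rewrite in_itv/= -ler_norml.
Qed.

Lemma open_continuous_measurable_fun_heis (A : set (heis R n)) f : open A ->
  (forall p, A p -> {for p, continuous f}) -> measurable_fun A f.
Proof.
move=> oA cf; apply: (measurability _ (RGenOpens.measurableE R)).
move=> _ [_ [a [b ->] <-]]; apply: open_measurable_heis.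
rewrite openE => p /= [Ap fp]; rewrite /interior; near=> q; split.
  by near: q; exact: open_nbhs_nbhs.
near: q; apply: (cf _ Ap); by apply: open_nbhs_nbhs; split => //; exact: interval_open.
Unshelve. all: by end_near. Qed.

(** The difference quotients along v have integral 0 by translation invariance. The mean value
    theorem bounds them by M, and dominated convergence passes to the limit. Continuity of f across
    lines is not assumed, which suits the cut-off functions. *)
Lemma integral_derive0 f (df : heis R n -> R) v (M r : R) :
  measurable_fun setT f -> (forall p, is_derive p v f (df p)) ->
  (forall p, `|f p| <= M) -> (forall p, `|df p| <= M) ->
  (forall p, r < `|p| -> f p = 0) ->
  mu.-integrable setT (EFin \o df) /\ (\int[mu]_p (df p)%:E = 0)%E.
Proof.
move=> mf fdf fM dfM f0.
(* The shifts used are at most v, so this ball holds the supports of all the quotients. *)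
pose B := [set p : heis R n | `|p| <= r + `|v| ].
have mB : measurable B := measurable_norm_le _.
have Boo : (mu B < +oo)%E := norm_le_measure _.
have M0 : 0 <= M := le_trans (normr_ge0 _) (fM 0).
have fB p : ~ B p -> f p = 0.
  move=> /negP; rewrite -ltNge => h; apply: f0; apply: le_lt_trans h.
  by rewrite lerDl.
have intf : mu.-integrable setT (EFin \o f).
  exact: (@integrable_bounded_support _ _ R mu B f M mB Boo mf (fun x _ => fM x) fB).
pose c (k : nat) : R := k.+1%:R^-1.
have c0 k : 0 < c k by rewrite invr_gt0.
have c1 k : c k <= 1 by rewrite invf_le1// ler1n.
pose sh k := fun p : heis R n => p + c k *: v.
have psh k : measure_preserving mu (sh k) by exact: heis_measure_shift.
pose F k p := (c k)^-1 * (f (sh k p) - f p).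
have mF k : measurable_fun setT (F k).
  apply: measurable_funM => //; apply: measurable_funB => //.
  by apply: (measurableT_comp mf); have [] := psh k.
have FM k p : `|F k p| <= M.
  have [t _ E] := @line_MVT _ _ f df p v (c k) (fun t => fdf _).
  by rewrite /F /sh (addrC p) E mulrA mulVf ?gt_eqF// mul1r dfM.
have FB k p : ~ B p -> F k p = 0.
  move=> nB; rewrite /F (fB p nB) f0 ?subrr ?mulr0//.
  move/negP : nB; rewrite -ltNge -ltrBrDr => h; apply: lt_le_trans h _.
  rewrite lerBlDr; apply: le_trans (_ : `|sh k p| + `|c k *: v| <= _).
    by rewrite -[in leLHS](addrK (c k *: v) p) (le_trans (ler_normB _ _)).
  by rewrite lerD2l normrZ gtr0_norm// ler_piMl.
have intF0 k : (\int[mu]_p (F k p)%:E = 0)%E.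
  have ish := integrable_measure_preserving (psh k) intf.
  transitivity ((c k)^-1%:E * \int[mu]_p (((EFin \o f) \o sh k) p - (EFin \o f) p))%E.
    rewrite -integralZl//; exact: (integrableB measurableT ish intf).
  rewrite integralB// (integral_measure_preserving (psh k) intf) subee ?mule0//.
  exact: integrable_fin_num.
have cv p : F k p @[k --> \oo] --> df p.
  have [dp dE] := fdf p; have /cvg_ex[a ha] := dp.
  have -> : df p = a by rewrite -dE; exact: cvg_lim ha.
  move/cvgr_dnbhsP : ha => /(_ c)/=.
  have -> : (fun k => F k p) = (fun k => (c k)^-1 *: (f (c k *: v + p) - f p)).
    by apply/funext => k; rewrite /F /sh (addrC p).
  by apply; split; [move=> k; rewrite gt_eqF|exact: cvg_harmonic].
have mdf : measurable_fun setT df by apply: (measurable_fun_cvg mF) => p _; exact: cv.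
have ig : mu.-integrable setT (EFin \o (M \*o \1_B)).
  apply: (@integrable_bounded_support _ _ R mu B _ M mB Boo).
  - by apply: measurable_funM => //; exact: measurable_indic.
  - by move=> x Bx; rewrite /= indicE mem_set// mulr1 ger0_norm.
  - by move=> x Bx; rewrite /= indicE memNset// mulr0.
have dom : {ae mu, forall p k, setT p -> (`|(EFin \o F k) p| <= (EFin \o (M \*o \1_B)) p)%E}.
  apply: aeW => p k _; rewrite /= lee_fin indicE.
  have [Bp|nB] := pselect (B p); first by rewrite mem_set// mulr1 FM.
  by rewrite FB// normr0 mulr_ge0.
have cvE : {ae mu, forall p, setT p -> (fun k => (EFin \o F k) p) @ \oo --> (EFin \o df) p}.
  by apply: aeW => p _; apply: cvg_EFin; [exact: nearW|exact: cv].
have mFE k : measurable_fun setT (EFin \o F k) by exact/measurable_EFinP.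
have mdfE : measurable_fun setT (EFin \o df) by exact/measurable_EFinP.
have [i1 _ i3] := @dominated_convergence _ _ R mu setT measurableT
  (fun k => EFin \o F k) (EFin \o df) (EFin \o (M \*o \1_B)) mFE mdfE cvE ig dom.
split => //; apply: (cvg_unique _ i3).
  exact: ereal_hausdorff.
rewrite (_ : (fun k => _) = cst 0%E); first exact: cvg_cst.
by apply/funext => k; rewrite /= intF0.
Qed.

Let measurable_coord0 (i : 'I_n) : measurable [set x : 'rV[R]_n | x 0 i = 0].
Proof.
rewrite (_ : [set x | _] = (fun x : 'rV[R]_n => x 0 i) @^-1` [set 0])//.
by rewrite -[_ @^-1` _]setTI; apply: measurable_coord => //; exact: measurable_set1.
Qed.

Let lebesgue_rV_coord0 (i : 'I_n) :
  lebesgue_rV R n [set x : 'rV[R]_n | x 0 i = 0] = 0%E.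
Proof.
pose A (j : 'I_n) : set R := if j == i then [set 0] else setT.
rewrite (_ : [set x | _] = [set x : 'rV[R]_n | forall j, A j (x 0 j)]).
  rewrite lebesgue_rV_box; last first.
    by move=> j; rewrite /A; case: ifPn => // _; exact: measurable_set1.
  by rewrite (bigD1 i)//= /A eqxx lebesgue_measure_set1 mul0e.
apply/seteqP; split => x /=.
  by move=> xi j; rewrite /A; case: eqP => // ->.
by move=> /(_ i); rewrite /A eqxx.
Qed.

Lemma null_xcoord (i : 'I_n) : mu [set p : heis R n | p.1.1 0%R i = 0%R] = 0%E.
Proof.
have m0 := measurable_coord0 i; set X := [set x | _] in m0.
rewrite (_ : [set p | _] = (X `*` setT) `*` setT); last first.
  by apply/seteqP; split => p /=; [move=> ?|move=> [[]]].
transitivity ((lebesgue_rV R n \x lebesgue_rV R n) (X `*` setT) * lebesgue_measure [set: R])%E.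
  by apply: product_measure1E => //; exact: measurableX.
have -> : ((lebesgue_rV R n \x lebesgue_rV R n) (X `*` setT) = lebesgue_rV R n X * lebesgue_rV R n setT)%E.
  exact: product_measure1E.
by rewrite lebesgue_rV_coord0 !mul0e.
Qed.

Lemma null_ycoord (i : 'I_n) : mu [set p : heis R n | p.1.2 0%R i = 0%R] = 0%E.
Proof.
have m0 := measurable_coord0 i; set X := [set x | _] in m0.
rewrite (_ : [set p | _] = (setT `*` X) `*` setT); last first.
  by apply/seteqP; split => p /=; [move=> ?|move=> [[]]].
transitivity ((lebesgue_rV R n \x lebesgue_rV R n) (setT `*` X) * lebesgue_measure [set: R])%E.
  by apply: product_measure1E => //; exact: measurableX.
have -> : ((lebesgue_rV R n \x lebesgue_rV R n) (setT `*` X) = lebesgue_rV R n setT * lebesgue_rV R n X)%E.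
  exact: product_measure1E.
by rewrite lebesgue_rV_coord0 mule0 mul0e.
Qed.

Lemma measurable_xcoord0 (i : 'I_n) : measurable [set p : heis R n | p.1.1 0 i = 0].
Proof.
rewrite -[X in measurable X]setTI; exact: (measurable_xcoord i measurableT (measurable_set1 _)).
Qed.

Lemma measurable_ycoord0 (i : 'I_n) : measurable [set p : heis R n | p.1.2 0 i = 0].
Proof.
rewrite -[X in measurable X]setTI; exact: (measurable_ycoord i measurableT (measurable_set1 _)).
Qed.

End integration_by_parts.

(** * The lower bound *)

Section compact_support.
Context {R : realType} {n : nat}.
Implicit Types (p q v w : heis R n) (f : heis R n -> R) (K : set (heis R n)).

Definition supported K f := forall p, ~ K p -> f p = 0.

Lemma supported_derive K f v : closed K -> supported K f -> supported K ('D_v f).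
Proof.
move=> cK f0 p Kp.
rewrite (@near_eq_derive _ _ _ f (cst 0)) ?derive_cst//.
have oK : open (~` K) by rewrite openC.
have : nbhs p (~` K) by apply: open_nbhs_nbhs.
by apply: filterS => q; exact: f0.
Qed.

Lemma supported_bounded K f : compact K -> continuous f -> supported K f ->
  exists2 M : R, 0 < M & forall p, `|f p| <= M.
Proof.
move=> cK cf f0.
have [[p0 Kp0]|K0] := pselect (K !=set0); last first.
  by exists 1 => // p; rewrite f0 ?normr0// => Kp; apply: K0; exists p.
have cn : {within K, continuous (fun p => `|f p|)}.
  by apply: continuous_subspaceT => p; apply: continuous_comp; [exact: cf|exact: norm_continuous].
have [c _ hc] := compact_EVT_max (ex_intro _ p0 Kp0) cK cn.
exists (`|f c| + 1) => [|p]; first by rewrite ltr_wpDl.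
have [Kp|Kp] := pselect (K p); last by rewrite f0// normr0 addr_ge0.
by rewrite (le_trans (hc _ (mem_set Kp)))// lerDl.
Qed.

Lemma compact_upper_bounds K : compact K -> K `<=` [set p | 0 < p.2] ->
  exists z0 r : R, [/\ 0 < z0, 0 < r & forall p, K p -> z0 <= p.2 /\ `|p| <= r].
Proof.
move=> cK K0.
have [[p0 Kp0]|Ke] := pselect (K !=set0); last first.
  by exists 1, 1; split => // p Kp; exfalso; apply: Ke; exists p.
have cz : {within K, continuous (fun p : heis R n => p.2)}.
  by apply: continuous_subspaceT; exact: continuous_zcoord.
have cn : {within K, continuous (fun p : heis R n => `|p|)}.
  by apply: continuous_subspaceT; exact: norm_continuous.
have [c Kc hc] := compact_EVT_min (ex_intro _ p0 Kp0) cK cz.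
have [d _ hd] := compact_EVT_max (ex_intro _ p0 Kp0) cK cn.
exists c.2, (`|d| + 1); split; [exact: K0 (set_mem Kc)|by rewrite ltr_wpDl|].
move=> p Kp; split; first exact: hc (mem_set Kp).
by rewrite (le_trans (hd _ (mem_set Kp)))// lerDl.
Qed.

Lemma hdot_le_norm p : hdot p p <= n%:R * (2 * `|p| ^+ 2).
Proof.
rewrite /hdot; apply: (@le_trans _ _ (\sum_(i < n) 2 * `|p| ^+ 2)); last first.
  by rewrite sumr_const card_ord -[leLHS]mulr_natl lexx.
apply: ler_sum => i _; have [h1 h2 _] := ler_norm_coord p i.
rewrite mulr_natl mulr2n; apply: lerD.
  by rewrite -expr2 -real_normK ?num_real// lerXn2r ?nnegrE.
by rewrite -expr2 -real_normK ?num_real// lerXn2r ?nnegrE.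
Qed.

Lemma continuous_sqdist p : noncentral p -> {for p, continuous (@sqdist R n)}.
Proof.
move=> Up; have [thd _] := arc_angleP Up.
have cth := continuous_arc_angle Up.
have ck : {for arc_angle p, continuous halfcot}.
  apply/differentiable_continuous/derivable1_diffP.
  by have [] := is_derive_halfcot (cos_lt1 thd).
apply: cvgD; apply: cvgM.
- by apply: cvgM; [exact: cvg_cst|exact: cth].
- exact: continuous_zcoord.
- by apply: cvgM; [exact: cth|apply: continuous_comp].
- exact: continuous_hdot_id.
Qed.

Lemma continuous_ccdist p : noncentral p -> {for p, continuous (@ccdist R n)}.
Proof.
move=> Up.
have h : (Num.sqrt \o @sqdist R n) q @[q --> p] --> Num.sqrt (sqdist p).
  apply: (@continuous_comp _ _ _ (@sqdist R n) (@Num.sqrt R) p).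
    exact: continuous_sqdist.
  exact: sqrt_continuous.
rewrite -ccdistE// in h; apply: cvg_trans h; apply: near_eq_cvg; near=> q.
by rewrite /= -ccdistE//; near: q; exact: near_noncentral.
Unshelve. all: by end_near. Qed.

Lemma open_noncentral : open (@noncentral R n).
Proof. by rewrite openE => p Up; exact: near_noncentral. Qed.

(** Towards the centre the angle tends to 2 pi and [halfcot] is unbounded. Cauchy-Schwarz still
    controls the cotangent term by delta |v|, since theta^2 halfcot^2 |w|^2 <= delta^2; the bound by
    1 + |v|^2 avoids a root. *)
Lemma dist_slope_le p v : noncentral p ->
  `|dist_slope p v| <= 2 * pi * `|v.2| + ccdist p * (1 + hdot v v).
Proof.
move=> Up; have [/andP[th0 thpi] _] := arc_angleP Up; have [s0 _] := Up.
have thd : 0 < arc_angle p < 2 * pi by rewrite th0.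
rewrite /dist_slope mulrDr; apply: (le_trans (ler_normD _ _)); apply: lerD.
  by rewrite normrM ler_wpM2r// gtr0_norm// ltW.
have d0 := ccdist_gt0 Up.
have h0 := hdot_ge0 v.
have R0 : 0 <= ccdist p * (1 + hdot v v) by rewrite mulr_ge0 ?ltW// ltr_wpDr.
have E := ccdist_sq Up; rewrite sqdistE// in E.
have CS := hdot_CS p v.
have e : hdot p p / (2 * (1 - cos (arc_angle p))) =
    (1 / 4 + halfcot (arc_angle p) ^+ 2) * hdot p p.
  by rewrite halfcotE ?cos_lt1// mul1r mulrC.
rewrite e in E; move: (arc_angle p) (halfcot (arc_angle p)) (hdot p v) (hdot p p) (hdot v v) (ccdist p) s0 h0 th0 d0 R0 E CS.
clear => th ka D s h d s0 h0 th0 d0 R0 E CS.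
rewrite -(ger0_norm R0) -ler_sqr ?nnegrE// !real_normK ?num_real// !exprMn E.
rewrite -[leRHS]mulrA ler_pM2l ?exprn_gt0//.
apply: (@le_trans _ _ (ka ^+ 2 * (s * h))); first by rewrite ler_wpM2l ?sqr_ge0.
have h1 : s * h <= s * (1 + h) ^+ 2.
  rewrite ler_pM2l//; have := sqr_ge0 h; rewrite expr2; move: h0; clear; rewrite expr2; lra.
have h2 : 0 <= 1 / 4 * (s * (1 + h) ^+ 2).
  by apply: mulr_ge0; [lra|apply: mulr_ge0; [exact: ltW|exact: sqr_ge0]].
have h3 : ka ^+ 2 * (s * h) <= ka ^+ 2 * (s * (1 + h) ^+ 2) by rewrite ler_wpM2l ?sqr_ge0.
by rewrite -mulrA mulrDl; move: h2 h3; clear; lra.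
Qed.

Lemma normr_ln_le (x : R) : 0 < x -> `|ln x| <= x + x^-1.
Proof.
move=> x0; have xV : 0 < x^-1 by rewrite invr_gt0.
have h1 := ln_sublinear x0; have := ln_sublinear xV; rewrite lnV ?posrE// => h2.
by rewrite ler_norml; apply/andP; split; lra.
Qed.

End compact_support.

(** * Null Lagrangians in f and ln delta *)

Section weak_commutation.
Context {R : realType} {n : nat}.
Notation mu := (@heis_measure R n).
Implicit Types (p q v w : heis R n).
Variables (K : set (heis R n)) (f : heis R n -> R).
Hypotheses (cK : compact K) (K0 : K `<=` [set p | 0 < p.2]).
Hypotheses (Cf : Cn 2 f) (f0 : supported K f).

(* The derivative along w of ln(ccdist) times that of f along v, cut off on
   the null set {c = 0}. *)
Definition cut_derive (c : heis R n -> R) v w p : R :=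
  if c p == 0 then 0
  else ln (ccdist p) * 'D_w ('D_v f) p + 'D_v f p * (dist_slope p w / ccdist p ^+ 2).

(** As c is constant along w, a line in this direction either lies in {c = 0}, where the cut
    function vanishes, or avoids the centre. So ln delta times ['D_v f], once cut off, is
    differentiable along w everywhere, even where it jumps across {c = 0}. *)
Lemma integral_cut_derive (c : heis R n -> R) v w :
  continuous c -> (forall p (t : R), c (t *: w + p) = c p) ->
  (forall p, c p != 0 -> 0 < hdot p p) ->
  mu.-integrable setT (EFin \o cut_derive c v w) /\
  (\int[mu]_p (cut_derive c v w p)%:E = 0)%E.
Proof.
move=> cc cw c0.
have clK : closed K by apply: compact_closed => //; exact: norm_hausdorff.
have fv0 := supported_derive v clK f0.
have fvw0 := supported_derive w clK fv0.
have Cfv := Cn_derive v Cf.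
have cfv := Cn_continuous Cfv; have cfvw := Cn_continuous (Cn_derive w Cfv).
have [M1 M10 hM1] := supported_bounded cK cfv fv0.
have [M2 M20 hM2] := supported_bounded cK cfvw fvw0.
have [z0 [r [z00 r0 zr]]] := compact_upper_bounds cK K0.
have KU p : K p -> c p != 0 -> noncentral p by move=> /K0 Kp /c0.
(* Bounds for delta on K, from [sqdist_ge] and [sqdist_le]; they make ln delta and its slope bounded
   up to the centre. *)
pose dl : R := Num.sqrt (2 * pi * z0).
have dl0 : 0 < dl by rewrite sqrtr_gt0 !mulr_gt0// pi_gt0.
pose du : R := Num.sqrt (4 * pi * r + n%:R * (2 * r ^+ 2)).
have dd p : K p -> c p != 0 -> dl <= ccdist p <= du.
  move=> Kp cp; have Up := KU _ Kp cp; have [zp rp] := zr _ Kp.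
  have [s0 zp0] := Up; rewrite ccdistE//; apply/andP; split; apply: ler_wsqrtr.
    by rewrite (le_trans _ (sqdist_ge Up))// ler_pM2l// mulr_gt0// pi_gt0.
  apply: (le_trans (sqdist_le Up)); apply: lerD.
    rewrite ler_pM2l ?mulr_gt0 ?pi_gt0//; apply: le_trans rp.
    apply: (le_trans (ler_norm _)); suff : `|p.2| <= Num.max `|p.1| `|p.2| by [].
    by rewrite le_max lexx orbT.
  apply: (le_trans (hdot_le_norm p)); rewrite ler_wpM2l// ler_pM2l//.
  by rewrite lerXn2r ?nnegrE// ltW.
pose m1 : R := 2 * pi * `|w.2| / dl ^+ 2 + (1 + hdot w w) / dl.
pose m2 : R := du + dl^-1.
have b1 p : K p -> c p != 0 -> `|dist_slope p w / ccdist p ^+ 2| <= m1.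
  move=> Kp cp; have Up := KU _ Kp cp; have /andP[l1 _] := dd _ Kp cp.
  have d0 := ccdist_gt0 Up; have h0 := hdot_ge0 w.
  rewrite normrM normfV [X in _ / X]ger0_norm ?sqr_ge0//.
  apply: (@le_trans _ _ ((2 * pi * `|w.2| + ccdist p * (1 + hdot w w)) / ccdist p ^+ 2)).
    by rewrite ler_wpM2r ?invr_ge0 ?sqr_ge0// dist_slope_le.
  have -> : (2 * pi * `|w.2| + ccdist p * (1 + hdot w w)) / ccdist p ^+ 2 =
    2 * pi * `|w.2| / ccdist p ^+ 2 + (1 + hdot w w) / ccdist p by field; rewrite gt_eqF.
  apply: lerD; apply: ler_wpM2l.
  - by rewrite !mulr_ge0// pi_ge0.
  - by rewrite lef_pV2 ?posrE ?exprn_gt0// lerXn2r ?nnegrE// ltW.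
  - by rewrite addr_ge0.
  - by rewrite lef_pV2 ?posrE.
have b2 p : K p -> c p != 0 -> `|ln (ccdist p)| <= m2.
  move=> Kp cp; have Up := KU _ Kp cp; have /andP[l1 l2] := dd _ Kp cp.
  apply: (le_trans (normr_ln_le (ccdist_gt0 Up))); apply: lerD => //.
  by rewrite lef_pV2 ?posrE// ccdist_gt0.
pose h p : R := if c p == 0 then 0 else ln (ccdist p) * 'D_v f p.
have m20 : 0 <= m2 by rewrite addr_ge0 ?sqrtr_ge0// invr_ge0 ltW.
have m10 : 0 <= m1.
  by rewrite addr_ge0// divr_ge0 ?(ltW dl0) ?sqr_ge0// ?mulr_ge0 ?pi_ge0// addr_ge0// hdot_ge0.
apply: (@integral_derive0 _ _ h _ w (m2 * M1 + m2 * M2 + M1 * m1) r).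
- have oA : open ((c @^-1` [set x | x != 0]) `&` @noncentral R n).
    apply: openI; last exact: open_noncentral.
    by apply: open_comp => [p _|]; [exact: cc|exact: open_neq].
  rewrite (_ : h = (fun p => ln (ccdist p) * 'D_v f p) \_ ((c @^-1` [set x | x != 0]) `&` @noncentral R n)).
    apply/(measurable_restrictT _ (open_measurable_heis oA)).
    apply: open_continuous_measurable_fun_heis => // p [cp Up].
    apply: cvgM; last exact: cfv.
    apply: continuous_comp; first exact: (continuous_ccdist Up).
    by apply: continuous_ln; exact: ccdist_gt0.
  apply/funext => p; rewrite /h patchE; case: ifPn => [/eqP cp|cp].
    by rewrite memNset// => -[/=]; rewrite cp eqxx.
  case: ifPn => // /negP nA; rewrite fv0 ?mulr0// => Kp; apply: nA.
  by rewrite mem_set//; split => //; exact: KU.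
- move=> p; rewrite /cut_derive; case: ifPn => [/eqP cp|cp].
    apply/is_derive_lineP; rewrite (_ : (fun t => _) = cst 0).
      exact: is_derive_cst.
    by apply/funext => t; rewrite /h cw cp eqxx.
  have ncp : \forall q \near p, c q != 0.
    apply: (cc p [set x | x != 0]); apply: open_nbhs_nbhs; split => //; exact: open_neq.
  have [Kp|nK] := pselect (K p).
    have Up := KU _ Kp cp.
    apply: (@near_eq_is_derive _ _ _ ((@ln R \o @ccdist R n) * 'D_v f)).
      by near=> q; rewrite /h ifN//; near: q.
    apply: (is_derive_eq (is_deriveM (is_derive_ln_ccdist w Up) (CnS Cfv p w))).
    by [].
  rewrite fv0// fvw0// mulr0 mul0r addr0.
  apply: (@near_eq_is_derive _ _ _ (cst 0)).
  have : nbhs p (~` K) by apply: open_nbhs_nbhs; split => //; rewrite openC.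
  by apply: filterS => q nq; rewrite /h fv0// mulr0; case: ifP.
- move=> p; rewrite /h; case: ifPn => [_|cp].
    by rewrite normr0 !addr_ge0// mulr_ge0// ltW.
  have [Kp|nK] := pselect (K p); last first.
    by rewrite fv0// mulr0 normr0 !addr_ge0// mulr_ge0// ltW.
  rewrite normrM; apply: (@le_trans _ _ (m2 * M1)).
    by apply: ler_pM => //; exact: b2.
  by rewrite -addrA lerDl addr_ge0// mulr_ge0// ltW.
- move=> p; rewrite /cut_derive; case: ifPn => [_|cp].
    by rewrite normr0 !addr_ge0// mulr_ge0// ltW.
  have [Kp|nK] := pselect (K p); last first.
    by rewrite fv0// fvw0// mulr0 mul0r addr0 normr0 !addr_ge0// mulr_ge0// ltW.
  apply: (le_trans (ler_normD _ _)); apply: lerD.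
    rewrite normrM; apply: (@le_trans _ _ (m2 * M2)); first by apply: ler_pM => //; exact: b2.
    by rewrite lerDr mulr_ge0// ltW.
  by rewrite normrM; apply: ler_pM => //; exact: b1.
- move=> p rp; rewrite /h fv0 ?mulr0; first by case: ifP.
  by move=> /zr[_]; rewrite leNgt rp.
Unshelve. all: by end_near. Qed.

End weak_commutation.

Section zero_mean.
Context d (T : measurableType d) (R : realType) (mu : {measure set T -> \bar R}).

Definition zero_mean (g : T -> R) : Prop :=
  mu.-integrable setT (EFin \o g) /\ (\int[mu]_x (g x)%:E = 0)%E.

Lemma zero_meanD g h : zero_mean g -> zero_mean h -> zero_mean (fun x => g x + h x).
Proof.
move=> [ig g0] [ih h0]; split.
  rewrite (_ : EFin \o _ = (EFin \o g) \+ (EFin \o h))%E; first exact: integrableD.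
  by apply/funext => x.
under eq_integral do rewrite EFinD.
by rewrite integralD// g0 h0 adde0.
Qed.

Lemma zero_meanZ (k : R) g : zero_mean g -> zero_mean (fun x => k * g x).
Proof.
move=> [ig g0]; split.
  rewrite (_ : EFin \o _ = (fun x => k%:E * (EFin \o g) x))%E; first exact: integrableZl.
  by apply/funext => x.
under eq_integral do rewrite EFinM.
by rewrite integralZl// g0 mule0.
Qed.

Lemma zero_meanB g h : zero_mean g -> zero_mean h -> zero_mean (fun x => g x - h x).
Proof.
move=> zg zh; rewrite (_ : (fun x => _) = (fun x => g x + -1 * h x)).
  by apply: zero_meanD => //; exact: zero_meanZ.
by apply/funext => x; rewrite mulN1r.
Qed.

Lemma zero_mean_sum m (g : 'I_m -> T -> R) :
  (forall i, zero_mean (g i)) -> zero_mean (fun x => \sum_i g i x).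
Proof.
elim: m g => [|m ih] g zg.
  rewrite (_ : (fun x => _) = cst 0); last by apply/funext => x; rewrite big_ord0.
  split; last by rewrite integral0.
  exact: integrable0.
rewrite (_ : (fun x => _) = (fun x => g ord0 x + \sum_i g (lift ord0 i) x)).
  by apply: zero_meanD => //; apply: ih => i.
by apply/funext => x; rewrite big_ord_recl.
Qed.

End zero_mean.

Section hardy_field.
Context {R : realType} {n : nat}.
Notation mu := (@heis_measure R n).
Implicit Types (p q v w : heis R n) (f : heis R n -> R) (i : 'I_n).

Definition xdir i : heis R n := (delta_mx 0 i, 0, 0).
Definition ydir i : heis R n := (0, delta_mx 0 i, 0).
Definition zdir : heis R n := (0, 0, 1).

Lemma derive_Xfield f i p : Cn 1 f ->
  'D_(Xfield i p) f p = 'D_(xdir i) f p - p.1.2 0 i / 2 * 'D_zdir f p.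
Proof.
move=> Cf; have -> : Xfield i p = xdir i + (- (p.1.2 0 i / 2)) *: zdir.
  rewrite /Xfield /xdir /zdir; congr (_, _, _) => /=.
  - by rewrite scaler0 addr0.
  - by rewrite scaler0 addr0.
  - by rewrite add0r; exact/esym/mulr1.
rewrite derive_add// derive_scale ?mulNr// => v.
by have [] := CnS Cf p v.
Qed.

Lemma derive_Yfield f i p : Cn 1 f ->
  'D_(Yfield i p) f p = 'D_(ydir i) f p + p.1.1 0 i / 2 * 'D_zdir f p.
Proof.
move=> Cf; have -> : Yfield i p = ydir i + (p.1.1 0 i / 2) *: zdir.
  rewrite /Yfield /ydir /zdir; congr (_, _, _) => /=.
  - by rewrite scaler0 addr0.
  - by rewrite scaler0 addr0.
  - by rewrite add0r; exact/esym/mulr1.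
rewrite derive_add// derive_scale// => v.
by have [] := CnS Cf p v.
Qed.

Lemma dist_slope_xdir i p :
  dist_slope p (xdir i) = arc_angle p * (halfcot (arc_angle p) * p.1.1 0 i).
Proof.
rewrite /dist_slope add0r; congr (_ * (_ * _)); rewrite /hdot (bigD1 i)//= big1.
  by rewrite !mxE !eqxx mulr1 mulr0 !addr0.
by move=> j /negPf ji; rewrite !mxE ji !mulr0 addr0.
Qed.

Lemma dist_slope_ydir i p :
  dist_slope p (ydir i) = arc_angle p * (halfcot (arc_angle p) * p.1.2 0 i).
Proof.
rewrite /dist_slope add0r; congr (_ * (_ * _)); rewrite /hdot (bigD1 i)//= big1.
  by rewrite !mxE !eqxx mulr1 mulr0 addr0 add0r.
by move=> j /negPf ji; rewrite !mxE ji !mulr0 addr0.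
Qed.

Lemma dist_slope_zdir p : dist_slope p zdir = arc_angle p.
Proof.
rewrite /dist_slope /hdot big1 ?mulr0 ?addr0 ?mulr1//.
by move=> j _; rewrite !mxE !mulr0 addr0.
Qed.

Local Notation xc i := (fun p : heis R n => p.1.1 0 i).
Local Notation yc i := (fun p : heis R n => p.1.2 0 i).

(* Up to the cut-offs, each bracket is df /\ d(ln ccdist) on two coordinate
   directions; the combination is the one in which the rotated radial field W
   appears: it equals W f / ccdist - n f d(ln ccdist)/dz. *)
Definition hardy_field f p : R := \sum_i
  (cut_derive f (yc i) (ydir i) (xdir i) p - cut_derive f (xc i) (xdir i) (ydir i) p +
   2^-1 * ((cut_derive (fun q => q.1.1 0 i * f q) (yc i) zdir (xdir i) p -
            cut_derive (fun q => q.1.1 0 i * f q) (yc i) (xdir i) zdir p) +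
           (cut_derive (fun q => q.1.2 0 i * f q) (xc i) zdir (ydir i) p -
            cut_derive (fun q => q.1.2 0 i * f q) (xc i) (ydir i) zdir p))).

(** Symmetry of second derivatives cancels the two terms in ln delta and leaves a coefficient of df
    /\ d(ln delta). *)
Lemma cut_deriveB f (c c' : heis R n -> R) v w p : Cn 2 f -> c p != 0 -> c' p != 0 ->
  cut_derive f c v w p - cut_derive f c' w v p =
  'D_v f p * (dist_slope p w / ccdist p ^+ 2) - 'D_w f p * (dist_slope p v / ccdist p ^+ 2).
Proof.
move=> Cf cp cp'; rewrite /cut_derive (ifN _ _ cp) (ifN _ _ cp').
have := derive_comm v w p Cf.
move: ('D_v ('D_w f) p) ('D_w ('D_v f) p) => a b ->.
by rewrite opprD addrACA subrr add0r.
Qed.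

(** The zeroth-order term comes from the product rule: for each i, differentiating x_i f and y_i f
    releases f / 2 twice, whence the factor n. *)
Lemma hardy_fieldE f p : Cn 2 f -> noncentral p ->
  (forall i, p.1.1 0 i != 0 /\ p.1.2 0 i != 0) ->
  hardy_field f p = hdot (hgrad f p) (hrot (radial_dir p)) / ccdist p -
    n%:R * (arc_angle p * f p / ccdist p ^+ 2).
Proof.
move=> Cf Up nz; have d0 := ccdist_gt0 Up; have C1 := CnW Cf.
pose A := arc_angle p / ccdist p ^+ 2; pose ka := halfcot (arc_angle p).
have -> : hdot (hgrad f p) (hrot (radial_dir p)) / ccdist p =
    \sum_i A * ('D_(Xfield i p) f p * (- (ka * p.1.2 0 i) - 2^-1 * p.1.1 0 i) +
                'D_(Yfield i p) f p * (ka * p.1.1 0 i - 2^-1 * p.1.2 0 i)).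
  rewrite hgrad_coord /hdot mulr_suml; apply: eq_bigr => i _.
  rewrite !mxE /= -/ka /A; move: (ccdist p) d0 ('D_(Xfield i p) f p) ('D_(Yfield i p) f p) => d d0 a b.
  by field; rewrite gt_eqF.
have -> (x : R) : n%:R * x = \sum_(i < n) x by rewrite sumr_const card_ord mulr_natl.
rewrite -sumrB.
apply: eq_bigr => i _; have [xi yi] := nz i.
have Cx := CnM (Cn_xcoord (n := n) 2 i) Cf; have Cy := CnM (Cn_ycoord (n := n) 2 i) Cf.
rewrite (derive_Xfield i p C1) (derive_Yfield i p C1).
rewrite (cut_deriveB (c := yc i) (c' := xc i) (ydir i) (xdir i) Cf yi xi).
rewrite (cut_deriveB (c := yc i) (c' := yc i) zdir (xdir i) Cx yi yi).
rewrite (cut_deriveB (c := xc i) (c' := xc i) zdir (ydir i) Cy xi xi).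
have dM (c : heis R n -> R) v : (forall p v, is_derive p v c (c v)) ->
    'D_v (fun q => c q * f q) p = c p * 'D_v f p + f p * c v.
  move=> dc; have := is_deriveM (dc p v) (CnS C1 p v).
  by case.
have dx v := dM (xc i) v (is_derive_xcoord i); have dy v := dM (yc i) v (is_derive_ycoord i).
rewrite (dx zdir) (dx (xdir i)) (dy zdir) (dy (ydir i)).
rewrite dist_slope_xdir dist_slope_ydir dist_slope_zdir /= !mxE !eqxx/= -/ka /A.
move: (ccdist p) d0 (f p) ('D_(xdir i) f p : R) ('D_(ydir i) f p : R) ('D_zdir f p : R).
move=> d d0 g; rewrite -[(nat_of_bool true)%:R]/(1 : R) => a b e.
by field; rewrite gt_eqF.
Qed.

(** In each summand the cut-off coordinate is one along which the outer direction of differentiation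
    has no component. *)
Lemma hardy_field_zero_mean (K : set (heis R n)) f : compact K -> K `<=` [set p | 0 < p.2] ->
  Cn 2 f -> supported K f -> zero_mean mu (hardy_field f).
Proof.
move=> cK K0 Cf f0.
have c0x i p : p.1.1 0 i != 0 -> 0 < hdot p p by move=> pi; apply: (hdot_gt0 (i := i)); rewrite pi.
have c0y i p : p.1.2 0 i != 0 -> 0 < hdot p p by move=> pi; apply: (hdot_gt0 (i := i)); rewrite pi orbT.
have zmx i v w g : Cn 2 g -> supported K g -> w.1.1 0 i = 0 ->
    zero_mean mu (cut_derive g (xc i) v w).
  move=> Cg g0 wi; apply: (integral_cut_derive cK K0 Cg g0).
  - exact: continuous_xcoord.
  - by move=> p t; rewrite !mxE wi mulr0 add0r.
  - exact: c0x.
have zmy i v w g : Cn 2 g -> supported K g -> w.1.2 0 i = 0 ->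
    zero_mean mu (cut_derive g (yc i) v w).
  move=> Cg g0 wi; apply: (integral_cut_derive cK K0 Cg g0).
  - exact: continuous_ycoord.
  - by move=> p t; rewrite !mxE wi mulr0 add0r.
  - exact: c0y.
apply: zero_mean_sum => i.
have Cx := CnM (Cn_xcoord (n := n) 2 i) Cf; have Cy := CnM (Cn_ycoord (n := n) 2 i) Cf.
have x0 : supported K (fun q => q.1.1 0 i * f q) by move=> q /f0 ->; rewrite mulr0.
have y0 : supported K (fun q => q.1.2 0 i * f q) by move=> q /f0 ->; rewrite mulr0.
have ex : (xdir i).1.2 0 i = 0 by rewrite mxE.
have ey : (ydir i).1.1 0 i = 0 by rewrite mxE.
have ez1 : (zdir).1.1 0 i = 0 by rewrite mxE.
have ez2 : (zdir).1.2 0 i = 0 by rewrite mxE.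
have h1 := zero_meanB (zmy i (ydir i) (xdir i) f Cf f0 ex) (zmx i (xdir i) (ydir i) f Cf f0 ey).
have h2 := zero_meanB (zmy i zdir (xdir i) _ Cx x0 ex) (zmy i (xdir i) zdir _ Cx x0 ez2).
have h3 := zero_meanB (zmx i zdir (ydir i) _ Cy y0 ey) (zmx i (ydir i) zdir _ Cy y0 ez1).
exact: (zero_meanD h1 (zero_meanZ 2^-1 (zero_meanD h2 h3))).
Qed.

End hardy_field.

Section null_axes.
Context {R : realType} {n : nat}.
Notation mu := (@heis_measure R n).
Implicit Types (p q : heis R n) (A : set (heis R n)).

(** A null union of coordinate hyperplanes. For n >= 1 it contains the centre, and off it every
    cut-off of [hardy_field] is inactive. *)
Definition axes : set (heis R n) := 
  [set p : heis R n | exists i, p.1.1 0 i = 0 \/ p.1.2 0 i = 0].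

Lemma axes_null : measurable axes /\ mu axes = 0%E.
Proof.
pose F i : set (heis R n) := [set p : heis R n | p.1.1 0 i = 0] `|`
    [set p : heis R n | p.1.2 0 i = 0].
have -> : axes = \big[setU/set0]_(i < n) F i.
  rewrite -bigcup_seq; apply/seteqP; split => p /=.
    by move=> [i pi]; exists i => //=; rewrite mem_index_enum.
  by move=> [i _ pi]; exists i.
suff [mF nF] : measurable (\big[setU/set0]_(i < n) F i) /\
    mu.-negligible (\big[setU/set0]_(i < n) F i).
  by split => //; exact: measure_negligible.
elim/big_ind : _ => [|A B [mA nA] [mB nB]|i _].
- by split; [exact: measurable0|exact: negligible_set0].
- by split; [exact: measurableU|exact: negligibleU].
have [mx my] := (measurable_xcoord0 (R := R) i, measurable_ycoord0 (R := R) i).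
split; first exact: measurableU.
by apply: negligibleU; apply/negligibleP => //; [exact: null_xcoord|exact: null_ycoord].
Qed.

Lemma ge0_integral_axes A (f : heis R n -> \bar R) : (forall p, A p -> (0 <= f p)%E) ->
  (\int[mu]_(p in A) f p = \int[mu]_(p in A `\` axes) f p)%E.
Proof.
move=> f0; have [mN N0] := axes_null.
exact: (@ge0_null_integral_nonmeasurable _ _ R mu A axes f mN N0 f0).
Qed.

Lemma noncentral_axes p : (1 <= n)%N -> ~ axes p -> 0 < p.2 -> noncentral p.
Proof.
move=> n1 ap pz; split => //; pose i := Ordinal n1.
have pi : p.1.1 0 i != 0 by apply/eqP => h; apply: ap; exists i; left.
by apply: (hdot_gt0 (i := i)); rewrite pi.
Qed.

Lemma measurable_heis_box (a b c d r s : R) :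
  measurable [set p : heis R n | (forall i, p.1.1 0 i \in `[a, b]) /\
    (forall i, p.1.2 0 i \in `[c, d]) /\ p.2 \in `[r, s]].
Proof.
rewrite (_ : [set p | _] = (\bigcap_i ((fun q : heis R n => q.1.1 0 i) @^-1` `[a, b])) `&`
  ((\bigcap_i ((fun q : heis R n => q.1.2 0 i) @^-1` `[c, d])) `&`
  ((fun q : heis R n => q.2) @^-1` `[r, s]))).
  apply: measurableI; last apply: measurableI.
  - apply: fin_bigcap_measurable => // i _; rewrite -[X in measurable X]setTI.
    exact: (measurable_xcoord i).
  - apply: fin_bigcap_measurable => // i _; rewrite -[X in measurable X]setTI.
    exact: (measurable_ycoord i).
  - by rewrite -[X in measurable X]setTI; exact: measurable_zcoord.
apply/seteqP; split => q /=.
  by move=> [h1 [h2 h3]]; split; [|split] => // i _ /=; [exact: h1|exact: h2].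
by move=> [h1 [h2 h3]]; split; [|split] => // i; [exact: h1|exact: h2].
Qed.

Lemma open_measure_gt0 A p : open A -> A p ->
  exists B, [/\ measurable B, B `<=` A & (0 < mu B < +oo)%E].
Proof.
move=> oA Ap; have /nbhs_ballP[e /= e0 eA] : nbhs p A by exact: open_nbhs_nbhs.
pose B0 := [set q : heis R n | (forall i, q.1.1 0 i \in `[- (e / 2), e / 2]) /\
    (forall i, q.1.2 0 i \in `[- (e / 2), e / 2]) /\ q.2 \in `[- (e / 2), e / 2]].
have e2 : - (e / 2) <= e / 2 by lra.
have mB0 : measurable B0 by exact: measurable_heis_box.
have [mt tE] := heis_measure_shift (- p).
exists ((fun q => q + - p) @^-1` B0); split.
- by rewrite -[X in measurable X]setTI; exact: mt.
- move=> q [h1 [h2 h3]]; apply: eA; rewrite -ball_normE/= distrC.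
  apply: heis_norm_lt => // [i|].
    have := h1 i; have := h2 i; rewrite !in_itv/= => /andP[a b] /andP[c d].
    by rewrite !ltr_norml; split; apply/andP; split; lra.
  by move: h3; rewrite in_itv/= ltr_norml => /andP[a b]; apply/andP; split; lra.
- have -> : mu ((fun q => q + - p) @^-1` B0) = mu B0 by exact: tE.
  by rewrite heis_box_measure// lte_fin ltry andbT !mulr_gt0 ?exprn_gt0//; lra.
Qed.

End null_axes.

(** * The Hardy inequality on a set of positive heights *)

Section hardy_inequality.
Context {R : realType} {n : nat}.
Notation mu := (@heis_measure R n).
Implicit Types (p q : heis R n) (u : heis R n -> R).
Variable O : set (heis R n).
Hypotheses (n1 : (1 <= n)%N) (O0 : O `<=` [set p | 0 < p.2]).

(** The density of the denominator, restricted to the open set where delta is known to be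
    continuous; this makes it measurable and alters it in z > 0 on a null set only. *)
Definition hardy_weight u : heis R n -> R :=
  (fun p => u p ^+ 2 / ccdist p ^+ 2) \_ (@noncentral R n).

Let hardy_weightE u p : noncentral p -> hardy_weight u p = u p ^+ 2 / ccdist p ^+ 2.
Proof. by move=> Up; rewrite /hardy_weight patchE mem_set. Qed.

Lemma hardy_weight_ge0 u p : 0 <= hardy_weight u p.
Proof.
rewrite /hardy_weight patchE; case: ifP => // _.
by rewrite divr_ge0 ?sqr_ge0.
Qed.

Lemma test_function_support u : test_functions O u ->
  exists2 K : set (heis R n), compact K & [/\ K `<=` O, supported K u & forall k, Cn k u].
Proof.
move=> [su cK KO]; exists (closure [set p | u p != 0]) => //; split => //.
move=> p nKp; apply/eqP/negPn/negP => up; apply: nKp.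
exact: subset_closure.
Qed.

Lemma integrable_hardy_weight u : test_functions O u ->
  mu.-integrable setT (EFin \o hardy_weight u).
Proof.
move=> /test_function_support[K cK [KO u0 Cu]].
have K0 := subset_trans KO O0.
have cu := Cn_continuous (Cu 0%N).
have [M M0 hM] := supported_bounded cK cu u0.
have [z0 [r [z00 r0 zr]]] := compact_upper_bounds cK K0.
apply: (@integrable_bounded_support _ _ R mu [set p | `|p| <= r] _ (M ^+ 2 / (2 * pi * z0))).
- exact: measurable_norm_le.
- exact: norm_le_measure.
- apply/(measurable_restrictT _ (open_measurable_heis (@open_noncentral R n))).
  apply: open_continuous_measurable_fun_heis; first exact: open_noncentral.
  move=> p Up; apply: cvgM; first by apply: cvgM; exact: cu.
  apply: cvgV; first by rewrite gt_eqF// exprn_gt0// ccdist_gt0.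
  by apply: cvgM; exact: continuous_ccdist.
- move=> p _; rewrite ger0_norm ?hardy_weight_ge0//.
  have pz0 : 0 < 2 * pi * z0 by rewrite !mulr_gt0// pi_gt0.
  have [Up|nU] := pselect (noncentral p); last first.
    by rewrite /hardy_weight patchE memNset// divr_ge0 ?sqr_ge0// ltW.
  rewrite hardy_weightE//.
  have [Kp|nK] := pselect (K p); last first.
    by rewrite u0// expr0n mul0r divr_ge0 ?sqr_ge0// ltW.
  apply: ler_pM; rewrite ?sqr_ge0 ?invr_ge0 ?sqr_ge0//.
    by rewrite -[leLHS]real_normK ?num_real// lerXn2r ?nnegrE// ltW.
  rewrite lef_pV2 ?posrE// ?exprn_gt0 ?ccdist_gt0// ccdist_sq//.
  apply: le_trans (sqdist_ge Up); rewrite ler_pM2l ?mulr_gt0 ?pi_gt0//.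
  by have [] := zr _ Kp.
- move=> p rp; rewrite /hardy_weight patchE u0 ?expr0n ?mul0r; first by case: ifP.
  by move=> /zr[].
Qed.

Lemma hardy_denominatorE u : test_functions O u ->
  (\int[mu]_(p in O) (`|u p| ^+ 2 / ccdist p ^+ 2)%:E = \int[mu]_p (hardy_weight u p)%:E)%E.
Proof.
move=> /test_function_support[K cK [KO u0 Cu]].
rewrite ge0_integral_axes; last first.
  by move=> p _; rewrite lee_fin divr_ge0 ?sqr_ge0.
transitivity (\int[mu]_(p in O `\` axes) (hardy_weight u p)%:E)%E.
  apply: eq_integral => p /set_mem[Op Np].
  rewrite hardy_weightE ?real_normK ?num_real//; apply: noncentral_axes => //.
  exact: O0.
rewrite -ge0_integral_axes; last first.
  by move=> p _; rewrite lee_fin hardy_weight_ge0.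
rewrite integral_mkcond; apply: eq_integral => p _; rewrite patchE.
case: ifPn => // /negP Op; rewrite /hardy_weight patchE u0 ?expr0n ?mul0r.
  by case: ifP.
by move=> /KO Kp; apply: Op; exact: mem_set.
Qed.

(** This makes the quotient of extended reals a true one. Positivity is read off a small box where
    |u| exceeds half of a nonzero value and where [sqdist_le] bounds delta from above. *)
Lemma hardy_denominator_gt0 u : test_functions O u -> u <> cst 0 ->
  exists2 B : R, 0 < B & (\int[mu]_(p in O) (`|u p| ^+ 2 / ccdist p ^+ 2)%:E = B%:E)%E.
Proof.
move=> tu un0; have iw := integrable_hardy_weight tu.
rewrite hardy_denominatorE//.
have [K cK [KO u0 Cu]] := test_function_support tu.
have cu := Cn_continuous (Cu 0%N).
have [z0 [r [z00 r0 zr]]] := compact_upper_bounds cK (subset_trans KO O0).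
have [p0 up0] : exists p0, u p0 != 0.
  apply: contrapT => h; apply: un0; apply/funext => p; apply/eqP/negPn/negP => up.
  by apply: h; exists p.
pose c : R := `|u p0| / 2; have c0 : 0 < c by rewrite divr_gt0 ?normr_gt0.
have oA : open [set p | c < `|u p|].
  apply: (@open_comp _ _ (fun p => `|u p|) [set x : R | c < x]).
    by move=> p _; apply: continuous_comp; [exact: cu|exact: norm_continuous].
  exact: open_gt.
have [|B [mB BA /andP[muB0 muBoo]]] := open_measure_gt0 oA (p := p0).
  by rewrite /= /c ltr_pdivrMr// mulr_natr mulr2n ltrDl normr_gt0.
pose e : R := c ^+ 2 / (4 * pi * r + n%:R * (2 * r ^+ 2)).
have du0 : 0 < 4 * pi * r + n%:R * (2 * r ^+ 2).
  by rewrite ltr_pwDl ?mulr_gt0 ?pi_gt0// mulr_ge0// mulr_ge0// sqr_ge0.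
have e0 : 0 < e by rewrite divr_gt0// exprn_gt0.
have fin := integrable_fin_num measurableT iw.
exists (fine (\int[mu]_p (hardy_weight u p)%:E)%E); last by rewrite fineK.
rewrite -lte_fin fineK//.
apply: (@lt_le_trans _ _ (\int[mu]_(p in B) (cst e%:E p))%E).
  by rewrite integral_cst// mule_gt0.
have wp p : (0 <= (hardy_weight u p)%:E)%E by rewrite lee_fin hardy_weight_ge0.
apply: (@le_trans _ _ (\int[mu]_(p in B) (hardy_weight u p)%:E)%E); last first.
  by apply: ge0_subset_integral_nonmeasurable.
have eB p : B p -> (0 <= cst e%:E p)%E by move=> _; rewrite lee_fin ltW.
rewrite (ge0_integral_axes eB) (ge0_integral_axes (A := B) (fun p _ => wp p)).
apply: ge0_le_integral_nonmeasurable => p [Bp Np]; rewrite /= lee_fin; first exact: ltW.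
have cp : c < `|u p| := BA _ Bp.
have Kp : K p.
  by apply: contrapT => nK; move: cp; rewrite u0// normr0 ltNge ltW.
have [zp rp] := zr _ Kp.
have Up : noncentral p by apply: noncentral_axes => //; exact: (lt_le_trans z00).
rewrite hardy_weightE//; apply: ler_pM; rewrite ?sqr_ge0 ?invr_ge0 ?(ltW du0)//.
  by rewrite -[leRHS]real_normK ?num_real// lerXn2r ?nnegrE// ltW.
rewrite lef_pV2 ?posrE// ?exprn_gt0 ?ccdist_gt0// ccdist_sq//.
apply: (le_trans (sqdist_le Up)); apply: lerD.
  rewrite ler_pM2l ?mulr_gt0 ?pi_gt0//; apply: le_trans rp.
  apply: (le_trans (ler_norm _)); suff : `|p.2| <= Num.max `|p.1| `|p.2| by [].
  by rewrite le_max lexx orbT.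
apply: (le_trans (hdot_le_norm p)); rewrite ler_wpM2l// ler_pM2l//.
by rewrite lerXn2r ?nnegrE// ltW.
Qed.

Lemma cut_derive_supported (K : set (heis R n)) f c v w : closed K -> supported K f ->
  supported K (cut_derive f c v w).
Proof.
move=> cK f0 p Kp; rewrite /cut_derive; have fv0 := supported_derive v cK f0.
have := supported_derive w cK fv0 Kp; have := fv0 _ Kp.
move: ('D_v f p) ('D_w ('D_v f) p) => a b -> ->.
by rewrite mulr0 mul0r addr0; case: ifP.
Qed.

Lemma hardy_field_supported (K : set (heis R n)) f : closed K -> supported K f ->
  supported K (hardy_field f).
Proof.
move=> cK f0 p Kp; rewrite /hardy_field big1// => i _.
have x0 : supported K (fun q => q.1.1 0 i * f q) by move=> q /f0 ->; rewrite mulr0.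
have y0 : supported K (fun q => q.1.2 0 i * f q) by move=> q /f0 ->; rewrite mulr0.
have c0 g c v w (g0 : supported K g) := @cut_derive_supported K g c v w cK g0 p Kp.
by rewrite !(c0 _ _ _ _ f0) !(c0 _ _ _ _ x0) !(c0 _ _ _ _ y0) !subr0 addr0 mulr0 addr0.
Qed.

Lemma hgrad_sq u p w : Cn 1 u ->
  hdot (hgrad (fun q => u q * u q) p) w = 2 * u p * hdot (hgrad u p) w.
Proof.
move=> Cu; rewrite -hdotZl; apply: hdot_hgrad => i; rewrite hgrad_coord !mxE.
have D v : 'D_v (fun q => u q * u q) p = 2 * u p * 'D_v u p.
  have [_ ->] := is_deriveM (CnS Cu p v) (CnS Cu p v).
  by rewrite -[u p *: _]/(u p * _); ring.
by split; exact: D.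
Qed.

Lemma hardy_lower (rho : R) u : 0 <= rho ->
  (forall p, O p -> noncentral p -> rho <= arc_angle p) ->
  test_functions O u -> u <> cst 0 ->
  (((n%:R * rho / 2) ^+ 2)%:E <=
   (\int[mu]_(p in O) (hnorm (hgrad_perp u p) ^+ 2)%:E) /
   (\int[mu]_(p in O) (`|u p| ^+ 2 / ccdist p ^+ 2)%:E))%E.
Proof.
move=> rho0 Orho tu un0; have iw := integrable_hardy_weight tu.
have [B B0 BE] := hardy_denominator_gt0 tu un0.
have wB := hardy_denominatorE tu; rewrite BE in wB; rewrite BE.
rewrite inver gt_eqF// lee_pdivlMr// -EFinM.
have [K cK [KO u0 Cu]] := test_function_support tu.
have clK : closed K by apply: compact_closed => //; exact: norm_hausdorff.
pose f p : R := u p * u p.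
have Cf : Cn 2 f := CnM (Cu 2%N) (Cu 2%N).
have f0 : supported K f by move=> p /u0 up; rewrite /f up mul0r.
have [iT T0] := hardy_field_zero_mean cK (subset_trans KO O0) Cf f0.
have Ts := hardy_field_supported clK f0.
set a := n%:R * rho / 2; have a0 : 0 <= a by rewrite divr_ge0// mulr_ge0.
(* As [hardy_field f] has mean zero, F integrates to a^2 times the denominator. It remains to show
   that F is at most the energy density. *)
pose F p : R := a * hardy_field f p + a ^+ 2 * hardy_weight u p.
have iF1 : mu.-integrable setT (fun p => a%:E * (EFin \o hardy_field f) p)%E by exact: integrableZl.
have iF2 : mu.-integrable setT (fun p => (a ^+ 2)%:E * (EFin \o hardy_weight u) p)%E by exact: integrableZl.
have iF : mu.-integrable setT (EFin \o F).
  rewrite (_ : EFin \o F = (fun p => a%:E * (EFin \o hardy_field f) p) \+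
    (fun p => (a ^+ 2)%:E * (EFin \o hardy_weight u) p))%E; first exact: integrableD.
  by apply/funext => p.
have -> : ((a ^+ 2 * B)%:E = \int[mu]_p (EFin \o F) p)%E.
  transitivity (\int[mu]_p (a%:E * (EFin \o hardy_field f) p + (a ^+ 2)%:E * (EFin \o hardy_weight u) p))%E; last first.
    by apply: eq_integral.
  rewrite integralD//.
  by rewrite (integralZl measurableT iT) (integralZl measurableT iw) T0 mule0 add0e -wB.
have FO p : ~ O p -> F p = 0.
  move=> Op; have Kp : ~ K p by move=> /KO.
  rewrite /F Ts// /hardy_weight patchE u0 ?expr0n ?mul0r//.
  by case: ifP; rewrite !mulr0 addr0.
have F0 p : (0 <= (EFin \o F)^\+ p)%E by exact: funepos_ge0.
(* Comparison with the possibly nonmeasurable energy density needs a nonnegative lower function. The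
   positive part of F stays below that density, which is a square. *)
apply: (@le_trans _ _ (\int[mu]_p (EFin \o F)^\+ p)%E).
  apply: le_integral => //; first exact: integrable_funepos.
  by move=> p _; rewrite funeposE le_max lexx.
have -> : (\int[mu]_p (EFin \o F)^\+ p = \int[mu]_(p in O) (EFin \o F)^\+ p)%E.
  rewrite [RHS]integral_mkcond; apply: eq_integral => p _; rewrite patchE.
  case: ifPn => // /negP Op; rewrite funeposE /= FO ?maxxx// => Op'.
  by apply: Op; exact: mem_set.
rewrite (ge0_integral_axes (A := O) (fun p _ => F0 p)).
have H0 p : O p -> (0 <= (hnorm (hgrad_perp u p) ^+ 2)%:E)%E by move=> _; rewrite lee_fin sqr_ge0.
rewrite (ge0_integral_axes H0).
apply: ge0_le_integral_nonmeasurable => p [Op Np]//.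
have Up : noncentral p by apply: noncentral_axes => //; exact: O0.
rewrite funeposE /= -EFin_max lee_fin ge_max sqr_ge0 andbT.
apply: le_trans (hgrad_perp_ge u Up).
have nz i : p.1.1 0 i != 0 /\ p.1.2 0 i != 0.
  by split; apply/eqP => h; apply: Np; exists i; [left|right].
rewrite /F (hardy_fieldE Cf Up nz) (hardy_weightE u Up).
rewrite (hgrad_sq p (hrot (radial_dir p)) (Cu 1%N)) /f.
have th := Orho _ Op Up; have d0 := ccdist_gt0 Up.
move: (arc_angle p) (hdot (hgrad u p) (hrot (radial_dir p))) (u p) (ccdist p) th d0 => t W x d th d0.
(* The opening of the cone enters here, through rho <= theta. *)
have nt : 2 * a <= n%:R * t.
  by rewrite /a mulrC divfK ?pnatr_eq0// ler_wpM2l.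
have -> : 2 * x * W / d - n%:R * (t * (x * x) / d ^+ 2) =
  2 * (x / d) * W - (n%:R * t) * (x / d) ^+ 2 by field; rewrite gt_eqF.
rewrite -expr_div_n; move: a0 nt; move: (x / d) (n%:R * t) (a); clear=> y m a a0 nt.
have h1 := sqr_ge0 (W - a * y).
have h2 : 0 <= a * ((m - 2 * a) * y ^+ 2) by apply: mulr_ge0 => //; apply: mulr_ge0; rewrite ?sqr_ge0// subr_ge0.
rewrite -subr_ge0.
have -> : W ^+ 2 - (a * (2 * y * W - m * y ^+ 2) + a ^+ 2 * y ^+ 2) =
  (W - a * y) ^+ 2 + a * ((m - 2 * a) * y ^+ 2) by ring.
exact: addr_ge0.
Qed.

End hardy_inequality.

(** * The upper bound *)

Section flat_exp.
Context {R : realType}.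
Implicit Types (x y : R) (q : {poly R}).

(* A class of flat functions stable under differentiation. *)
Definition poly_bump q x : R := if 0 < x then q.[x^-1] * expR (- x^-1) else 0.

Lemma horner_bound q : exists A m, 0 <= A /\ forall y, 1 <= y -> `|q.[y]| <= A * y ^+ m.
Proof.
elim/poly_ind : q => [|q c [A [m [A0 hA]]]].
  by exists 0, 0%N; split => // y _; rewrite horner0 normr0 mul0r.
exists (A + `|c|), m.+1; split => [|y y1]; first by rewrite addr_ge0.
have y0 : 0 <= y by rewrite (le_trans _ y1).
rewrite !hornerE; apply: (le_trans (ler_normD _ _)); rewrite mulrDl; apply: lerD.
  by rewrite normrM [`|y|]ger0_norm// exprSr mulrA ler_wpM2r// hA.
by rewrite ler_peMr// exprn_ege1.
Qed.

(** If q grows like y^m, the term of order m + 2 of the exponential series at 1 / x gains two powers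
    of x, enough for a zero derivative at 0. *)
Lemma poly_bump_bound q : exists2 C, 0 <= C &
  forall x, `|x| <= 1 -> `|poly_bump q x| <= C * x ^+ 2.
Proof.
have [A [m [A0 hA]]] := horner_bound q.
exists (A * m.+2`!%:R) => [|x x1]; first by rewrite mulr_ge0.
rewrite /poly_bump; case: ltP => [x0|_]; last first.
  by rewrite normr0; apply: mulr_ge0; [exact: mulr_ge0|exact: sqr_ge0].
rewrite gtr0_norm// in x1.
have y1 : 1 <= x^-1 by rewrite invf_ge1.
have y0 : 0 < x^-1 by rewrite invr_gt0.
rewrite normrM [`|expR _|]gtr0_norm ?expR_gt0// expRN.
have h1 : x^-1 ^+ m.+2 / m.+2`!%:R <= expR x^-1.
  by apply: le_trans (expR_ge1Dxn m.+1 (ltW y0)); rewrite lerDr.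
have f0 : 0 < m.+2`!%:R :> R by rewrite ltr0n fact_gt0.
rewrite ler_pdivrMr ?expR_gt0//; apply: (le_trans (hA _ y1)).
rewrite -2!mulrA ler_wpM2l//.
rewrite -ler_pdivrMl ?mulr_gt0 ?exprn_gt0//.
have -> : x^-1 ^+ m = x ^+ 2 * x^-1 ^+ m.+2.
  by rewrite -(addn2 m) exprD mulrCA -exprMn mulfV ?gt_eqF// expr1n mulr1.
by rewrite invfM -mulrA mulKf ?expf_neq0 ?gt_eqF// mulrC.
Qed.

Lemma is_derive_flat (G : R -> R) (C : R) :
  (forall x, `|x| <= 1 -> `|G x| <= C * x ^+ 2) -> is_derive (0 : R) 1 G 0.
Proof.
move=> hG; have G0 : G 0 = 0.
  apply/eqP; rewrite -normr_le0; apply: (le_trans (hG 0 _)); rewrite ?normr0//.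
  by rewrite expr0n mulr0.
have C0 : 0 <= C by have := hG 1; rewrite normr1 expr1n mulr1 => /(_ (lexx _)); exact: le_trans.
suff lim : h^-1 *: (G (h *: 1 + 0) - G 0) @[h --> (0 : R)^'] --> (0 : R).
  by apply: DeriveDef; [apply/cvg_ex; exists 0|exact: cvg_lim lim].
apply/cvgrPdist_lt => e e0; near=> h.
have h0 : h != 0 by near: h; exact: nbhs_dnbhs_neq.
have h1 : `|h| < 1.
  by near: h; apply: dnbhs0_lt.
have h2 : `|h| < e / (C + 1) by near: h; apply: dnbhs0_lt; rewrite divr_gt0// ltr_wpDl.
rewrite sub0r normrN G0 subr0 addr0 /GRing.scale/= mulr1 normrM normfV.
have nh : 0 < `|h| by rewrite normr_gt0.
rewrite mulrC ltr_pdivrMr//; apply: (le_lt_trans (hG _ (ltW h1))).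
rewrite -real_normK ?num_real// expr2 mulrA ltr_pM2r//.
rewrite ltr_pdivlMr in h2; last by rewrite ltr_wpDl.
by apply: le_lt_trans h2; rewrite mulrC ler_wpM2l// lerDl.
Unshelve. all: by end_near. Qed.

Lemma is_derive_poly_bump q x :
  is_derive x 1 (poly_bump q) (poly_bump ((q - q^`()) * 'X ^+ 2) x).
Proof.
have [x0|x0|->] := ltgtP x 0.
- rewrite /poly_bump ltNge (ltW x0)/=.
  apply: (@near_eq_is_derive _ _ _ (cst 0)).
  near=> y; rewrite /cst ltNge ifF//; apply/negbTE; rewrite negbK ltW//.
  by near: y; exact: lt_nbhsl.
- have nx : x != 0 by rewrite gt_eqF.
  apply: (@near_eq_is_derive _ _ _ (fun y => q.[y^-1] * expR (- y^-1))).
    near=> y; rewrite /poly_bump ifT//; near: y; exact: lt_nbhsr.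
  have dV : is_derive x 1 (fun y : R => y^-1) (- x ^- 2).
    by apply: (is_derive_eq (is_deriveV nx (is_derive_id x (1:R)))); rewrite /GRing.scale/= mulr1.
  have dh : is_derive x^-1 1 (horner q) (q^`().[x^-1]).
    have /derivableP := @derivable_horner R q x^-1; by rewrite derivE derive1E.
  have dq : is_derive x 1 (fun y => q.[y^-1]) (q^`().[x^-1] * - x ^- 2).
    exact: (@is_derive1_comp R (horner q) (fun y => y^-1) x _ _ dh dV).
  have de : is_derive x 1 (fun y => expR (- y^-1)) (expR (- x^-1) * x ^- 2).
    apply: (@is_derive1_comp R expR (fun y => - y^-1)).
    by apply: (is_derive_eq (is_deriveN dV)); rewrite opprK.
  apply: (is_derive_eq (is_deriveM dq de)).
  rewrite /poly_bump x0 !hornerE /GRing.scale/=.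
  by move: (q.[x^-1]) (q^`().[x^-1]) (expR (- x^-1)) => a b c; field.
rewrite {2}/poly_bump ltxx; have [C _ hC] := poly_bump_bound q.
exact: is_derive_flat hC.
Unshelve. all: by end_near. Qed.

Lemma Cn_poly_bump_comp n k q (f : heis R n -> R) : Cn k f -> Cn k (poly_bump q \o f).
Proof.
apply: (@Cn_real_comp _ _ setT [set G | exists q, G = poly_bump q]) => //; last by exists q.
move=> _ [r ->]; exists (poly_bump ((r - r^`()) * 'X ^+ 2)); first by exists ((r - r^`()) * 'X ^+ 2).
by move=> x _; exact: is_derive_poly_bump.
Qed.

Definition flat_exp : R -> R := poly_bump 1.
Definition dflat_exp : R -> R := poly_bump ('X ^+ 2).

Lemma is_derive_flat_exp x : is_derive x 1 flat_exp (dflat_exp x).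
Proof.
apply: (is_derive_eq (is_derive_poly_bump 1 x)).
by rewrite /dflat_exp -[1]/(1%:P) derivC subr0 mul1r.
Qed.

Lemma flat_exp_out x : x <= 0 -> flat_exp x = 0 /\ dflat_exp x = 0.
Proof. by move=> x0; rewrite /flat_exp /dflat_exp /poly_bump !ltNge x0. Qed.

Lemma flat_exp_bounds x : 0 <= flat_exp x <= 1.
Proof.
rewrite /flat_exp /poly_bump; case: ltP => [x0|_]; last by rewrite lexx ler01.
by rewrite hornerC mul1r expR_ge0 expR_le1 oppr_le0 invr_ge0 ltW.
Qed.

(** With y = 1 / x the claim is y^2 <= 4 exp y, the square of y / 2 <= exp (y / 2). *)
Lemma dflat_exp_bounds x : 0 <= dflat_exp x <= 4.
Proof.
rewrite /dflat_exp /poly_bump; case: ltP => [x0|_]; last by apply/andP; split; lra.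
rewrite hornerXn; apply/andP; split.
  by apply: mulr_ge0; [rewrite exprn_ge0// invr_ge0 ltW|exact: expR_ge0].
rewrite expRN.
rewrite ler_pdivrMr ?expR_gt0//.
have y0 : 0 < x^-1 by rewrite invr_gt0.
have e : expR x^-1 = expR (x^-1 / 2) ^+ 2 by rewrite -expRM_natl mulrC divfK.
have h : x^-1 / 2 <= expR (x^-1 / 2).
  by apply: le_trans (expR_ge1Dx _); rewrite lerDr.
rewrite e; have -> : x^-1 ^+ 2 = 4 * (x^-1 / 2) ^+ 2 by field; rewrite gt_eqF.
by rewrite ler_pM2l// lerXn2r ?nnegrE ?expR_ge0// divr_ge0// ltW.
Qed.

Lemma flat_exp_lower x y : 0 < y -> y <= x -> expR (- y^-1) <= flat_exp x.
Proof.
move=> y0 yx; have x0 := lt_le_trans y0 yx.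
by rewrite /flat_exp /poly_bump x0 hornerC mul1r ler_expR lerN2 lef_pV2.
Qed.

End flat_exp.

Section square_bounds.
Context {R : realType}.
Implicit Types (t d s : R).

(** Young's inequality with a small weight h: the main term a must keep a coefficient close to 1,
    while the errors b and c may be multiplied by a large constant. *)
Lemma sqr_sum3_le (h a b c : R) : 0 < h ->
  (a + b + c) ^+ 2 <= (1 + h) * a ^+ 2 + 2 * (1 + h^-1) * (b ^+ 2 + c ^+ 2).
Proof.
move=> h0; rewrite -subr_ge0.
have -> : (1 + h) * a ^+ 2 + 2 * (1 + h^-1) * (b ^+ 2 + c ^+ 2) - (a + b + c) ^+ 2 =
    (h * a - (b + c)) ^+ 2 / h + (1 + h^-1) * (b - c) ^+ 2 by field; rewrite gt_eqF.
have hV : 0 < h^-1 by rewrite invr_gt0.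
by apply: addr_ge0; apply: mulr_ge0; rewrite ?sqr_ge0 ?addr_ge0 ?ltW.
Qed.

(** The constant pi n arises here, from t / 2 <= pi and s / (s + sg) <= 1. *)
Lemma main_term_le (m : nat) (t d s sg u : R) : 0 < t < 2 * pi -> 0 < d -> 0 < s -> 0 < sg ->
  (t / d * s * (- (m%:R / 2) / (s + sg) * u)) ^+ 2 <= (pi * m%:R) ^+ 2 * (u ^+ 2 / d ^+ 2).
Proof.
move=> /andP[t0 tpi] d0 s0 sg0.
have -> : t / d * s * (- (m%:R / 2) / (s + sg) * u) =
    - (t / 2 * (s / (s + sg)) * m%:R) * (u / d).
  by field; rewrite !gt_eqF// addr_gt0.
rewrite exprMn sqrrN expr_div_n ler_wpM2r ?divr_ge0 ?sqr_ge0//.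
have ss : 0 < s + sg by rewrite addr_gt0.
have r0 : 0 <= s / (s + sg) by rewrite divr_ge0// ltW.
have r1 : s / (s + sg) <= 1 by rewrite ler_pdivrMr// mul1r lerDl ltW.
have t1 : 0 <= t / 2 by rewrite divr_ge0// ltW.
have p0 : 0 <= pi :> R by exact: pi_ge0.
have le : t / 2 * (s / (s + sg)) <= pi.
  by rewrite -[leRHS]mulr1; apply: ler_pM => //; lra.
have le2 : t / 2 * (s / (s + sg)) * m%:R <= pi * m%:R by rewrite ler_wpM2r.
by rewrite lerXn2r ?nnegrE// mulr_ge0// mulr_ge0.
Qed.

(** The constant is 2 pi, a bound for t^2 / d^2, times 16, a bound for h^2. The singular factor f^2
    is absorbed by s^m, so sg does not appear. *)
Lemma cutoff_term_le (m : nat) (t d s s0 f h c : R) : (0 < m)%N -> 0 < t < 2 * pi ->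
  0 < d -> 2 * pi <= d ^+ 2 -> 0 < s <= s0 -> f ^+ 2 * s ^+ m <= 1 -> 0 <= h <= 4 -> 0 <= c <= 1 ->
  (t / d * s * (- f * h * m%:R * s ^+ m.-1 / s0 ^+ m * c)) ^+ 2 <= 32 * pi * m%:R ^+ 2 / s0 ^+ m.
Proof.
case: m => // m _ /andP[t0 tpi] d0 dpi /andP[s0' ss0] fs /andP[h0 h4] /andP[c0 c1].
have S0 : 0 < s0 by exact: lt_le_trans ss0.
have sm0 : 0 < s0 ^+ m.+1 by rewrite exprn_gt0.
have smp : 0 < s ^+ m.+1 by rewrite exprn_gt0.
have -> : (t / d * s * (- f * h * m.+1%:R * s ^+ m.+1.-1 / s0 ^+ m.+1 * c)) ^+ 2 =
   (m.+1%:R ^+ 2 / s0 ^+ m.+1) * ((t ^+ 2 / d ^+ 2) * ((f ^+ 2 * s ^+ m.+1) * (s ^+ m.+1 / s0 ^+ m.+1)) * (h ^+ 2 * c ^+ 2)).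
  rewrite [m.+1.-1]/= (exprS s m); move: (s0 ^+ m.+1) sm0 (s ^+ m) m.+1%:R => a a0 b k.
  by field; rewrite !gt_eqF.
have -> : 32 * pi * m.+1%:R ^+ 2 / s0 ^+ m.+1 = m.+1%:R ^+ 2 / s0 ^+ m.+1 * (2 * pi * (1 * 1) * (16 * 1)).
  by ring.
have p0 : 0 < pi :> R by exact: pi_gt0.
have q0 : 0 <= s ^+ m.+1 / s0 ^+ m.+1 by rewrite divr_ge0// ltW.
have f0 : 0 <= f ^+ 2 * s ^+ m.+1 by rewrite mulr_ge0 ?sqr_ge0// ltW.
have t2 : 0 <= t ^+ 2 / d ^+ 2 by rewrite divr_ge0 ?sqr_ge0.
apply: ler_wpM2l; first by rewrite divr_ge0 ?sqr_ge0// ltW.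
apply: ler_pM.
- by apply: mulr_ge0 => //; exact: mulr_ge0.
- by rewrite mulr_ge0 ?sqr_ge0.
- apply: ler_pM => //; first exact: mulr_ge0.
    rewrite ler_pdivrMr ?exprn_gt0//.
    apply: (@le_trans _ _ ((2 * pi) * (2 * pi))).
      by rewrite expr2; apply: ler_pM; rewrite ?ltW.
    by rewrite ler_wpM2l// mulr_ge0// ltW.
  apply: ler_pM => //; rewrite ler_pdivrMr// mul1r lerXn2r ?nnegrE// ltW//.
apply: ler_pM; rewrite ?sqr_ge0//.
  rewrite (_ : 16 = 4 ^+ 2 :> R); last by ring.
  by rewrite lerXn2r ?nnegrE.
by rewrite expr_le1.
Qed.

(** The formula for d^2 gives t^2 ka^2 s <= d^2, which tames the cotangent near the centre. What
    remains is s c^2 / 4 with |c| <= 8, small with s0. *)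
Lemma vertical_term_le (t d s s0 ka g c : R) : 0 < d -> 0 < s <= s0 ->
  d ^+ 2 = t ^+ 2 * ((1 / 4 + ka ^+ 2) * s) -> `|c| <= 8 ->
  (t / d * s * (- (g * c / 2 * ka))) ^+ 2 <= 16 * s0 * g ^+ 2.
Proof.
move=> d0 /andP[s0' ss0] dE c8.
have -> : (t / d * s * (- (g * c / 2 * ka))) ^+ 2 =
  (t ^+ 2 * (ka ^+ 2 * s) / d ^+ 2) * (s * (c ^+ 2 / 4)) * g ^+ 2.
  by field; rewrite gt_eqF.
apply: ler_wpM2r; first exact: sqr_ge0.
have k0 : 0 <= ka ^+ 2 * s by rewrite mulr_ge0 ?sqr_ge0// ltW.
have -> : 16 * s0 = 1 * (s0 * 16) by ring.
apply: ler_pM.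
- by rewrite divr_ge0 ?sqr_ge0// mulr_ge0 ?sqr_ge0.
- by rewrite mulr_ge0 ?divr_ge0 ?sqr_ge0// ltW.
- rewrite ler_pdivrMr ?exprn_gt0// mul1r dE ler_wpM2l ?sqr_ge0//.
  by rewrite mulrDl lerDr mulr_ge0// ltW.
apply: ler_pM => //; [exact: ltW|by rewrite divr_ge0 ?sqr_ge0|].
rewrite ler_pdivrMr// -real_normK ?num_real//.
have -> : 16 * 4 = 8 ^+ 2 :> R by ring.
by rewrite lerXn2r ?nnegrE.
Qed.

End square_bounds.

(** * Test functions concentrated near the centre *)

Section test_function.
Context {R : realType} {n : nat}.
Notation mu := (@heis_measure R n).
Implicit Types (p q v w : heis R n).
Hypothesis n1 : (1 <= n)%N.
Variables s0 sg : R.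
Hypotheses (s0_gt0 : 0 < s0) (s0_le1 : s0 <= 1) (sg_gt0 : 0 < sg).

Definition half_power (x : R) : R := expR (- (n%:R / 2) * ln x).

Lemma half_power_sq (x : R) : 0 < x -> half_power x ^+ 2 = (x ^+ n)^-1.
Proof.
move=> x0; rewrite /half_power -expRM_natl mulNr mulrN expRN; congr (_^-1).
by rewrite mulrA mulrCA mulfV// mulr1 expRM_natl lnK// posrE.
Qed.

Lemma half_power_gt0 x : 0 < half_power x.
Proof. exact: expR_gt0. Qed.

Lemma is_derive_half_power (x : R) : 0 < x ->
  is_derive x 1 half_power (- (n%:R / 2) / x * half_power x).
Proof.
move=> x0.
have d1 : is_derive x 1 (fun x => - (n%:R / 2) * ln x) (- (n%:R / 2) * x^-1).
  exact: (is_deriveZ (- (n%:R / 2)) (is_derive1_ln x0)).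
by apply: (is_derive_eq (@is_derive1_comp R expR _ x _ _ (is_derive_expR _) d1)); rewrite mulrC.
Qed.

Lemma Cn_half_power_comp k (f : heis R n -> R) : (forall p, 0 < f p) ->
  Cn k f -> Cn k (half_power \o f).
Proof.
apply: (@Cn_real_comp _ _ [set x | 0 < x] [set G | exists c e, G = fun x => c * expR (e * ln x)]).
  move=> _ [c [e ->]]; exists (fun x => c * e * expR ((e - 1) * ln x)); first by exists (c * e), (e - 1).
  move=> x x0.
  have d1 : is_derive x 1 (fun x => e * ln x) (e * x^-1) by exact: (is_deriveZ e (is_derive1_ln x0)).
  have d2 := @is_derive1_comp R expR _ x _ _ (is_derive_expR _) d1.
  apply: (is_derive_eq (is_deriveZ c d2)).
  rewrite mulrBl mul1r expRB lnK// /GRing.scale/=; by ring.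
by exists 1, (- (n%:R / 2)); apply/funext => x; rewrite mul1r.
Qed.

(* The power of s + sg is critical for the Hardy quotient, with mass growing like
   ln (1 / sg); the second factor is 1 / e up to O(s^n), which keeps the error
   coming from its derivative bounded uniformly in sg. *)
Definition profile (s : R) : R := half_power (s + sg) * flat_exp (1 - (s / s0) ^+ n).
Definition dprofile (s : R) : R :=
  - (n%:R / 2) / (s + sg) * half_power (s + sg) * flat_exp (1 - (s / s0) ^+ n) -
  half_power (s + sg) * dflat_exp (1 - (s / s0) ^+ n) * n%:R * s ^+ n.-1 / s0 ^+ n.

Lemma is_derive_profile (s : R) : 0 <= s -> is_derive s 1 profile (dprofile s).
Proof.
move=> s_ge0; have ss : 0 < s + sg by rewrite ltr_wpDl.
have d1 : is_derive s 1 (fun s => half_power (s + sg)) (- (n%:R / 2) / (s + sg) * half_power (s + sg)).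
  have da : is_derive s 1 (fun s : R => s + sg) 1.
    by apply: (is_derive_eq (is_deriveD (is_derive_id s (1:R)) (is_derive_cst sg s 1))); rewrite addr0.
  by apply: (is_derive_eq (@is_derive1_comp R half_power _ s _ _ (is_derive_half_power ss) da)); rewrite mulr1.
have d2 : is_derive s 1 (fun s => 1 - (s / s0) ^+ n) (- (n%:R * s ^+ n.-1 / s0 ^+ n)).
  have db : is_derive s 1 (fun s : R => (s / s0) ^+ n) (n%:R * s ^+ n.-1 / s0 ^+ n).
    have -> : (fun s : R => (s / s0) ^+ n) = (s0 ^+ n)^-1 \*: (fun s : R => s ^+ n).
      by apply/funext => x; rewrite /= expr_div_n mulrC.
    have dX : is_derive s 1 (fun s : R => s ^+ n) (n%:R * s ^+ n.-1).
      have -> : (fun s : R => s ^+ n) = (@id R : R -> R) ^+ n by rewrite exprfctE.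
      by apply: (is_derive_eq (is_deriveX n (is_derive_id s (1:R)))); rewrite /GRing.scale/= mulr1.
    by apply: (is_derive_eq (is_deriveZ _ dX)); rewrite /GRing.scale/= mulrC.
  by apply: (is_derive_eq (is_deriveB (is_derive_cst (1:R) s 1) db)); rewrite sub0r.
have d3 := @is_derive1_comp R flat_exp _ s _ _ (is_derive_flat_exp _) d2.
apply: (is_derive_eq (is_deriveM d1 d3)).
rewrite /dprofile /GRing.scale/=.
move: (half_power _) (flat_exp _) (dflat_exp _) (s ^+ n.-1) (s0 ^+ n) => a b c d e; by ring.
Qed.

Definition chi (z : R) : R := flat_exp (z - 1) * flat_exp (2 - z).
Definition dchi (z : R) : R := dflat_exp (z - 1) * flat_exp (2 - z) - flat_exp (z - 1) * dflat_exp (2 - z).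

Lemma is_derive_chi (z : R) : is_derive z 1 chi (dchi z).
Proof.
have da : is_derive z 1 (fun z : R => z - 1) 1.
  by apply: (is_derive_eq (is_deriveB (is_derive_id z (1:R)) (is_derive_cst (1 : R) z 1))); rewrite subr0.
have db : is_derive z 1 (fun z : R => 2 - z) (- 1).
  by apply: (is_derive_eq (is_deriveB (is_derive_cst (2 : R) z 1) (is_derive_id z (1:R)))); rewrite sub0r.
have d1 := @is_derive1_comp R flat_exp _ z _ _ (is_derive_flat_exp _) da.
have d2 := @is_derive1_comp R flat_exp _ z _ _ (is_derive_flat_exp _) db.
apply: (is_derive_eq (is_deriveM d1 d2)).
rewrite /dchi /GRing.scale/=; by ring.
Qed.

Lemma chi_bounds (z : R) : 0 <= chi z <= 1.
Proof.
have /andP[a0 a1] := flat_exp_bounds (z - 1); have /andP[b0 b1] := flat_exp_bounds (2 - z).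
by rewrite mulr_ge0//= mulr_ile1.
Qed.

Lemma dchi_bound (z : R) : `|dchi z| <= 8.
Proof.
have /andP[a0 a1] := flat_exp_bounds (z - 1); have /andP[b0 b1] := flat_exp_bounds (2 - z).
have /andP[c0 c1] := dflat_exp_bounds (z - 1); have /andP[d0 d1] := dflat_exp_bounds (2 - z).
have h1 : `|dflat_exp (z - 1) * flat_exp (2 - z)| <= 4 * 1.
  by rewrite ger0_norm ?mulr_ge0//; apply: ler_pM.
have h2 : `|flat_exp (z - 1) * dflat_exp (2 - z)| <= 1 * 4.
  by rewrite ger0_norm ?mulr_ge0//; apply: ler_pM.
by apply: (le_trans (ler_normB _ _)); apply: (le_trans (lerD h1 h2)); lra.
Qed.

Lemma chi_out (z : R) : ~~ (1 <= z <= 2) -> chi z = 0 /\ dchi z = 0.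
Proof.
rewrite negb_and -!ltNge => /orP[z1|z2].
  have [|a b] := @flat_exp_out R (z - 1); first by lra.
  by rewrite /chi /dchi a b !mul0r subr0.
have [|a b] := @flat_exp_out R (2 - z); first by lra.
by rewrite /chi /dchi a b !mulr0 subr0.
Qed.

(** On the middle third both arguments of [flat_exp] are at least 1 / 3, so each factor is at least
    exp (-3). *)
Lemma chi_lower (z : R) : 4 / 3 <= z <= 5 / 3 -> expR (- 6) <= chi z.
Proof.
move=> /andP[z1 z2]; have -> : - 6 = - 3 + - 3 :> R by ring.
have i3 : (1 / 3)^-1 = 3 :> R by rewrite div1r invrK.
have l1 : expR (- 3) <= flat_exp (z - 1) by rewrite -i3; apply: flat_exp_lower; lra.
have l2 : expR (- 3) <= flat_exp (2 - z) by rewrite -i3; apply: flat_exp_lower; lra.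
by rewrite expRD /chi; apply: ler_pM; rewrite ?expR_ge0.
Qed.

Lemma profile_out (s : R) : s0 < s -> profile s = 0 /\ dprofile s = 0.
Proof.
move=> ss; have [|a b] := @flat_exp_out R (1 - (s / s0) ^+ n).
  by rewrite subr_le0 exprn_ege1// ler_pdivlMr// mul1r ltW.
by rewrite /profile /dprofile a b !mulr0 !mul0r subr0.
Qed.

Lemma profile_sqE (s : R) : 0 < s + sg ->
  profile s ^+ 2 = flat_exp (1 - (s / s0) ^+ n) ^+ 2 / (s + sg) ^+ n.
Proof. by move=> ss; rewrite exprMn half_power_sq// mulrC. Qed.

Lemma profile_sq_le (s : R) : 0 <= s -> profile s ^+ 2 <= (sg ^+ n)^-1.
Proof.
move=> s_ge0; have ss : 0 < s + sg by rewrite ltr_wpDl.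
rewrite profile_sqE//.
have /andP[a0 a1] := flat_exp_bounds (1 - (s / s0) ^+ n).
rewrite -[leRHS]mul1r; apply: ler_pM; rewrite ?invr_ge0 ?exprn_ge0 ?(ltW ss) ?(ltW sg_gt0)//.
  by rewrite expr_le1.
by rewrite lef_pV2 ?posrE ?exprn_gt0// lerXn2r ?nnegrE ?(ltW ss) ?(ltW sg_gt0)// lerDr.
Qed.

Definition test_fun p : R := profile (hdot p p) * chi p.2.

Lemma Cn_test_fun k : Cn k test_fun.
Proof.
have Cs := @Cn_hdot_id R n k; have Cz := @Cn_zcoord R n k.
have C1 : Cn k (half_power \o (fun p => hdot p p + sg)).
  apply: Cn_half_power_comp; last exact: CnD Cs (Cn_cst k sg).
  by move=> p; rewrite ltr_wpDl ?hdot_ge0.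
have CX m : Cn k (fun p : heis R n => (hdot p p / s0) ^+ m).
  elim: m => [|m ih]; first exact: (Cn_cst k 1).
  have -> : (fun p : heis R n => (hdot p p / s0) ^+ m.+1) =
      (fun p => (hdot p p * cst s0^-1 p) * (hdot p p / s0) ^+ m).
    by apply/funext => p; rewrite exprS.
  by apply: CnM => //; apply: CnM => //; exact: Cn_cst.
have C2 : Cn k (poly_bump 1 \o (fun p : heis R n => 1 - (hdot p p / s0) ^+ n)).
  apply: Cn_poly_bump_comp.
  have -> : (fun p : heis R n => 1 - (hdot p p / s0) ^+ n) =
     (fun p => cst 1 p + cst (- 1) p * (hdot p p / s0) ^+ n).
    by apply/funext => p; rewrite mulN1r.
  by apply: CnD; [exact: Cn_cst|apply: CnM; [exact: Cn_cst|exact: CX]].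
have C3 : Cn k (poly_bump 1 \o (fun p : heis R n => p.2 - 1)).
  by apply: Cn_poly_bump_comp; exact: (CnD Cz (Cn_cst k (- 1))).
have C4 : Cn k (poly_bump 1 \o (fun p : heis R n => 2 - p.2)).
  apply: Cn_poly_bump_comp.
  have -> : (fun p : heis R n => 2 - p.2) = (fun p => cst 2 p + cst (- 1) p * p.2).
    by apply/funext => p; rewrite mulN1r.
  by apply: CnD; [exact: Cn_cst|apply: CnM; [exact: Cn_cst|exact: Cz]].
exact: (CnM (CnM C1 C2) (CnM C3 C4)).
Qed.

End test_function.

Section test_function_energy.
Context {R : realType} {n : nat}.
Notation mu := (@heis_measure R n).
Implicit Types (p q v w : heis R n).
Hypothesis n1 : (1 <= n)%N.
Variables s0 sg : R.
Hypotheses (s0_gt0 : 0 < s0) (s0_le1 : s0 <= 1) (sg_gt0 : 0 < sg).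
Local Notation tf := (@test_fun R n s0 sg).
Local Notation prf := (@profile R n s0 sg).
Local Notation dprf := (@dprofile R n s0 sg).

Lemma hdot_hgrad_test_fun p w : hdot (hgrad tf p) w =
  hdot ((2 * dprf (hdot p p) * chi p.2) *: p + (prf (hdot p p) * dchi p.2 / 2) *: hrot p) w.
Proof.
have D v : is_derive p v tf (prf (hdot p p) * (dchi p.2 * v.2) +
    chi p.2 * (dprf (hdot p p) * (2 * hdot p v))).
  have d1 := @is_derive_real_comp R (heis R n) prf (fun p => hdot p p) p v _ _ (is_derive_profile (n := n) s0 sg_gt0 (hdot_ge0 p)) (is_derive_hdot_id p v).
  have d2 := @is_derive_real_comp R (heis R n) chi (fun p => p.2) p v _ _ (is_derive_chi p.2) (is_derive_zcoord p v).
  exact: (is_deriveM d1 d2).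
apply: hdot_hgrad => i; split.
  have [_ ->] := D (Xfield i p); rewrite hdot_Xfield /= !mxE.
  by move: (prf _) (dprf _) (chi _) (dchi _) => a b c d; field.
have [_ ->] := D (Yfield i p); rewrite hdot_Yfield /= !mxE.
by move: (prf _) (dprf _) (chi _) (dchi _) => a b c d; field.
Qed.

Definition slab (a b : R) : set (heis R n) :=
  [set p | hdot p p <= s0 /\ a <= p.2 <= b].


Lemma test_fun_out p : ~ slab 1 2 p -> tf p = 0.
Proof.
move=> np; rewrite /test_fun.
have [ps|sp] := ltP s0 (hdot p p).
  by have [-> _] := profile_out (n := n) sg s0_gt0 ps; rewrite mul0r.
have [|-> _] := @chi_out R p.2; last by rewrite mulr0.
by apply/negP => pz; apply: np.
Qed.

Lemma test_fun_perp_le (h : R) p : 0 < h -> noncentral p ->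
  hnorm (hgrad_perp tf p) ^+ 2 <= (1 + h) * ((pi * n%:R) ^+ 2 * hardy_weight tf p) +
   2 * (1 + h^-1) * ((32 * pi * n%:R ^+ 2 / s0 ^+ n + 16 * s0 * prf (hdot p p) ^+ 2) * \1_(slab 1 2) p).
Proof.
move=> h0 Up; have [s_gt0 z_gt0] := Up.
rewrite (hgrad_perp_radial Up (hdot_hgrad_test_fun p)).
have [Kp|nKp] := pselect (slab 1 2 p); last first.
  have -> : 2 * dprf (hdot p p) * chi p.2 / 2 - prf (hdot p p) * dchi p.2 / 2 * halfcot (arc_angle p) = 0.
    have [ps|sp] := ltP s0 (hdot p p).
      by have [-> ->] := profile_out (n := n) sg s0_gt0 ps; rewrite mulr0 !mul0r subr0.
    have [|-> ->] := @chi_out R p.2; last by rewrite !mulr0 !mul0r subr0.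
    by apply/negP => pz; apply: nKp.
  rewrite mulr0 expr0n/= indicE memNset// !mulr0 addr0.
  have h1 : 0 <= 1 + h by rewrite addr_ge0// ltW.
  by apply: mulr_ge0 => //; apply: mulr_ge0; [exact: sqr_ge0|exact: hardy_weight_ge0].
rewrite indicE (mem_set Kp) mulr1.
have [sp /andP[z1 z2]] := Kp.
have [thd _] := arc_angleP Up; have d0 := ccdist_gt0 Up.
have dpi : 2 * pi <= ccdist p ^+ 2.
  rewrite ccdist_sq//; apply: le_trans (sqdist_ge Up).
  by rewrite ler_peMr// mulr_ge0// pi_ge0.
have dE : ccdist p ^+ 2 = arc_angle p ^+ 2 * ((1 / 4 + halfcot (arc_angle p) ^+ 2) * hdot p p).
  by rewrite ccdist_sq// sqdistE// halfcotE ?cos_lt1//; congr (_ * _); rewrite mul1r mulrC.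
rewrite /hardy_weight patchE mem_set// /test_fun.
have := chi_bounds p.2; have := dchi_bound p.2.
rewrite /dprofile /profile.
have hs : 0 < hdot p p + sg by rewrite addr_gt0.
have ha := half_power_sq (n := n) hs.
have := flat_exp_bounds (1 - (hdot p p / s0) ^+ n); have := dflat_exp_bounds (1 - (hdot p p / s0) ^+ n).
move: (arc_angle p) (halfcot (arc_angle p)) (ccdist p) thd d0 dpi dE.
move: (chi p.2) (dchi p.2) (flat_exp _) (dflat_exp _) (half_power _) ha.
move: (hdot p p) s_gt0 sp hs => s s_gt0 sp hs.
move=> c c' e e' f ha t ka d thd d0 dpi dE he' he hc' hc.
have fs : f ^+ 2 * s ^+ n <= 1.
  rewrite ha mulrC ler_pdivrMr ?exprn_gt0// mul1r lerXn2r ?nnegrE ?ltW//.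
  by rewrite ltrDl.
(* T1 carries the derivative of the critical power, T2 that of the radial cut-off and T3 that of
   [chi]. *)
pose T1 := t / d * s * (- (n%:R / 2) / (s + sg) * (f * e * c)).
pose T2 := t / d * s * (- f * e' * n%:R * s ^+ n.-1 / s0 ^+ n * c).
pose T3 := t / d * s * (- ((f * e) * c' / 2 * ka)).
have b1 : T1 ^+ 2 <= (pi * n%:R) ^+ 2 * ((f * e * c) ^+ 2 / d ^+ 2) by exact: main_term_le.
have b2 : T2 ^+ 2 <= 32 * pi * n%:R ^+ 2 / s0 ^+ n.
  by apply: cutoff_term_le => //; rewrite s_gt0.
have b3 : T3 ^+ 2 <= 16 * s0 * (f * e) ^+ 2.
  by apply: (@vertical_term_le _ t d s s0 ka (f * e) c') => //; rewrite s_gt0.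
have hV : 0 < h^-1 by rewrite invr_gt0.
have -> : t / d * s * (2 * (- (n%:R / 2) / (s + sg) * f * e - f * e' * n%:R * s ^+ n.-1 / s0 ^+ n) *
   c / 2 - f * e * c' / 2 * ka) = T1 + T2 + T3.
  rewrite /T1 /T2 /T3; move: (s ^+ n.-1) (s0 ^+ n)^-1 => x y.
  by field; rewrite !gt_eqF.
apply: (le_trans (sqr_sum3_le T1 T2 T3 h0)); apply: lerD.
  by rewrite ler_wpM2l// addr_ge0// ltW.
by rewrite ler_wpM2l ?lerD// mulr_ge0// addr_ge0// ltW.
Qed.

End test_function_energy.

Section test_function_integrals.
Context {R : realType} {n : nat}.
Notation mu := (@heis_measure R n).
Implicit Types (p q v w : heis R n).
Hypothesis n1 : (1 <= n)%N.
Variables s0 sg : R.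
Hypotheses (s0_gt0 : 0 < s0) (s0_le1 : s0 <= 1) (sg_gt0 : 0 < sg).
Local Notation tf := (@test_fun R n s0 sg).
Local Notation prf := (@profile R n s0 sg).
Local Notation slab := (@slab R n s0).

Lemma slab_coord a b p i : slab a b p -> `|p.1.1 0 i| <= 1 /\ `|p.1.2 0 i| <= 1.
Proof.
move=> [sp _]; have : p.1.1 0 i ^+ 2 + p.1.2 0 i ^+ 2 <= 1.
  apply: (le_trans _ s0_le1); apply: (le_trans _ sp).
  rewrite /hdot (bigD1 i)//= -!expr2 lerDl.
  by apply: sumr_ge0 => j _; rewrite addr_ge0// -expr2 sqr_ge0.
have := sqr_ge0 (p.1.1 0 i); have := sqr_ge0 (p.1.2 0 i).
move: (p.1.1 0 i) (p.1.2 0 i) => x y hy hx xy.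
by split; rewrite -[_ <= _](@expr_le1 _ 2)// real_normK ?num_real//; lra.
Qed.

Lemma slab_norm a b p : 1 <= a -> b <= 2 -> slab a b p -> `|p| <= 3.
Proof.
move=> a1 b2 sp; apply/ltW/heis_norm_lt => // [i|].
  by have [h1 h2] := slab_coord i sp; split; [apply: (le_lt_trans h1)|apply: (le_lt_trans h2)]; lra.
by have [_ /andP[h1 h2]] := sp; rewrite ger0_norm; lra.
Qed.

Lemma closed_slab a b : closed (slab a b).
Proof.
rewrite (_ : slab a b = (fun p => hdot p p) @^-1` [set x | x <= s0] `&`
   ((fun p => p.2) @^-1` [set x | a <= x] `&` (fun p => p.2) @^-1` [set x | x <= b])).
  apply: closedI; last apply: closedI.
  - by apply: (@closed_comp _ _ (fun p => hdot p p)) => [p _|]; [exact: continuous_hdot_id|exact: closed_le].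
  - by apply: (@closed_comp _ _ (fun p => p.2)) => [p _|]; [exact: continuous_zcoord|exact: closed_ge].
  - by apply: (@closed_comp _ _ (fun p => p.2)) => [p _|]; [exact: continuous_zcoord|exact: closed_le].
apply/seteqP; split => p /=; first by move=> [h1 /andP[h2 h3]].
by move=> [h1 [h2 h3]]; split => //; apply/andP.
Qed.

Lemma measurable_slab a b : measurable (slab a b).
Proof.
rewrite -[X in measurable X]setCK; apply: measurableC; apply: open_measurable_heis.
by rewrite openC; exact: closed_slab.
Qed.

Lemma compact_slab : compact (slab 1 2).
Proof.
pose cube := [set x : 'rV[R]_n | forall i, `[(-1)%R, 1%R]%classic (x ord0 i)].
have cc : compact cube.
  exact: (@rV_compact R n (fun=> `[(-1)%R, 1%R]%classic) (fun=> @segment_compact R (-1) 1)).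
have cp := compact_setX (compact_setX cc cc) (@segment_compact R 1 2).
apply: (@subclosed_compact (heis R n) _ _ (@closed_slab 1 2) cp).
move=> p sp; have [_ z12] := sp; split; first split.
- by move=> i /=; have [h _] := slab_coord i sp; rewrite in_itv/= -ler_norml.
- by move=> i /=; have [_ h] := slab_coord i sp; rewrite in_itv/= -ler_norml.
- by rewrite /= in_itv.
Qed.

Lemma test_fun_test_functions (O : set (heis R n)) : slab 1 2 `<=` O ->
  test_functions O tf /\ tf <> cst 0.
Proof.
move=> KO; have clK : closure [set p | tf p != 0] `<=` slab 1 2.
  rewrite [X in _ `<=` X](closure_id _).1; last exact: closed_slab.
  apply: closure_subset => p /= tp; apply: contrapT => np.
  by move/eqP: tp; apply; exact: test_fun_out np.
split; first split.
- by move=> k; exact: Cn_test_fun.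
- by exact: (@subclosed_compact (heis R n) _ _ (@closed_closure _ _) compact_slab clK).
- exact: subset_trans KO.
(* The test function is positive at this point of the centre, halfway up the slab. *)
move=> /(congr1 (fun f => f (0, 0, 3 / 2))); rewrite /test_fun /=.
have -> : hdot (0, 0, 3 / 2) (0, 0, 3 / 2) = 0 :> R.
  by move=> m; rewrite /hdot big1// => i _; rewrite !mxE mulr0 addr0.
have h1 : 0 < chi (3 / 2 : R).
  apply: (lt_le_trans (expR_gt0 (- 6))); apply: chi_lower; apply/andP; split; lra.
have h2 : 0 < prf 0.
  rewrite /profile mulr_gt0 ?half_power_gt0// mul0r expr0n -[n == 0%N]negbK -lt0n n1 subr0.
  by apply: (lt_le_trans (expR_gt0 (- 1^-1))); exact: flat_exp_lower.
by apply/eqP; rewrite gt_eqF// mulr_gt0.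
Qed.

Definition profile_slab a b p : R := prf (hdot p p) ^+ 2 * \1_(slab a b) p.

Lemma profile_slab_ge0 a b p : 0 <= profile_slab a b p.
Proof. by rewrite mulr_ge0 ?sqr_ge0// indicE. Qed.

Lemma integrable_profile_slab a b : 1 <= a -> b <= 2 ->
  mu.-integrable setT (EFin \o profile_slab a b).
Proof.
move=> a1 b2; apply: (@integrable_bounded_support _ _ R mu [set p | `|p| <= 3] _ (sg ^+ n)^-1).
- exact: measurable_norm_le.
- exact: norm_le_measure.
- apply: measurable_funM; last exact: measurable_indic (measurable_slab a b).
  apply: continuous_measurable_fun_heis => p.
  have cs : {for hdot p p, continuous prf}.
    apply/differentiable_continuous/derivable1_diffP.
    by have [] := is_derive_profile (n := n) s0 sg_gt0 (hdot_ge0 p).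
  have cp : {for p, continuous (prf \o (fun p => hdot p p))}.
    by apply: continuous_comp => //; exact: continuous_hdot_id.
  by apply: cvgM; exact: cp.
- move=> p _; rewrite ger0_norm ?profile_slab_ge0// -[leRHS]mulr1.
  apply: ler_pM; rewrite ?sqr_ge0 ?indicE//; last by case: (_ \in _).
  by apply: profile_sq_le => //; exact: hdot_ge0.
- move=> p np; rewrite /profile_slab indicE memNset ?mulr0//.
  by move=> sp; apply: np; exact: slab_norm sp.
Qed.

Definition profile_mass a b : R := fine (\int[mu]_p (profile_slab a b p)%:E)%E.

Lemma profile_massE a b : 1 <= a -> b <= 2 ->
  (\int[mu]_p (profile_slab a b p)%:E = (profile_mass a b)%:E)%E.
Proof.
move=> a1 b2; rewrite fineK//; exact: (integrable_fin_num measurableT (integrable_profile_slab a1 b2)).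
Qed.

Lemma slab_measure : mu (slab 1 2) = (fine (mu (slab 1 2)))%:E.
Proof.
have h : (mu (slab 1 2) <= mu [set p : heis R n | (`|p| <= 3)%R])%E.
  apply: le_measure; rewrite ?inE.
  - exact: measurable_slab.
  - exact: measurable_norm_le.
  - by move=> p sp; exact: slab_norm sp.
have hoo := le_lt_trans h (@norm_le_measure R n 3).
by rewrite fineK// ge0_fin_numE.
Qed.

Lemma profile_mass_shift a b c : 1 <= a -> b <= 2 -> 1 <= a + c -> b + c <= 2 ->
  profile_mass (a + c) (b + c) = profile_mass a b.
Proof.
move=> a1 b2 ac bc; apply: EFin_inj; rewrite -!profile_massE//.
have h := integral_measure_preserving (heis_measure_shift (0, 0, c)) (integrable_profile_slab ac bc).
rewrite -h; apply: eq_integral => p _; congr EFin.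
have hE : hdot (p + (0, 0, c)) (p + (0, 0, c)) = hdot p p.
  by apply: eq_bigr => i _; rewrite !mxE !addr0.
rewrite /profile_slab hE; congr (_ * _); rewrite !indicE; congr (_%:R); congr nat_of_bool.
by apply/idP/idP; rewrite !inE /slab /= hE !lerD2r.
Qed.

(** The profile does not depend on z, so vertical translation gives the three thirds equal mass. The
    errors live on the whole slab, whereas [chi] is bounded below only on the middle third. *)
Lemma profile_mass_thirds : profile_mass 1 2 <= 3 * profile_mass (4 / 3) (5 / 3).
Proof.
have [a1 a2 a3 a4] : [/\ 1 <= 4 / 3 :> R, 4 / 3 <= 2 :> R, 5 / 3 <= 2 :> R & 1 <= 5 / 3 :> R].
  by split; lra.
have [b1 b2 b3] : [/\ 1 + 1 / 3 = 4 / 3 :> R, 4 / 3 + 1 / 3 = 5 / 3 :> R & 5 / 3 + 1 / 3 = 2 :> R].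
  by split; lra.
have e1 : profile_mass 1 (4 / 3) = profile_mass (4 / 3) (5 / 3).
  by have := @profile_mass_shift 1 (4 / 3) (1 / 3); rewrite b1 b2 => ->.
have e2 : profile_mass (5 / 3) 2 = profile_mass (4 / 3) (5 / 3).
  by have := @profile_mass_shift (4 / 3) (5 / 3) (1 / 3); rewrite b2 b3 => ->.
have -> : 3 * profile_mass (4 / 3) (5 / 3) =
  profile_mass 1 (4 / 3) + profile_mass (4 / 3) (5 / 3) + profile_mass (5 / 3) 2.
  by rewrite e1 e2; ring.
have i2 := integrable_profile_slab (lexx 1) a2; have i3 := integrable_profile_slab a1 a3.
have i4 := integrable_profile_slab a4 (lexx 2).
have i23 := integrableD measurableT i2 i3.
rewrite -lee_fin !EFinD -!profile_massE//.
have -> : (\int[mu]_p (profile_slab 1 (4 / 3) p)%:E + \int[mu]_p (profile_slab (4 / 3) (5 / 3) p)%:E +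
    \int[mu]_p (profile_slab (5 / 3) 2 p)%:E = \int[mu]_p ((profile_slab 1 (4 / 3) p)%:E +
    (profile_slab (4 / 3) (5 / 3) p)%:E + (profile_slab (5 / 3) 2 p)%:E))%E.
  by rewrite -(integralD measurableT i2 i3) -(integralD measurableT i23 i4).
apply: ge0_le_integral_nonmeasurable => p _; first by rewrite lee_fin profile_slab_ge0.
rewrite -!EFinD lee_fin /profile_slab -!mulrDr ler_wpM2l ?sqr_ge0// !indicE.
have [|_] := boolP (p \in slab 1 2); last by rewrite !addr_ge0.
rewrite inE => -[sp /andP[z1 z2]].
have [za|za] := leP p.2 (4 / 3).
  by rewrite [X in (nat_of_bool X)%:R + _ + _]mem_set; [rewrite -addrA lerDl addr_ge0|split => //; rewrite z1].
have [zb|zb] := leP p.2 (5 / 3).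
  by rewrite [X in _ + (nat_of_bool X)%:R + _]mem_set; [rewrite addrAC lerDr addr_ge0|split => //; rewrite zb ltW].
by rewrite [X in _ + _ + (nat_of_bool X)%:R]mem_set; [rewrite lerDr addr_ge0|split => //; rewrite z2 ltW].
Qed.

End test_function_integrals.

(** * Logarithmic divergence of the mass *)

Section dyadic_divergence.
Context {R : realType} {n : nat}.
Notation mu := (@heis_measure R n).
Implicit Types (p q : heis R n).
Hypothesis n1 : (1 <= n)%N.
Variables s0 : R.
Hypotheses (s0_gt0 : 0 < s0) (s0_le1 : s0 <= 1).

(** The factor 1 / (4 n) confines all the boxes to [hdot p p <= s0 / 2], where the radial cut-off is
    bounded below. *)
Definition dyadic_radius (k : nat) : R := s0 / (4 * n%:R) * 2^-1 ^+ k.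

Let nR : 1 <= n%:R :> R. Proof. by rewrite ler1n. Qed.

Let r_gt0 k : 0 < dyadic_radius k.
Proof.
by rewrite mulr_gt0 ?exprn_gt0// divr_gt0// mulr_gt0// (lt_le_trans _ nR).
Qed.

Let nr_gt0 (c : R) k : 0 < c -> 0 < c * n%:R * dyadic_radius k ^+ 2.
Proof.
by move=> c0; apply: mulr_gt0; [rewrite mulr_gt0// (lt_le_trans _ nR)|rewrite exprn_gt0].
Qed.

Lemma dyadic_radius_lt j k : (j < k)%N -> dyadic_radius k <= dyadic_radius j / 2.
Proof.
move=> jk; rewrite /dyadic_radius; set c := s0 / _.
have -> : c * 2^-1 ^+ j / 2 = c * 2^-1 ^+ j.+1 by rewrite exprSr mulrA.
rewrite ler_pM2l.
  by apply: ler_wiXn2l => //; rewrite ?invr_ge0// invf_le1// ler1n.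
by rewrite divr_gt0// mulr_gt0// (lt_le_trans _ nR).
Qed.

(** The lower end 3/4 exceeds the ratio 1/2 of successive radii, which makes the boxes disjoint. *)
Definition dyadic_box k : set (heis R n) :=
  [set p : heis R n | (forall i, p.1.1 0 i \in `[3 / 4 * dyadic_radius k, dyadic_radius k]) /\
    (forall i, p.1.2 0 i \in `[3 / 4 * dyadic_radius k, dyadic_radius k]) /\
    p.2 \in `[4 / 3, 5 / 3]].

Lemma dyadic_box_measure k :
  mu (dyadic_box k) = ((dyadic_radius k ^+ 2 / 16) ^+ n / 3)%:E.
Proof.
have r0 := r_gt0 k.
have [h1 h2] : 3 / 4 * dyadic_radius k <= dyadic_radius k /\ 4 / 3 <= 5 / 3 :> R by split; lra.
rewrite (heis_box_measure h1 h1 h2).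
have -> : 5 / 3 - 4 / 3 = 3^-1 :> R by lra.
by rewrite -exprMn; congr (_ ^+ n * _)%:E; field.
Qed.

Lemma dyadic_box_disjoint j k : (j < k)%N -> dyadic_box j `&` dyadic_box k = set0.
Proof.
move=> jk; apply/seteqP; split => // p [[h _] [g _]].
have := h (Ordinal n1); have := g (Ordinal n1); rewrite !in_itv/= => /andP[_ a] /andP[b _].
have := dyadic_radius_lt jk; have := r_gt0 j.
by move: (dyadic_radius j) (dyadic_radius k) a b => x y; lra.
Qed.

Lemma hdot_dyadic_box k p : dyadic_box k p -> hdot p p <= 2 * n%:R * dyadic_radius k ^+ 2.
Proof.
move=> [hx [hy _]]; have r0 := r_gt0 k.
have sq (x : R) : x \in `[3 / 4 * dyadic_radius k, dyadic_radius k] -> x * x <= dyadic_radius k ^+ 2.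
  rewrite in_itv/= => /andP[a b]; have x0 : 0 <= x by apply: le_trans a; rewrite mulr_ge0// ltW.
  by rewrite expr2; apply: ler_pM.
apply: (@le_trans _ _ (\sum_(i < n) 2 * dyadic_radius k ^+ 2)).
  by apply: ler_sum => i _; rewrite mulr_natl mulr2n lerD ?sq.
by rewrite sumr_const card_ord -[leLHS]mulr_natl mulrCA mulrA.
Qed.

Lemma dyadic_radius_small k : 2 * n%:R * dyadic_radius k ^+ 2 <= s0 / 2.
Proof.
have n0 : 0 < n%:R :> R by rewrite (lt_le_trans _ nR).
have h : dyadic_radius k ^+ 2 <= (s0 / (4 * n%:R)) ^+ 2.
  rewrite lerXn2r ?nnegrE ?(ltW (r_gt0 k))//; first by rewrite divr_ge0 ?mulr_ge0// ltW.
  by rewrite /dyadic_radius ler_piMr ?divr_ge0 ?mulr_ge0 ?(ltW s0_gt0)// exprn_ile1 ?invr_ge0// invf_le1// ler1n.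
apply: (@le_trans _ _ (2 * n%:R * (s0 / (4 * n%:R)) ^+ 2)).
  by rewrite ler_wpM2l// mulr_ge0.
have -> : 2 * n%:R * (s0 / (4 * n%:R)) ^+ 2 = (s0 / 2) * (s0 / (4 * n%:R)) by field; rewrite gt_eqF.
rewrite ler_piMr ?divr_ge0 ?(ltW s0_gt0)// ler_pdivrMr ?mulr_gt0// mul1r.
by apply: (le_trans s0_le1); move: nR; lra.
Qed.

(** On box k both [hdot p p] and the shift sg are at most 2 n r_k^2, and the cut-off is at least exp
    (-2) because its argument is at least 1 / 2. *)
Lemma profile_dyadic (N k : nat) p : (k < N)%N -> dyadic_box k p ->
  expR (- 2) ^+ 2 / (4 * n%:R * dyadic_radius k ^+ 2) ^+ n <=
  profile_slab s0 (2 * n%:R * dyadic_radius N ^+ 2) (4 / 3) (5 / 3) p.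
Proof.
move=> kN bp; have [_ [_ z]] := bp; rewrite in_itv/= in z.
have n0 : 0 < n%:R :> R by rewrite (lt_le_trans _ nR).
have hs := hdot_dyadic_box bp; have hs0 := dyadic_radius_small k.
have ss : hdot p p <= s0 / 2 := le_trans hs hs0.
have s2 : hdot p p <= s0 by apply: (le_trans ss); move: s0_gt0; lra.
rewrite /profile_slab indicE mem_set ?mulr1; last by split.
have sg0 : 0 < 2 * n%:R * dyadic_radius N ^+ 2 by exact: nr_gt0.
have sp : 0 < hdot p p + 2 * n%:R * dyadic_radius N ^+ 2 by rewrite ltr_wpDl ?hdot_ge0.
rewrite (profile_sqE _ sp).
have b : hdot p p + 2 * n%:R * dyadic_radius N ^+ 2 <= 4 * n%:R * dyadic_radius k ^+ 2.
  have -> : 4 * n%:R * dyadic_radius k ^+ 2 =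
    2 * n%:R * dyadic_radius k ^+ 2 + 2 * n%:R * dyadic_radius k ^+ 2 by ring.
  apply: lerD => //; rewrite ler_wpM2l ?mulr_ge0 ?(ltW n0)//.
  rewrite lerXn2r ?nnegrE ?(ltW (r_gt0 _))//.
  by apply: (le_trans (dyadic_radius_lt kN)); have := r_gt0 k; lra.
have b0 := lt_le_trans sp b.
apply: ler_pM; rewrite ?exprn_ge0 ?expR_ge0// ?invr_ge0 ?exprn_ge0 ?(ltW b0)//; last first.
  by rewrite lef_pV2 ?posrE ?exprn_gt0// lerXn2r ?nnegrE ?(ltW sp) ?(ltW b0).
have i2 : (1 / 2)^-1 = 2 :> R by rewrite div1r invrK.
rewrite lerXn2r ?nnegrE ?expR_ge0//; first by have /andP[] := flat_exp_bounds (1 - (hdot p p / s0) ^+ n).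
have x0 : 0 <= hdot p p / s0 by rewrite divr_ge0 ?hdot_ge0// ltW.
have x2 : hdot p p / s0 <= 1 / 2 by rewrite ler_pdivrMr// mulrC mul1r.
have xn : (hdot p p / s0) ^+ n <= 1 / 2.
  move: x0 x2; move: (hdot p p / s0) => y y0 y2; apply: (le_trans _ y2).
  have y1 : y <= 1 by lra.
  by rewrite -(prednK n1) exprS ler_piMr// exprn_ile1.
by rewrite -i2; apply: flat_exp_lower; move: xn; lra.
Qed.

(** At the critical power the volume of box k, of order r_k^(2n), cancels the size of the squared
    profile. All N boxes thus contribute the same amount, and N is of order ln (1 / sg). *)
Lemma profile_mass_dyadic (N : nat) :
  N%:R * (expR (- 2) ^+ 2 / (64 * n%:R) ^+ n / 3) <=
  profile_mass (n := n) s0 (2 * n%:R * dyadic_radius N ^+ 2) (4 / 3) (5 / 3).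
Proof.
have n0 : 0 < n%:R :> R by rewrite (lt_le_trans _ nR).
have sg0 : 0 < 2 * n%:R * dyadic_radius N ^+ 2 by exact: nr_gt0.
have [a1 a3] : 1 <= 4 / 3 :> R /\ 5 / 3 <= 2 :> R by split; lra.
rewrite -lee_fin -profile_massE//.
set F := profile_slab _ _ _ _.
have F0 p : 0 <= F p by exact: profile_slab_ge0.
have iF : mu.-integrable setT (EFin \o F) by exact: integrable_profile_slab.
have mF : measurable_fun setT (EFin \o F) by case/integrableP : iF.
pose D := \big[setU/set0]_(k <- iota 0 N) dyadic_box k.
have mB k : measurable (dyadic_box k) by exact: measurable_heis_box.
apply: (@le_trans _ _ (\int[mu]_(p in D) (F p)%:E)%E); last first.
  by apply: (@ge0_subset_integral_nonmeasurable _ _ R mu) => // p _; rewrite lee_fin.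
rewrite (@ge0_integral_bigsetU _ _ R mu _ dyadic_box (EFin \o F) (iota 0 N))//=; first last.
- by move=> p _; rewrite lee_fin.
- exact: measurable_funTS.
- apply/trivIsetP => j k _ _ jk.
  by have [lt|lt|e] := ltngtP j k; [exact: dyadic_box_disjoint|rewrite setIC; exact: dyadic_box_disjoint|rewrite e eqxx in jk].
- exact: iota_uniq.
apply: (@le_trans _ _ (\sum_(k <- iota 0 N) (expR (- 2) ^+ 2 / (64 * n%:R) ^+ n / 3)%:E)%E).
  rewrite sumEFin lee_fin big_const_seq count_predT size_iota iter_addr_0.
  by rewrite mulr_natl.
rewrite [leLHS]big_seq [leRHS]big_seq; apply: lee_sum => k; rewrite mem_iota add0n => /andP[_ kN].
have r0 := r_gt0 k.
pose c : R := expR (- 2) ^+ 2 / (4 * n%:R * dyadic_radius k ^+ 2) ^+ n.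
apply: (@le_trans _ _ (\int[mu]_(p in dyadic_box k) (cst c%:E p))%E).
  have ic : (\int[mu]_(p in dyadic_box k) cst c%:E p = c%:E * mu (dyadic_box k))%E.
    exact: (@integral_cst _ _ R mu (dyadic_box k) (mB k) c%:E).
  rewrite ic dyadic_box_measure -EFinM lee_fin /c.
  have -> : (64 * n%:R : R) = 4 * n%:R * dyadic_radius k ^+ 2 / (dyadic_radius k ^+ 2 / 16).
    by field; rewrite gt_eqF.
  have A0 : 0 < 4 * n%:R * dyadic_radius k ^+ 2 by exact: nr_gt0.
  have B0 : 0 < dyadic_radius k ^+ 2 / 16 by rewrite divr_gt0// exprn_gt0.
  rewrite [X in _ / X / 3]expr_div_n; move: (exprn_gt0 n A0) (exprn_gt0 n B0) (expR (- 2) ^+ 2).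
  move: (_ ^+ n) (_ ^+ n) => A B A1 B1 E.
  by rewrite le_eqVlt; apply/orP; left; apply/eqP; field; rewrite !gt_eqF.
apply: ge0_le_integral_nonmeasurable => p bp; rewrite /= lee_fin.
  by rewrite divr_ge0// exprn_ge0 ?expR_ge0// ltW// nr_gt0.
exact: profile_dyadic kN bp.
Qed.

End dyadic_divergence.

Section upper_bound.
Context {R : realType} {n : nat}.
Notation mu := (@heis_measure R n).
Implicit Types (p q : heis R n).
Variable O : set (heis R n).
Hypotheses (n1 : (1 <= n)%N) (O0 : O `<=` [set p | 0 < p.2]).

Section fixed_parameters.
Variables s0 sg : R.
Hypotheses (s0_gt0 : 0 < s0) (s0_le1 : s0 <= 1) (sg_gt0 : 0 < sg).
Hypothesis slabO : slab s0 1 2 `<=` O.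
Local Notation tf := (@test_fun R n s0 sg).

Lemma test_fun_energy_le (h B : R) : 0 < h ->
  (\int[mu]_p (hardy_weight tf p)%:E = B%:E)%E ->
  (\int[mu]_(p in O) (hnorm (hgrad_perp tf p) ^+ 2)%:E <=
   ((1 + h) * ((pi * n%:R) ^+ 2 * B) + 2 * (1 + h^-1) *
    (32 * pi * n%:R ^+ 2 / s0 ^+ n * fine (mu (slab s0 1 2)) +
     16 * s0 * profile_mass (n := n) s0 sg 1 2))%:E)%E.
Proof.
move=> h0 BE; have [tt _] := test_fun_test_functions n1 s0_gt0 s0_le1 sg_gt0 slabO.
have iw := integrable_hardy_weight O0 tt.
have ig := integrable_profile_slab (n := n) s0_le1 sg_gt0 (lexx 1) (lexx 2).
have is1 : mu.-integrable setT (EFin \o (\1_(@slab R n s0 1 2) : heis R n -> R)).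
  apply: (@integrable_bounded_support _ _ R mu [set p | `|p| <= 3] _ 1).
  - exact: measurable_norm_le.
  - exact: norm_le_measure.
  - exact: measurable_indic (measurable_slab s0 1 2).
  - by move=> p _; rewrite indicE; case: (_ \in _); rewrite ?normr1// normr0.
  - by move=> p np; rewrite indicE memNset// => sp; apply: np; exact: slab_norm sp.
set c1 := (1 + h) * (pi * n%:R) ^+ 2; set c2 := 2 * (1 + h^-1) * (32 * pi * n%:R ^+ 2 / s0 ^+ n).
set c3 := 2 * (1 + h^-1) * (16 * s0).
have hV : 0 < h^-1 by rewrite invr_gt0.
have c10 : 0 <= c1 by apply: mulr_ge0; [rewrite addr_ge0// ltW|exact: sqr_ge0].
have H0 : 0 <= 2 * (1 + h^-1) by rewrite mulr_ge0// addr_ge0// ltW.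
have c20 : 0 <= c2.
  by apply: mulr_ge0 => //; rewrite divr_ge0 ?exprn_ge0 ?(ltW s0_gt0)// mulr_ge0 ?exprn_ge0// mulr_ge0// pi_ge0.
have c30 : 0 <= c3 by apply: mulr_ge0 => //; rewrite mulr_ge0// ltW.
pose F p : R := c1 * hardy_weight tf p + c2 * \1_(slab s0 1 2) p + c3 * profile_slab s0 sg 1 2 p.
have F0 p : 0 <= F p.
  by rewrite !addr_ge0// mulr_ge0 ?hardy_weight_ge0 ?profile_slab_ge0// indicE.
have -> : ((1 + h) * ((pi * n%:R) ^+ 2 * B) + 2 * (1 + h^-1) *
    (32 * pi * n%:R ^+ 2 / s0 ^+ n * fine (mu (slab s0 1 2)) +
     16 * s0 * profile_mass (n := n) s0 sg 1 2))%:E = (\int[mu]_p (F p)%:E)%E.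
  have j1 := integrableZl measurableT c1 iw; have j2 := integrableZl measurableT c2 is1.
  have j3 := integrableZl measurableT c3 ig.
  have j12 := integrableD measurableT j1 j2.
  have -> : (\int[mu]_p (F p)%:E = c1%:E * \int[mu]_p (hardy_weight tf p)%:E +
     c2%:E * \int[mu]_p (\1_(slab s0 1 2) p)%:E + c3%:E * \int[mu]_p (profile_slab s0 sg 1 2 p)%:E)%E.
    rewrite -(integralZl measurableT iw) -(integralZl measurableT is1) -(integralZl measurableT ig).
    by rewrite -(integralD measurableT j1 j2) -(integralD measurableT j12 j3).
  have e2 : (\int[mu]_p (\1_(slab s0 1 2) p)%:E = (fine (mu (slab s0 1 2)))%:E)%E.
    rewrite -slab_measure//; have := integral_indic mu measurableT (measurable_slab (n := n) s0 1 2).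
    by rewrite setIT.
  rewrite BE e2 profile_massE// -!EFinM -!EFinD; congr EFin; rewrite /c1 /c2 /c3; ring.
have H1 p : O p -> (0 <= (hnorm (hgrad_perp tf p) ^+ 2)%:E)%E by move=> _; rewrite lee_fin sqr_ge0.
rewrite (ge0_integral_axes H1).
apply: (@le_trans _ _ (\int[mu]_(p in O `\` axes) (F p)%:E)%E); last first.
  by apply: (@ge0_subset_integral_nonmeasurable _ _ R mu) => // p _; rewrite lee_fin.
apply: ge0_le_integral_nonmeasurable => p [Op Np]; first exact: H1.
have Up : noncentral p by apply: noncentral_axes => //; exact: O0.
rewrite lee_fin; apply: (le_trans (test_fun_perp_le n1 s0_gt0 sg_gt0 h0 Up)).
rewrite /F /profile_slab /c1 /c2 /c3 le_eqVlt; apply/orP; left; apply/eqP.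
by move: (hardy_weight _ _) (profile _ _ _) (\1_ _ _) => a b c; ring.
Qed.

(** On the middle third [chi] is at least exp (-6), and [sqdist_le] with z <= 2 and s <= 1 gives
    delta^2 <= 8 pi + 1. *)
Lemma test_fun_mass_ge (B : R) :
  (\int[mu]_p (hardy_weight tf p)%:E = B%:E)%E ->
  expR (- 6) ^+ 2 / (8 * pi + 1) * profile_mass (n := n) s0 sg (4 / 3) (5 / 3) <= B.
Proof.
move=> BE; set c := expR (- 6) ^+ 2 / _.
have [a1 a3] : 1 <= 4 / 3 :> R /\ 5 / 3 <= 2 :> R by split; lra.
have ig := integrable_profile_slab (n := n) s0_le1 sg_gt0 a1 a3.
have p8 : 0 < 8 * pi + 1 :> R by rewrite addr_gt0// mulr_gt0// pi_gt0.
have c0 : 0 <= c by rewrite divr_ge0 ?sqr_ge0// ltW.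
have Zl : (c%:E * \int[mu]_p (profile_slab s0 sg (4 / 3) (5 / 3) p)%:E =
    \int[mu]_p (c%:E * (profile_slab s0 sg (4 / 3) (5 / 3) p)%:E))%E.
  exact: esym (integralZl measurableT ig c).
rewrite -lee_fin -BE EFinM -(profile_massE s0_le1 sg_gt0 a1 a3) Zl.
have g0 p : setT p -> (0 <= c%:E * (profile_slab s0 sg (4 / 3) (5 / 3) p)%:E)%E.
  by move=> _; rewrite -EFinM lee_fin mulr_ge0// profile_slab_ge0.
have w0 p : setT p -> (0 <= (hardy_weight tf p)%:E)%E by move=> _; rewrite lee_fin hardy_weight_ge0.
rewrite (ge0_integral_axes g0) (ge0_integral_axes w0).
apply: ge0_le_integral_nonmeasurable => p [_ Np]; first exact: g0.
rewrite /= -EFinM lee_fin /profile_slab indicE.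
have [|_] := boolP (p \in _); last by rewrite !mulr0 hardy_weight_ge0.
rewrite inE mulr1 => -[sp zp]; have [z1 z2] := andP zp.
have Up : noncentral p by apply: noncentral_axes => //; lra.
rewrite /hardy_weight patchE mem_set// /test_fun; move: (profile _ _ _) => y; rewrite exprMn.
have -> : c * y ^+ 2 = y ^+ 2 * (expR (- 6) ^+ 2 / (8 * pi + 1)).
  by rewrite mulrC.
rewrite -[leRHS]mulrA. apply: ler_wpM2l; first exact: sqr_ge0.
have e6 : 0 <= expR (- 6) :> R by exact: expR_ge0.
have ch := chi_lower zp.
apply: ler_pM; rewrite ?sqr_ge0 ?invr_ge0 ?(ltW p8)//.
  by rewrite lerXn2r ?nnegrE// (le_trans e6 ch).
rewrite lef_pV2 ?posrE// ?exprn_gt0 ?ccdist_gt0// ccdist_sq//.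
apply: (le_trans (sqdist_le Up)); apply: lerD; last exact: le_trans s0_le1.
have -> : 8 * pi = 4 * pi * 2 :> R by ring.
by apply: ler_wpM2l; [rewrite mulr_ge0// pi_ge0|lra].
Qed.

End fixed_parameters.

Lemma hardy_upper (s1 : R) : 0 < s1 -> slab s1 1 2 `<=` O ->
  (ereal_inf [set
    ((\int[mu]_(p in O) (hnorm (hgrad_perp u p) ^+ 2)%:E) /
     (\int[mu]_(p in O) (`|u p| ^+ 2 / ccdist p ^+ 2)%:E))%E
    | u in test_functions O `&` [set u | u <> cst 0%R]] <= (pi ^+ 2 * n%:R ^+ 2)%:E)%E.
Proof.
move=> s1_gt0 s1O; apply/lee_addgt0Pr => e e0.
have n0 : 0 < n%:R :> R by rewrite ltr0n.
have pn : 0 < (pi * n%:R) ^+ 2 :> R by rewrite exprn_gt0// mulr_gt0// pi_gt0.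
(* The excess e is shared equally: h pays for the weight of the main term, s0 for the vertical term
   and N for the cut-off term. N comes last because its error C depends on s0. *)
pose h : R := e / (3 * (pi * n%:R) ^+ 2).
have h0 : 0 < h by rewrite divr_gt0// mulr_gt0.
pose L : R := 2 * (1 + h^-1).
have L0 : 0 < L by rewrite mulr_gt0// addr_gt0// invr_gt0.
pose c : R := expR (- 6) ^+ 2 / (8 * pi + 1).
have c0 : 0 < c by rewrite divr_gt0 ?exprn_gt0 ?expR_gt0// addr_gt0// mulr_gt0// pi_gt0.
(* 48 is the 16 of [vertical_term_le] times the 3 of [profile_mass_thirds]. *)
pose s0 : R := Num.min (Num.min s1 1) (e * c / (3 * 48 * L)).
have s00 : 0 < s0.
  by rewrite !lt_min s1_gt0 ltr01/=; apply: divr_gt0; [exact: mulr_gt0|apply: mulr_gt0].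
have s01 : s0 <= 1 by rewrite !ge_min lexx orbT.
have s0s1 : s0 <= s1 by rewrite !ge_min lexx.
have s0e : L * (48 * s0) <= e / 3 * c.
  have : s0 <= e * c / (3 * 48 * L) by rewrite !ge_min lexx !orbT.
  have D : 0 < 3 * 48 * L by rewrite mulr_gt0.
  rewrite (ler_pdivlMr _ _ D) => le.
  have -> : L * (48 * s0) = s0 * (3 * 48 * L) / 3 by field.
  by rewrite [leRHS]mulrAC ler_pM2r ?invr_gt0.
have KO : slab s0 1 2 `<=` O by move=> p [sp zp]; apply: s1O; split => //; exact: le_trans s0s1.
pose C : R := 32 * pi * n%:R ^+ 2 / s0 ^+ n * fine (mu (slab s0 1 2)).
pose k : R := expR (- 2) ^+ 2 / (64 * n%:R) ^+ n / 3.
have k0 : 0 < k by rewrite divr_gt0// divr_gt0 ?exprn_gt0 ?expR_gt0// mulr_gt0.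
pose N := Num.bound `|3 * L * C / (e * c * k)|.
have NC : L * C <= e / 3 * (c * (N%:R * k)).
  have /ltW : 3 * L * C / (e * c * k) < N%:R.
    by apply: (le_lt_trans (ler_norm _)); exact: (archi_boundP (normr_ge0 _)).
  have D : 0 < e * c * k by apply: mulr_gt0; [exact: mulr_gt0|].
  rewrite (ler_pdivrMr _ _ D) => le.
  have -> : e / 3 * (c * (N%:R * k)) = N%:R * (e * c * k) / 3 by field.
  rewrite ler_pdivlMr//; apply: le_trans le.
  by have -> : L * C * 3 = 3 * L * C by ring.
pose sg : R := 2 * n%:R * @dyadic_radius R n s0 N ^+ 2.
have sg0 : 0 < sg.
  apply: mulr_gt0; first exact: mulr_gt0.
  apply: exprn_gt0; apply: mulr_gt0; last by rewrite exprn_gt0.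
  by apply: divr_gt0 => //; exact: mulr_gt0.
have [tt tn0] := test_fun_test_functions n1 s00 s01 sg0 KO.
have [B B0 BE] := hardy_denominator_gt0 n1 O0 tt tn0.
have wB := hardy_denominatorE n1 O0 tt; rewrite BE in wB; have {}wB := esym wB.
apply: ge_ereal_inf; eexists; first by exists (test_fun s0 sg); [split|reflexivity].
rewrite BE inver gt_eqF// lee_pdivrMr// -EFinD -EFinM.
apply: (le_trans (test_fun_energy_le s00 s01 sg0 KO h0 wB)); rewrite lee_fin.
have m1 := test_fun_mass_ge s01 sg0 wB; rewrite -/c in m1.
have m2 := profile_mass_dyadic n1 s00 s01 N; rewrite -/k -/sg in m2.
have m3 := profile_mass_thirds (n := n) s01 sg0.
rewrite -/L -/C; move: (profile_mass _ _ _ _) (profile_mass _ _ _ _) m1 m2 m3 => J I m1 m2 m3.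
have t1 : h * ((pi * n%:R) ^+ 2 * B) = e / 3 * B.
  by rewrite /h; move: pn; move: ((pi * n%:R) ^+ 2) => X X0; field; rewrite gt_eqF.
have t2 : L * C <= e / 3 * B.
  apply: (le_trans NC); rewrite ler_pM2l ?divr_gt0//; apply: le_trans m1.
  by rewrite ler_pM2l.
have t3 : L * (16 * s0 * J) <= e / 3 * B.
  apply: (@le_trans _ _ (L * (48 * s0) * I)).
    have -> : L * (48 * s0) * I = L * (16 * s0 * (3 * I)) by ring.
    apply: ler_wpM2l; first exact: ltW.
    by apply: ler_wpM2l => //; apply: mulr_ge0 => //; exact: ltW.
  have I0 : 0 <= I by apply: le_trans m2; apply: mulr_ge0 => //; exact: ltW.
  apply: (@le_trans _ _ (e / 3 * c * I)); first by rewrite ler_wpM2r.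
  by rewrite -mulrA ler_pM2l// divr_gt0.
have -> : (1 + h) * ((pi * n%:R) ^+ 2 * B) + L * (C + 16 * s0 * J) =
  (pi * n%:R) ^+ 2 * B + h * ((pi * n%:R) ^+ 2 * B) + L * C + L * (16 * s0 * J) by ring.
have -> : (pi ^+ 2 * n%:R ^+ 2 + e) * B = (pi * n%:R) ^+ 2 * B + e / 3 * B + e / 3 * B + e / 3 * B by field.
by rewrite t1; apply: lerD => //; apply: lerD.
Qed.

End upper_bound.

(** * Cones over spherical caps *)

Section cap_parameters.
Context {R : realType} {n : nat}.
Implicit Types (p q : heis R n) (Sigma : set (heis R n)).

Lemma hdot_dilation (l : R) p : hdot (dilation l p) (dilation l p) = l ^+ 2 * hdot p p.
Proof.
by rewrite /hdot mulr_sumr; apply: eq_bigr => i _; rewrite !mxE; ring.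
Qed.

(** The right side is invariant under dilations. On the unit sphere s = 1 - z^2, and the difference
    of its two sides factors as (z - h) (1 + h z). *)
Lemma cone_capE (h : R) p : 0 <= h < 1 ->
  cone (upper_hemisphere `&` [set p | h < p.2]) p <-> h * hdot p p < (1 - h ^+ 2) * p.2 /\ 0 < p.2.
Proof.
move=> /andP[h0 h1].
have key (s z : R) : s + z ^+ 2 = 1 -> 0 < z -> (h * s < (1 - h ^+ 2) * z) = (h < z).
  move=> sz z0; have -> : s = 1 - z ^+ 2 by rewrite -sz addrK.
  rewrite -subr_gt0 -[RHS]subr_gt0.
  have -> : (1 - h ^+ 2) * z - h * (1 - z ^+ 2) = (z - h) * (1 + h * z) by ring.
  by rewrite pmulr_lgt0// ltr_pwDl// mulr_ge0// ltW.
split=> [[l /= l0 [q [[q1 q0] hq]] <-]|[hp p0]].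
  rewrite hdot_dilation /=; rewrite sqnormE in q1.
  have l2 : 0 < l ^+ 2 by rewrite exprn_gt0.
  split; last exact: mulr_gt0.
  by rewrite mulrCA [X in _ < X]mulrCA ltr_pM2l// key.
set s := hdot p p in hp *; set z := p.2 in hp p0 *.
have s0 : 0 <= s := hdot_ge0 p.
(* The positive root of m^2 = s m + z^2: dilating p by the inverse of l = sqrt m puts it on the unit
   sphere. *)
pose m := (s + Num.sqrt (s ^+ 2 + 4 * z ^+ 2)) / 2.
have z2 : 0 < z ^+ 2 by rewrite exprn_gt0.
have d0 : 0 < s ^+ 2 + 4 * z ^+ 2 by rewrite ltr_wpDl ?sqr_ge0// mulr_gt0.
have m0 : 0 < m by rewrite divr_gt0// ltr_wpDl// sqrtr_gt0.
have mE : s * m + z ^+ 2 = m ^+ 2.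
  have := sqr_sqrtr (ltW d0); rewrite /m; move: (Num.sqrt _) => r rE.
  have -> : z ^+ 2 = (r ^+ 2 - s ^+ 2) / 4 by rewrite rE; field.
  by field.
pose l := Num.sqrt m; have l0 : 0 < l by rewrite sqrtr_gt0.
have l2 : l ^+ 2 = m by rewrite sqr_sqrtr// ltW.
exists l => //; exists (dilation l^-1 p); last first.
  rewrite /dilation /= !scalerA mulfV ?gt_eqF// !scale1r mulrA -exprMn mulfV ?gt_eqF//.
  by rewrite expr1n mul1r -!surjective_pairing.
have sq : hdot (dilation l^-1 p) (dilation l^-1 p) = s / m.
  by rewrite hdot_dilation exprVn l2 mulrC.
have zq : (dilation l^-1 p).2 = z / m by rewrite /= exprVn l2 mulrC.
have zq0 : 0 < z / m by rewrite divr_gt0.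
have one : s / m + (z / m) ^+ 2 = 1.
  have -> : s / m + (z / m) ^+ 2 = (s * m + z ^+ 2) / m ^+ 2 by field; rewrite gt_eqF.
  by rewrite mE divff// gt_eqF// exprn_gt0.
split; first by split; [rewrite sqnormE sq zq|rewrite zq].
suff : h < (dilation l^-1 p).2 by [].
by rewrite zq -(key _ _ one zq0) !mulrA ltr_pM2r// invr_gt0.
Qed.

(** By [cone_capE] the parameter can be taken as (1 - h^2) / h, or infinite for the full hemisphere
    h = 0. *)
Lemma cap_alphaP Sigma : spherical_cap Sigma ->
  (0 < cap_alpha Sigma)%E /\ cone Sigma = paraboloid (cap_alpha Sigma).
Proof.
move=> [h /andP[h0 h1] ->].
suff : exists a, (0 < a)%E /\ cone (upper_hemisphere `&` [set p : heis R n | h < p.2]) = paraboloid a.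
  by move=> /getPex.
have hE p := cone_capE p (introT andP (conj h0 h1)).
move: h0; rewrite le_eqVlt => /predU1P[h0|h0].
  exists +oo%E; split => //; apply/seteqP; split => p.
    by move=> /hE[].
  by move=> p0; apply/hE; split => //; rewrite -h0 mul0r expr0n subr0 mul1r.
have hh : 0 < 1 - h ^+ 2 by rewrite subr_gt0 expr_lt1// ltW.
exists ((1 - h ^+ 2) / h)%:E; split; first by rewrite lte_fin divr_gt0.
have E p : (sqnorm p.1.1 + sqnorm p.1.2 < (1 - h ^+ 2) / h * p.2) = (h * hdot p p < (1 - h ^+ 2) * p.2).
  by rewrite sqnormE mulrAC ltr_pdivlMr// mulrC.
apply/seteqP; split => p; first by move=> /hE[hp _]; rewrite /= E.
rewrite /= E => hp; apply/hE; split => //.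
rewrite -(pmulr_rgt0 _ hh); apply: le_lt_trans hp.
by rewrite mulr_ge0 ?hdot_ge0// ltW.
Qed.

Lemma paraboloid_gt0 (a : \bar R) : (0 < a)%E ->
  paraboloid a `<=` [set p : heis R n | 0 < p.2].
Proof.
case: a => [a|_|] //; rewrite lte_fin => a0 p /=; rewrite sqnormE => sp.
by rewrite -(pmulr_rgt0 _ a0); apply: le_lt_trans sp; exact: hdot_ge0.
Qed.

(** Every cone contains a thin tube around the segment of the centre between heights 1 and 2, which
    leaves room for the test functions. *)
Lemma slab_paraboloid (a : \bar R) : (0 < a)%E ->
  exists2 s1 : R, 0 < s1 & slab s1 1 2 `<=` paraboloid (n := n) a.
Proof.
case: a => [a|_|] //; last first.
  by exists 1 => // p [_ /andP[z1 _]] /=; exact: lt_le_trans z1.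
rewrite lte_fin => a0; exists (a / 2) => [|p [sp /andP[z1 _]] /=]; first exact: divr_gt0.
rewrite sqnormE; apply: (le_lt_trans sp); apply: (@lt_le_trans _ _ a).
  by rewrite ltr_pdivrMr// mulr_natr mulr2n ltrDl.
by rewrite ler_peMr// ltW.
Qed.

Lemma phi_arc_ratio (r : R) : 0 < r -> phi r = (arc_ratio r)^-1%:E.
Proof.
by move=> r0; rewrite /phi gt_eqF// /arc_ratio invf_div.
Qed.

Lemma cap_rhoP Sigma : spherical_cap Sigma ->
  0 <= cap_rho Sigma <= 2 * pi /\ phi (cap_rho Sigma) = cap_alpha Sigma.
Proof.
move=> /cap_alphaP[a0 _].
suff : exists r, 0 <= r <= 2 * pi /\ phi r = cap_alpha Sigma by move=> /getPex.
move: (cap_alpha Sigma) a0 => [a|_|] //; last first.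
  by exists 0; rewrite /phi eqxx lexx mulr_ge0// pi_ge0.
rewrite lte_fin => a0; have aV : 0 < a^-1 by rewrite invr_gt0.
have [r rd rE] := arc_ratio_surj aV; have /andP[r0 r2] := rd.
by exists r; rewrite (ltW r0) (ltW r2) phi_arc_ratio// rE invrK.
Qed.

(** Membership in the cone says that z / (|x|^2 + |y|^2) exceeds 1 / alpha, which is [arc_ratio] at
    rho when rho > 0; monotonicity compares the angles. *)
Lemma cap_rho_le_arc_angle Sigma p : spherical_cap Sigma -> cone Sigma p ->
  noncentral p -> cap_rho Sigma <= arc_angle p.
Proof.
move=> cS; have [a0 ->] := cap_alphaP cS; have [/andP[r0 r2] rE] := cap_rhoP cS.
move: (cap_rho Sigma) r0 r2 rE => r; rewrite le_eqVlt => /predU1P[<- _ _ _ Up|r0 r2].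
  by have [/andP[/ltW]] := arc_angleP Up.
rewrite phi_arc_ratio// => rE; rewrite -rE in a0 *; rewrite lte_fin in a0.
rewrite /= sqnormE => sp Up; have [thd thE] := arc_angleP Up; have [/= sp0 zp0] := Up.
rewrite leNgt; apply/negP => lt.
(* At 2 pi the denominator 1 - cos vanishes and both inverses take their default value 0, so alpha
   would be 0, against its positivity. *)
have rpi : r < 2 * pi.
  rewrite lt_neqAle r2 andbT; apply/eqP => rr; move: a0.
  by rewrite rr /arc_ratio mulr_natl cos2pi subrr mulr0 invr0 mulr0 invr0 ltxx.
have /andP[th0 _] := thd.
have := arc_ratio_incr th0 lt rpi; rewrite thE.
have ar0 : 0 < arc_ratio r by rewrite -invr_gt0.
rewrite ltr_pdivrMr// => h; rewrite ltr_pdivlMl// in sp.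
by have := lt_trans h sp; rewrite ltxx.
Qed.

End cap_parameters.

Theorem theorem2 (R : realType) (n : nat) (Sigma : set (heis R n)) :
  (1 <= n)%N -> spherical_cap Sigma ->
  ((n%:R ^+ 2 * cap_rho Sigma ^+ 2 / 4)%:E <= c_perp Sigma)%E /\
  (c_perp Sigma <= (pi ^+ 2 * n%:R ^+ 2)%:E)%E.
Proof.
move=> n1 cS; have [a0 coneE] := cap_alphaP cS.
have O0 : cone Sigma `<=` [set p | 0 < p.2] by rewrite coneE; exact: paraboloid_gt0.
have [/andP[r0 _] _] := cap_rhoP cS.
split; rewrite /c_perp.
  apply: le_ereal_inf_tmp => _ [u [tu un0] <-].
  have := hardy_lower n1 O0 r0 (fun p => cap_rho_le_arc_angle cS (p := p)) tu un0.
  have -> : (n%:R * cap_rho Sigma / 2) ^+ 2 = n%:R ^+ 2 * cap_rho Sigma ^+ 2 / 4 by field.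
  by [].
have [s1 s10 s1O] := slab_paraboloid (n := n) a0; rewrite -coneE in s1O.
exact: hardy_upper s10 s1O.
Qed.
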